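(* For each integer $b\ge0$ and each band $j$ ($1\le j\le p$), there is an integer $D_{b,j}$ so that the number of zeros $N_{b,j}(m)$ of $p_{mp+b-1}$ in band $j$ is either $m-D_{b,j}$ or $m-D_{b,j}+1$. In particular, $$\sup_{n,j}\Bigl|\frac np-N^{(n,j)}\Bigr|<\infty .$$ Moreover, letting $x^{(n,j)}_1<x^{(n,j)}_2<\dots<x^{(n,j)}_{N^{(n,j)}}$ be the zeros of $p_n$ in band $j$, $$\sup_{\substack{1\le j\le p\\ \ell=1,\dots,N^{(n,j)}-1}} n\,\Bigl|k\bigl(x^{(n,j)}_{\ell+1}\bigr)-k\bigl(x^{(n,j)}_\ell\bigr)-\frac1n\Bigr|\longrightarrow0\quad\text{as } n\to\infty .$$
   Context: Let $p\ge 1$ and let $\{a_n\}_{n\ge1}$, $\{b_n\}_{n\ge1}$ be real sequences with $a_n>0$, $a_{n+p}=a_n$, $b_{n+p}=b_n$. The orthonormal polynomials $p_n$ are defined by $p_{-1}\equiv0$, $p_0\equiv1$, $xp_n(x)=a_{n+1}p_{n+1}(x)+b_{n+1}p_n(x)+a_np_{n-1}(x)$ for $n\ge0$ (with $a_0:=a_p$). Let $A_k(z)=\frac1{a_{k+1}}\begin{pmatrix} z-b_{k+1}&-a_k\\ a_{k+1}&0\end{pmatrix}$, $T_n(z)=A_{n-1}(z)\cdots A_0(z)$, and $\Delta(z)=\mathrm{Tr}(T_p(z))$, a polynomial of degree $p$. The set $\{z\in\mathbb C:\Delta(z)\in(-2,2)\}$ is a union of $p$ disjoint open real intervals $(\alpha_j,\beta_j)$,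 with $\alpha_1<\beta_1\le\alpha_2<\beta_2\le\cdots\le\alpha_p<\beta_p$. Band $j$ is $[\alpha_j,\beta_j]$, and $N^{(n,j)}$ is the number of zeros of $p_n$ in band $j$. $dk$ is the (probability) logarithmic-potential-theoretic equilibrium measure of $B=\bigcup_{j=1}^p[\alpha_j,\beta_j]$, and $k(x)=\int_{\alpha_1}^x dk$.
   Formalization: The claim that the number of zeros N_{b,j}(m) is m−D_{b,j} or m−D_{b,j}+1 is stated only for all sufficiently large m; for all m≥1 it fails, e.g. p=3, a=(3/4,1/2,11/4), b=(3/2,1/2,−1/4), band 2, zeros of p_{3m}: N(1)≥1 but N(2)=0. *)

(* Defs.v *)
From HB Require Import structures.
From mathcomp Require Import all_boot all_order all_algebra.
From mathcomp Require Import polyrcf complex.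
From mathcomp Require Import all_classical all_reals all_analysis.

Set Implicit Arguments.
Unset Strict Implicit.
Unset Printing Implicit Defensive.

Import Order.TTheory GRing.Theory Num.Theory.
Import numFieldNormedType.Exports.

Local Open Scope classical_set_scope.
Local Open Scope ring_scope.

Section PeriodicJacobi.
Variable R : realType.
Implicit Types (a b alpha beta : nat -> R) (p n k j : nat).

(* The sequences are indexed from 1; [a 0] carries the convention a_0 := a_p,
   and [b 0] is never used in the definitions below. *)
Definition periodic_jacobi p a b : Prop :=
  [/\ forall n, (1 <= n)%N -> 0 < a n,
      forall n, (1 <= n)%N -> a (n + p)%N = a n,
      forall n, (1 <= n)%N -> b (n + p)%N = b n &
      a 0%N = a p].

(* The pair (p_n, p_{n-1}), with p_{-1} = 0. *)
Fixpoint opoly2 a b n : {poly R} * {poly R} :=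
  if n is m.+1 then
    let: (q, r) := opoly2 a b m in
    ((a m.+1)^-1 *: (('X - (b m.+1)%:P) * q - a m *: r), q)
  else (1, 0).

Definition opoly a b n : {poly R} := (opoly2 a b n).1.

(* The matrices below have entries in R[z]. *)
Definition step_mx a b k : 'M[{poly R}]_2 :=
  ((a k.+1)^-1)%:P *:
  \matrix_(i < 2, j < 2)
     nth 0 (nth [::] [:: [:: 'X - (b k.+1)%:P ; - (a k)%:P ];
                         [:: (a k.+1)%:P      ; 0          ]] i) j.

Fixpoint transfer_mx a b n : 'M[{poly R}]_2 :=
  if n is m.+1 then step_mx a b m *m transfer_mx a b m else 1%:M.

Definition discriminant p a b : {poly R} := \tr (transfer_mx a b p).

Definition band_index p : set nat := [set j | (1 <= j <= p)%N].

(* [alpha] and [beta] are only constrained, and only used, on 1, ..., p; there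
   they are uniquely determined by the discriminant, since the intervals are
   the connected components of the set on the left-hand side. *)
Definition are_bands p a b alpha beta : Prop :=
  [/\ forall j, (1 <= j <= p)%N -> alpha j < beta j,
      forall j, (1 <= j < p)%N -> beta j <= alpha j.+1 &
      [set z : R[i] | exists2 t : R, -2 < t < 2 &
         (map_poly (real_complex R) (discriminant p a b)).[z]
           = real_complex R t]
      = \bigcup_(j in band_index p)
          (real_complex R @` [set` `]alpha j, beta j[ ])].

Definition band_union p alpha beta : set R :=
  \bigcup_(j in band_index p) [set` `[alpha j, beta j] ].

(* The zeros of p_n in the closed band j, in increasing order. *)
Definition band_zeros a b alpha beta n j : seq R :=
  [seq x <- rootsR (opoly a b n) | x \in `[alpha j, beta j] ].

Definition num_zeros a b alpha beta n j : nat :=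
  size (band_zeros a b alpha beta n j).

(* [lne] is -oo at 0, so the kernel is +oo on the diagonal. *)
Definition log_energy (B : set R) (mu : probability (measurableTypeR R) R) : \bar R :=
  (\int[mu]_(x in B) \int[mu]_(y in B) (- lne (`|x - y|%:E)))%E.

Definition equilibrium_measure (B : set R) (mu : probability (measurableTypeR R) R) : Prop :=
  mu B = 1%E /\
  forall nu : probability (measurableTypeR R) R,
    nu B = 1%E -> (log_energy B mu <= log_energy B nu)%E.

Definition eq_cdf alpha (dk : probability (measurableTypeR R) R) (x : R) : R :=
  \int[dk]_(t in [set` `[alpha 1%N, x] ]) 1.

(* x_(l+1) and x_l, for 1 <= l < num_zeros, are the entries of (0-based) ranks
   l and l - 1 in [band_zeros]. *)
Definition spacing_error a b alpha beta (dk : probability (measurableTypeR R) R) n j l : R :=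
  let x := band_zeros a b alpha beta n j in
  n%:R * `|eq_cdf alpha dk x`_l - eq_cdf alpha dk x`_l.-1 - n%:R^-1|.

End PeriodicJacobi.

(* Main.v *)
(* Write q_m for p_(r + m p) and r < p, and Delta = 2 cos theta on a band.  Along m the
   polynomials satisfy q_(m+2) = Delta q_(m+1) - q_m, hence
     sin theta q_m = f sin (m theta) + v sin theta cos (m theta),
   with f, v independent of m.  Dividing by the square root of N = f^2 + v^2 sin^2 theta
   gives a unit vector whose components extend continuously to the closed band, so that
   for large m consecutive zeros of q_m, at which the value of the next polynomial changes
   sign, are at distance pi / m + o (1 / m) in theta.  On the other hand dk is the image of
   the normalised measure d theta / pi, summed over the bands and divided by p: the
   logarithmic potential of this measure is constant on the bands, being an affine function
   of the mean over theta of log |Delta (x) - 2 cos theta|; and a measure of minimal energy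
   is unique, because after adding functions of one variable the kernel
   - log |x - y| is a sum of products g (x) g (y).  Hence k grows by
   |theta - theta'| / (pi p) along a band.

   For the number of zeros, Sturm's argument writes the number of zeros of p_n above x as
   the number of k < n at which (p_k (x), p_(k+1) (x)) changes sign.  At a band edge
   Delta = +- 2, so +- q_m is affine in m, and the signs become periodic in n with period p,
   up to a common sign; thus n -> n + p adds a fixed number of zeros above each edge and in
   each band.  In a band that number is at least 1, as p_(m p) = (-1) ^ k at
   theta = k pi / m, and the numbers over all bands sum to at most p, so each is 1. *)
Require Import Defs.
From HB Require Import structures.
From mathcomp Require Import all_boot all_order all_algebra.
From mathcomp Require Import polyrcf complex.
From mathcomp Require Import all_classical all_reals all_analysis.
From mathcomp Require Import measurable_realfun ring lra zify.

Set Implicit Arguments.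
Unset Strict Implicit.
Unset Printing Implicit Defensive.

Import Order.TTheory GRing.Theory Num.Theory.
Import numFieldNormedType.Exports.

Local Open Scope classical_set_scope.
Local Open Scope ring_scope.

(** * Orthogonal polynomials and the monodromy matrix *)

(** The obstacle is uniformity up to the band edges. The amplitude may vanish at an edge, where the
    unit vector becomes a quotient 0/0. Boundedness lets it be extended, but its value is also
    needed when p_(r + m p) has a zero at the edge itself. For large m this forces p_r and p_(r + p)
    to vanish there, hence also an entry C of the period matrix. As C is an orthogonal polynomial of
    a shifted sequence, its zero is simple and the limit, sign included, can be computed. Uniform
    continuity then gives the o (1 / m): over an angle of order 1 / m the unit vector hardly turns,
    while (sin, cos) (m theta) makes half a turn. For the energy, nothing is known about the
    integrability of the logarithm against the given minimiser. It is compared only with truncations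
    of the kernel, which increase to it and have continuous terms. The outcome is equality of the
    means of all powers of x / (s^2 + x^2), a function increasing on [-s, s], so distribution
    functions agree. Delta is inverted on a band without derivatives: as Delta - t has only real
    roots, Delta has no local extremum with value in (-2, 2). *)

Section OrthogonalPolynomials.
Variable R : realType.
Implicit Types (a b : nat -> R) (n m r k p : nat) (x : R).

Lemma opoly2E a b n : opoly2 a b n.+1 = (opoly a b n.+1, opoly a b n).
Proof. by rewrite /opoly /=; case: (opoly2 a b n). Qed.

Lemma opoly0 a b : opoly a b 0 = 1.
Proof. by []. Qed.

Lemma opoly1 a b : opoly a b 1 = (a 1%N)^-1 *: ('X - (b 1%N)%:P).
Proof. by rewrite /opoly /= scaler0 subr0 mulr1. Qed.

Lemma opolySS a b n : opoly a b n.+2 =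
  (a n.+2)^-1 *: (('X - (b n.+2)%:P) * opoly a b n.+1 - a n.+1 *: opoly a b n).
Proof.
by have -> : opoly a b n.+2 = (let: (q, r) := opoly2 a b n.+1 in
  ((a n.+2)^-1 *: (('X - (b n.+2)%:P) * q - a n.+1 *: r), q)).1
  by []; rewrite opoly2E.
Qed.

Definition wronskian a b n : {poly R} :=
  (opoly a b n.+1)^`() * opoly a b n - opoly a b n.+1 * (opoly a b n)^`().

Section Positive.
Variables (a b : nat -> R).
Hypothesis a_gt0 : forall n, (1 <= n)%N -> 0 < a n.

(** The confluent Christoffel-Darboux recursion: iterated, it makes [a n.+1 *: wronskian a b n] the
    sum of the squares of p_0, ..., p_n. Simplicity of zeros, coprimality and interlacing of
    consecutive polynomials all come from this positivity. *)
Lemma wronskianS n : a n.+2 *: wronskian a b n.+1 =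
  opoly a b n.+1 ^+ 2 + a n.+1 *: wronskian a b n.
Proof.
rewrite /wronskian opolySS; set P := opoly a b n.+1; set Q := opoly a b n.
have a0 : a n.+2 != 0 by rewrite gt_eqF// a_gt0.
rewrite derivZ derivB derivM derivB derivX derivC derivZ.
rewrite -!scalerAl -scalerBr scalerA divff // scale1r.
rewrite -!mul_polyC; ring.
Qed.

Lemma wronskian_gt0 n x : 0 < (wronskian a b n).[x].
Proof.
elim: n => [|n IH].
  rewrite /wronskian opoly0 opoly1 derivZ derivB derivX derivC.
  by rewrite subr0 mulr1 -polyC1 derivC mulr0 subr0 !hornerE invr_gt0 a_gt0.
have := congr1 (horner^~ x) (wronskianS n).
rewrite hornerD !hornerZ horner_exp => E.
have : 0 < a n.+2 * (wronskian a b n.+1).[x].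
  by rewrite E ltr_wpDl ?sqr_ge0 // mulr_gt0 // a_gt0.
by rewrite pmulr_rgt0 // a_gt0.
Qed.

Lemma wronskianE n x : (wronskian a b n).[x] =
  (opoly a b n.+1)^`().[x] * (opoly a b n).[x] -
  (opoly a b n.+1).[x] * (opoly a b n)^`().[x].
Proof. by rewrite /wronskian !hornerE. Qed.

Lemma opoly_coprime n x : (opoly a b n).[x] = 0 -> (opoly a b n.+1).[x] != 0.
Proof.
move=> P0; apply/eqP => P1; have := wronskian_gt0 n x.
by rewrite wronskianE P0 P1 mulr0 mul0r subr0 ltxx.
Qed.

Lemma opoly_simple n x : (opoly a b n).[x] = 0 -> (opoly a b n)^`().[x] != 0.
Proof.
case: n => [|n] P0; first by move: P0; rewrite opoly0 hornerC => /eqP; rewrite oner_eq0.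
apply/eqP => P1; have := wronskian_gt0 n x.
by rewrite wronskianE P0 P1 !mul0r subr0 ltxx.
Qed.

Lemma opoly_size_lead n :
  size (opoly a b n) = n.+1 /\ 0 < lead_coef (opoly a b n).
Proof.
have [] : (size (opoly a b n) = n.+1 /\ 0 < lead_coef (opoly a b n)) /\
       (size (opoly a b n.+1) = n.+2 /\ 0 < lead_coef (opoly a b n.+1)); last by [].
elim: n => [|n [[sP lP] [sQ lQ]]].
  rewrite opoly0 opoly1 size_poly1 lead_coefC ltr01 lead_coefZ lead_coefXsubC.
  have a0 : 0 < (a 1%N)^-1 by rewrite invr_gt0 a_gt0.
  by rewrite mulr1 size_scale ?gt_eqF // size_XsubC.
split=> //; have a0 : 0 < (a n.+2)^-1 by rewrite invr_gt0 a_gt0.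
have Q0 : opoly a b n.+1 != 0 by rewrite -size_poly_gt0 sQ.
have sM : size (('X - (b n.+2)%:P) * opoly a b n.+1) = n.+3.
  by rewrite size_mul ?polyXsubC_eq0 // size_XsubC sQ.
have lt : (size (- (a n.+1 *: opoly a b n)) <
           size (('X - (b n.+2)%:P) * opoly a b n.+1)%R)%N.
  by rewrite size_polyN sM (leq_ltn_trans (size_scale_leq _ _)) // sP.
rewrite opolySS size_scale ?gt_eqF // lead_coefZ size_polyDl // sM; split=> //.
by rewrite lead_coefDl // lead_coefM lead_coefXsubC mul1r mulr_gt0.
Qed.

Lemma size_opoly n : size (opoly a b n) = n.+1.
Proof. by case: (opoly_size_lead n). Qed.

Lemma lead_opoly_gt0 n : 0 < lead_coef (opoly a b n).
Proof. by case: (opoly_size_lead n). Qed.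

Lemma opoly_neq0 n : opoly a b n != 0.
Proof. by rewrite -size_poly_gt0 size_opoly. Qed.

End Positive.

(** Restarts the recursion at site [r]: the period matrix based at [r] is a transfer matrix of the
    shifted sequences. *)
Definition shift_seq r (f : nat -> R) n := f (n + r)%N.

Lemma step_mx_shift a b r n :
  step_mx (shift_seq r a) (shift_seq r b) n = step_mx a b (n + r).
Proof. by []. Qed.

Lemma transfer_mxD a b n r : transfer_mx a b (n + r) =
  transfer_mx (shift_seq r a) (shift_seq r b) n *m transfer_mx a b r.
Proof.
elim: n => [|n IH]; first by rewrite mul1mx.
by rewrite addSn /= IH mulmxA step_mx_shift.
Qed.

Lemma step_mxE a b k (i j : 'I_2) : step_mx a b k i j =
  if (i == 0) then (if j == 0 then (a k.+1)^-1 *: ('X - (b k.+1)%:P)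
                    else - ((a k.+1)^-1 * a k)%:P)
  else (if j == 0 then ((a k.+1)^-1 * a k.+1)%:P else 0).
Proof.
rewrite !mxE; case: i => -[|[]] //= hi; case: j => -[|[]] //= hj; rewrite -?mul_polyC ?polyCM //.
  by rewrite mulrN.
by rewrite mulr0.
Qed.

Lemma transfer_col0 a b n : (forall n, (1 <= n)%N -> 0 < a n) ->
  transfer_mx a b n 0 0 = opoly a b n /\
  transfer_mx a b n.+1 1 0 = opoly a b n.
Proof.
move=> a0.
have st1 k : transfer_mx a b k.+1 1 0 = transfer_mx a b k 0 0.
  rewrite /= !mxE !big_ord_recl big_ord0 !step_mxE /= mul0r !addr0.
  by rewrite mulVf ?mul1r ?gt_eqF ?a0 //.
have st0 k : transfer_mx a b k.+1 0 0 = (a k.+1)^-1 *: 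
   (('X - (b k.+1)%:P) * transfer_mx a b k 0 0 - a k *: transfer_mx a b k 1 0).
  rewrite /= !mxE !big_ord_recl big_ord0 !step_mxE /= addr0.
  have -> : lift ord0 ord0 = 1 :> 'I_2 by apply: val_inj.
  by rewrite polyCM -!mul_polyC; ring.
suff [E _] : transfer_mx a b n 0 0 = opoly a b n /\
  transfer_mx a b n.+1 0 0 = opoly a b n.+1 by rewrite st1.
elim: n => [|n [IH1 IH2]].
  by rewrite st0 /= !mxE /= opoly1 scaler0 subr0 mulr1.
by split=> //; rewrite st0 st1 IH1 IH2 opolySS.
Qed.

Lemma det_mx22 (T : comPzRingType) (M : 'M[T]_2) :
  \det M = M 0 0 * M 1 1 - M 0 1 * M 1 0.
Proof.
rewrite (expand_det_row _ ord0) !big_ord_recl big_ord0 addr0 /cofactor !det_mx11.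
rewrite !mxE !lift0 /= expr0 expr1 mul1r mulN1r mulrN.
by do !f_equal; apply: val_inj.
Qed.

Lemma det_step a b k : (forall n, (1 <= n)%N -> 0 < a n) ->
  \det (step_mx a b k) = (a k / a k.+1)%:P.
Proof.
move=> a0; rewrite det_mx22 !step_mxE /= mulr0 sub0r mulVf ?gt_eqF ?a0 //.
by rewrite mulr1 opprK mulrC.
Qed.

Lemma det_transfer a b n : (forall n, (1 <= n)%N -> 0 < a n) -> a 0%N != 0 ->
  \det (transfer_mx a b n) = (a 0%N / a n)%:P.
Proof.
move=> a0 a00; elim: n => [|n IH]; first by rewrite det1 divff.
rewrite /= det_mulmx IH det_step // -polyCM; congr _%:P.
have : a n != 0 by case: n {IH} => // n; rewrite gt_eqF ?a0.
have : a n.+1 != 0 by rewrite gt_eqF ?a0.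
by move=> ??; field; apply/andP.
Qed.

Section Periodic.
Variables (p : nat) (a b : nat -> R).
Hypothesis p_gt0 : (1 <= p)%N.
Hypothesis jac : periodic_jacobi p a b.

Let a_gt0 n : (1 <= n)%N -> 0 < a n.
Proof. by case: jac => h _ _ _; apply: h. Qed.

Let aD n : a (n + p)%N = a n.
Proof. by case: jac => _ h _ h0; case: n => [|n]; [rewrite add0n h0|apply: h]. Qed.

Let step_mxD k : step_mx a b (k + p) = step_mx a b k.
Proof.
case: jac => _ _ h _; rewrite /step_mx -addSn (h k.+1) //.
by rewrite !aD.
Qed.

Let monodromy r := transfer_mx (shift_seq r a) (shift_seq r b) p.

Lemma shift_gt0 r n : (1 <= n)%N -> 0 < shift_seq r a n.
Proof. by move=> n0; apply: a_gt0; rewrite addn_gt0 n0. Qed.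

(** Moving the base site by one conjugates the matrix by a step matrix: the factor at [r] leaves on
    one side and, by periodicity, returns on the other. Cyclicity of the trace does the rest. *)
Let trace_monodromy r : \tr (monodromy r) = discriminant p a b.
Proof.
elim: r => [|r <-].
  rewrite /monodromy /discriminant; congr (\tr (transfer_mx _ _ _)).
  - by apply/funext => n; rewrite /shift_seq addn0.
  - by apply/funext => n; rewrite /shift_seq addn0.
have sh f : shift_seq 1 (shift_seq r f) = shift_seq r.+1 f :> (nat -> R).
  by apply/funext => n; rewrite /shift_seq addn1 addSnnS.
have mS q : transfer_mx (shift_seq r a) (shift_seq r b) q.+1 =
    transfer_mx (shift_seq r.+1 a) (shift_seq r.+1 b) q *m step_mx a b r.
  by rewrite -[q.+1]addn1 transfer_mxD !sh /= mulmx1 step_mx_shift.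
rewrite /monodromy; have := step_mxD r.
case: (p) p_gt0 => // q _ stepD.
by rewrite mS /= step_mx_shift addnS -addSn addnC stepD mxtrace_mulC.
Qed.

Let monodromyD r : monodromy (r + p) = monodromy r.
Proof.
rewrite /monodromy; suff E n : transfer_mx (shift_seq (r + p) a) (shift_seq (r + p) b) n =
  transfer_mx (shift_seq r a) (shift_seq r b) n by [].
by elim: n => [//|n /= ->]; rewrite !step_mx_shift addnA step_mxD.
Qed.

Let det_monodromy r : \det (monodromy r) = 1.
Proof.
have a0 : a r != 0.
  by rewrite -(aD r) gt_eqF // a_gt0 // addn_gt0 p_gt0 orbT.
rewrite det_transfer; last 2 first.
- exact: shift_gt0.
- by rewrite /shift_seq add0n.
by rewrite /shift_seq add0n addnC aD divff.
Qed.

(* The monodromy matrix of the recursion between sites [r.+1] and [r.+1 + p]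
   is [A, B; C, D]. *)
Lemma opoly_monodromy r : exists A B C D : {poly R},
  [/\ A + D = discriminant p a b, A * D - B * C = 1,
      forall x, C.[x] = 0 -> C^`().[x] != 0 &
      forall m, opoly a b (r + m * p + p) =
          C * opoly a b (r.+1 + m * p) + D * opoly a b (r + m * p) /\
        opoly a b (r.+1 + m * p + p) =
          A * opoly a b (r.+1 + m * p) + B * opoly a b (r + m * p)].
Proof.
pose M := monodromy r.+1.
exists (M 0 0), (M 0 1), (M 1 0), (M 1 1); split.
- by rewrite -(trace_monodromy r.+1) /mxtrace !big_ord_recl big_ord0 addr0; congr (_ + M _ _); apply: val_inj.
- by rewrite -det_mx22 det_monodromy.
(* [C] is the polynomial of degree p - 1 of the shifted sequences, so its zeros are simple. *)
- have [_] := transfer_col0 (shift_seq r.+1 b) p.-1 (shift_gt0 r.+1).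
  by rewrite prednK // => -> x; apply/opoly_simple/shift_gt0.
- move=> m.
  have MD : monodromy (r.+1 + m * p) = M.
    by elim: m => [|m IH]; rewrite ?addn0 // mulSn addnCA addnC monodromyD.
  have := transfer_mxD a b p (r.+1 + m * p); rewrite -/(monodromy _) MD => E.
  have col k : transfer_mx a b k.+1 0 0 = opoly a b k.+1 /\
               transfer_mx a b k.+1 1 0 = opoly a b k.
    by split; [have [] := transfer_col0 b k.+1 a_gt0|have [] := transfer_col0 b k a_gt0].
  have E1 : lift ord0 ord0 = 1 :> 'I_2 by apply: val_inj.
  have [c1 c2] := col (r + m * p)%N.
  have [d1 d2] := col (r + m * p + p)%N.
  have -> : (r.+1 + m * p = (r + m * p).+1)%N by [].
  have sumE (N : 'M[{poly R}]_2) (i k : 'I_2) : (M *m N) i k = M i 0 * N 0 k + M i 1 * N 1 k.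
    by rewrite mxE !big_ord_recl big_ord0 addr0 E1.
  have -> : ((r + m * p).+1 + p = (r + m * p + p).+1)%N by [].
  rewrite -d1 -d2 -c1 -c2.
  have -> : ((r + m * p + p).+1 = p + (r.+1 + m * p))%N by lia.
  by rewrite E !sumE.
Qed.

(** Cayley-Hamilton for a matrix of determinant 1, applied to (p_(n+1), p_n). *)
Lemma opoly_period2 n : opoly a b (n + p + p) =
  discriminant p a b * opoly a b (n + p) - opoly a b n.
Proof.
have [A [B [C [D [AD det _ E]]]]] := opoly_monodromy n.
have [e1 e2] := E 0; have [e3 _] := E 1.
rewrite !mul0n !addn0 in e1 e2; rewrite !mul1n in e3.
rewrite e3 e2 e1 -AD; rewrite -[X in _ - X]mul1r -det; ring.
Qed.

(** At n = 0 the period recursion reads Delta p_p = p_(2p) + 1, from which the degree and the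
    leading coefficient of Delta follow. *)
Lemma size_discriminant : size (discriminant p a b) = p.+1.
Proof.
have E : discriminant p a b * opoly a b p = opoly a b (p + p) + 1.
  by have := opoly_period2 0; rewrite opoly0 add0n => ->; rewrite subrK.
have s2 : size (opoly a b (p + p) + 1) = (p + p).+1.
  rewrite size_polyDl ?size_poly1 ?(size_opoly b a_gt0) //.
  by rewrite ltnS addn_gt0 p_gt0.
have D0 : discriminant p a b != 0.
  by apply/eqP => D0; move: s2; rewrite -E D0 mul0r size_poly0.
move: s2; rewrite -E size_mul ?(opoly_neq0 b a_gt0) ?(size_opoly b a_gt0) //.
by rewrite addnS /= -addSn => /addIn.
Qed.

Lemma lead_discriminant_gt0 : 0 < lead_coef (discriminant p a b).
Proof.
have E : discriminant p a b * opoly a b p = opoly a b (p + p) + 1.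
  by have := opoly_period2 0; rewrite opoly0 add0n => ->; rewrite subrK.
have : 0 < lead_coef (opoly a b (p + p) + 1).
  rewrite lead_coefDl ?(lead_opoly_gt0 b a_gt0) // ?size_poly1 ?(size_opoly b a_gt0) //.
  by rewrite ltnS addn_gt0 p_gt0.
by rewrite -E lead_coefM pmulr_lgt0 // (lead_opoly_gt0 b a_gt0).
Qed.

(* When [Delta = 2 cos th], the product of [sin th] with P_(r + m p) is a sinusoid in
   [m th] with squared amplitude [amplitude r]; at its zeros, P_(r + 1 + m p) is
   [period_wronskian r] divided by plus or minus the amplitude [sqrt (amplitude r)]. *)
Definition period_wronskian r : {poly R} :=
  opoly a b (r + p) * opoly a b r.+1 - opoly a b r * opoly a b (r.+1 + p).

Definition amplitude r : {poly R} :=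
  opoly a b (r + p) ^+ 2 - discriminant p a b * opoly a b (r + p) * opoly a b r
  + opoly a b r ^+ 2.

(** [C] is the lower left entry of the period matrix. Where it vanishes, A D = 1 and so (A + D)^2 >=
    4; hence it has no zero inside an open band. *)
Lemma amplitude_factor r : exists C : {poly R},
  [/\ amplitude r = C * period_wronskian r,
      forall x, C.[x] = 0 -> C^`().[x] != 0,
      forall x, C.[x] = 0 -> 4 <= (discriminant p a b).[x] ^+ 2 &
      exists A B D : {poly R}, [/\ A + D = discriminant p a b, A * D - B * C = 1,
        opoly a b (r + p) = C * opoly a b r.+1 + D * opoly a b r &
        opoly a b (r.+1 + p) = A * opoly a b r.+1 + B * opoly a b r]].
Proof.
have [A [B [C [D [AD det simpleC E]]]]] := opoly_monodromy r.
have [e1 e2] := E 0; rewrite !mul0n !addn0 in e1 e2.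
exists C; split=> //.
- rewrite /amplitude /period_wronskian e1 e2 -AD.
  by rewrite -[X in _ + X]mul1r -det; ring.
- move=> x C0; have := congr1 (horner^~ x) AD; have := congr1 (horner^~ x) det.
  rewrite !hornerE C0 mulr0 subr0 => dAD <-.
  by have := sqr_ge0 (A.[x] - D.[x]); nra.
- by exists A, B, D.
Qed.

Lemma amplitude_square r x : (amplitude r).[x] =
  ((opoly a b (r + p)).[x] - (discriminant p a b).[x] / 2 * (opoly a b r).[x]) ^+ 2
  + (1 - ((discriminant p a b).[x] / 2) ^+ 2) * (opoly a b r).[x] ^+ 2.
Proof. rewrite /amplitude !(hornerD, hornerN, hornerM, horner_exp). by field. Qed.

(** A sum of two squares: if p_r vanishes, the first one is that of C p_(r+1), which is non-zero by
    coprimality. *)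
Lemma amplitude_gt0 r x : (discriminant p a b).[x] ^+ 2 < 4 -> 0 < (amplitude r).[x].
Proof.
move=> Dx; have [C [_ _ C4 [A [B [D [AD det e1 e2]]]]]] := amplitude_factor r.
have C0 : C.[x] != 0 by apply/eqP => /C4; rewrite leNgt Dx.
rewrite amplitude_square; set f := (X in X ^+ 2 + _).
have [v0|v0] := eqVneq (opoly a b r).[x] 0.
  have u0 := opoly_coprime a_gt0 v0.
  rewrite /f v0 mulr0 subr0 expr0n mulr0 addr0 e1 !hornerE v0 mulr0 addr0.
  by rewrite exprn_even_gt0 // mulf_neq0.
rewrite ltr_wpDl ?sqr_ge0 // mulr_gt0 ?exprn_even_gt0 //.
have := Dx; nra.
Qed.

Lemma period_wronskian_neq0 r x :
  (discriminant p a b).[x] ^+ 2 < 4 -> (period_wronskian r).[x] != 0.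
Proof.
move=> /(amplitude_gt0 r); have [C [-> _ _ _]] := amplitude_factor r.
by rewrite hornerM; apply: contraTneq => ->; rewrite mulr0 ltxx.
Qed.

(** At such an edge the amplitude has a double zero and the normalised vector is a limit 0/0. The
    zero can be divided out because [C] has a simple zero there, and the last inequality fixes the
    sign of the limit. *)
Lemma edge_zero_expansion r x : (discriminant p a b).[x] ^+ 2 = 4 ->
  (opoly a b r).[x] = 0 -> (opoly a b (r + p)).[x] = 0 ->
  exists f Q N : {poly R},
  [/\ opoly a b (r + p) - (2^-1)%:P * discriminant p a b * opoly a b r = ('X - x%:P) * f,
      period_wronskian r = ('X - x%:P) * Q,
      amplitude r = ('X - x%:P) ^+ 2 * N,
      N.[x] = f.[x] ^+ 2 & 0 < f.[x] * (opoly a b r.+1).[x] * Q.[x]].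
Proof.
move=> Dx v0 v10; have [C [NE C1 _ [A [B [D [AD det e1 e2]]]]]] := amplitude_factor r.
have u0 := opoly_coprime a_gt0 v0.
have C0 : C.[x] = 0.
  move: v10; rewrite e1 !hornerE v0 mulr0 addr0 => /eqP.
  by rewrite mulf_eq0 (negbTE u0) orbF => /eqP.
have factor (q : {poly R}) : q.[x] = 0 -> exists q1, q = ('X - x%:P) * q1.
  by move=> /eqP /factor_theorem[q1 ->]; exists q1; rewrite mulrC.
have [Ct CE] := factor _ C0; have [vt vE] := factor _ v0.
have Ct0 : Ct.[x] != 0.
  have := C1 _ C0; rewrite CE derivM derivB derivX derivC subr0 mul1r.
  by rewrite !hornerE subrr mul0r addr0.
have ADx : A.[x] + D.[x] = (discriminant p a b).[x] by rewrite -AD hornerD.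
have detx : A.[x] * D.[x] = 1.
  by have := congr1 (horner^~ x) det; rewrite !hornerE C0 mulr0 subr0.
have AeD : A.[x] = D.[x].
  apply/eqP; rewrite -subr_eq0 -sqrf_eq0; apply/eqP.
  rewrite (_ : _ ^+ 2 = (A.[x] + D.[x]) ^+ 2 - 4 * (A.[x] * D.[x])); last by ring.
  by rewrite ADx Dx detx mulr1 subrr.
set u := opoly a b r.+1.
pose f := Ct * u + D * vt - (2^-1)%:P * discriminant p a b * vt.
pose Q := Ct * u ^+ 2 + D * vt * u - vt * (A * u + B * opoly a b r).
exists f, Q, (Ct * Q).
have QE : period_wronskian r = ('X - x%:P) * Q.
  by rewrite /period_wronskian e1 e2 /Q -/u CE {1 2}vE; ring.
have fx : f.[x] = Ct.[x] * u.[x].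
  by rewrite /f !hornerE -ADx AeD; field.
have Qx : Q.[x] = Ct.[x] * u.[x] ^+ 2.
  by rewrite /Q !(hornerE, horner_exp) v0 mulr0 addr0 AeD; ring.
split.
- by rewrite e1 /f -/u CE vE; ring.
- exact: QE.
- by rewrite NE QE CE; ring.
- by rewrite hornerM Qx fx; ring.
- have -> : f.[x] * u.[x] * Q.[x] = (Ct.[x] * u.[x] ^+ 2) ^+ 2.
    by rewrite fx Qx; ring.
  by rewrite exprn_even_gt0 // mulf_neq0 // expf_neq0.
Qed.

End Periodic.
End OrthogonalPolynomials.

(** * Uniqueness of the equilibrium measure *)

Section LogSeries.
Variable R : realType.
Implicit Types (t x y s : R) (N : nat).

Definition log_partial N : {poly R} := \sum_(i < N) (i.+1%:R^-1) *: 'X^(i.+1).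

Lemma log_partialE N t : (log_partial N).[t] = \sum_(i < N) t ^+ i.+1 / i.+1%:R.
Proof.
rewrite /log_partial horner_sum; apply: eq_bigr => i _.
by rewrite hornerZ hornerXn mulrC.
Qed.

Lemma deriv_log_partial N t : t != 1 ->
  (log_partial N)^`().[t] = (1 - t)^-1 - t ^+ N / (1 - t).
Proof.
move=> t1; have t10 : 1 - t != 0 by rewrite subr_eq0 eq_sym.
rewrite /log_partial linear_sum horner_sum /=.
rewrite (eq_bigr (fun i : 'I_N => t ^+ i)); last first.
  move=> i _; rewrite derivZ derivXn /= hornerZ hornerMn hornerXn -[X in _ * X]mulr_natl.
  by rewrite mulrA mulVf ?pnatr_eq0 // mul1r.
have -> : (1 - t)^-1 - t ^+ N / (1 - t) = (1 - t ^+ N) / (1 - t) by rewrite mulrBl mul1r.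
by rewrite -(opprB (t ^+ N)) subrX1 -mulNr opprB mulrC mulKf.
Qed.

(** Mean value theorem for the remainder, whose derivative is t^N / (1 - t). *)
Lemma log_partial_error N t : 0 <= t < 1 -> exists2 c, 0 <= c <= t &
  - ln (1 - t) - (log_partial N).[t] = c ^+ N / (1 - c) * t.
Proof.
move=> /andP[t0 t1].
pose g x := - ln (1 - x) - (log_partial N).[x].
have dg x : 0 <= x <= t -> is_derive x 1 g (x ^+ N / (1 - x)).
  move=> /andP[x0 xt]; have x1 : 0 < 1 - x by rewrite subr_gt0 (le_lt_trans xt).
  have dl : is_derive x 1 (fun x => ln (1 - x)) ((1 - x)^-1 * (- 1)).
    rewrite -[fun x => _]/(@ln R \o (cst 1 - id : R -> R)).
    apply: is_derive1_comp; first exact: is_derive1_ln.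
    by apply: is_derive_eq; rewrite sub0r.
  rewrite -[g]/(- (fun x => ln (1 - x)) - horner (log_partial N)); apply: is_derive_eq.
  rewrite deriv_log_partial; last by rewrite lt_eqF // -subr_gt0.
  by field; rewrite gt_eqF.
have [||c] := @MVT_segment _ g (fun x => x ^+ N / (1 - x)) 0 t t0.
- by move=> x; rewrite in_itv /= => /andP[x0 xt]; apply: dg; rewrite !ltW.
- apply: derivable_within_continuous => x; rewrite in_itv /= => xt.
  by case: (dg x xt).
rewrite in_itv /= => ct; rewrite /g !subr0 ln1 oppr0 (log_partialE N 0) big1.
  by rewrite !subr0 => E; exists c.
by move=> i _; rewrite expr0n mul0r.
Qed.

Lemma log_partial_le N t : 0 <= t < 1 -> (log_partial N).[t] <= - ln (1 - t).
Proof.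
move=> /[dup] /andP[t0 t1] /(log_partial_error N)[c /andP[c0 ct] E].
rewrite -subr_ge0 E mulr_ge0 // divr_ge0 ?exprn_ge0 // subr_ge0.
by rewrite (le_trans ct) // ltW.
Qed.

Lemma cvg_log_partial t : 0 <= t < 1 ->
  (fun N => (log_partial N).[t]) @ \oo --> - ln (1 - t).
Proof.
move=> /[dup] t01 /andP[t0 t1].
have g0 : (fun N => t ^+ N / (1 - t)) @ \oo --> (0 : R).
  rewrite -[X in _ --> X](mul0r (1 - t)^-1); apply: cvgMl.
  by apply: cvg_expr; rewrite ger0_norm.
have lower : (fun N => - ln (1 - t) - t ^+ N / (1 - t)) @ \oo --> - ln (1 - t).
  by rewrite -[X in _ --> X]subr0; apply: cvgB => //; exact: cvg_cst.
apply: (squeeze_cvgr _ lower (cvg_cst _)); near=> N.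
rewrite log_partial_le // andbT.
have [c /andP[c0 ct] E] := log_partial_error N t01.
rewrite lerBlDr -lerBlDl E.
have c1 : 0 < 1 - c by rewrite subr_gt0 (le_lt_trans ct).
apply: (@le_trans _ _ (c ^+ N / (1 - c))).
  by rewrite ler_piMr ?(ltW t1) // divr_ge0 ?exprn_ge0 // ltW.
rewrite ler_pM ?exprn_ge0 ?invr_ge0 ?(ltW c1) //.
  by rewrite lerXn2r ?nnegrE.
have t1' : 0 < 1 - t by rewrite subr_gt0.
by rewrite lef_pV2 // lerD2l lerN2.
Unshelve. all: by end_near. Qed.

Lemma log_partial_nd t : 0 <= t -> {homo (fun N => (log_partial N).[t]) : m n / (m <= n)%N >-> m <= n}.
Proof.
move=> t0; apply: homo_leq => //; first exact: le_trans.
move=> N; rewrite !log_partialE big_ord_recr /= lerDl.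
by rewrite divr_ge0 ?exprn_ge0.
Qed.

Lemma dvg_log_partial1 : (fun N => (log_partial N).[1 : R]) @ \oo --> +oo.
Proof.
have E : (fun N => (log_partial N).[1 : R]) = series (@harmonic R).
  apply/funext => N; rewrite log_partialE /series /= big_mkord.
  by apply: eq_bigr => i _; rewrite expr1n mul1r.
have nd := log_partial_nd ler01.
apply: nondecreasing_dvgn_lt => //; rewrite E; exact: dvg_harmonic.
Qed.

End LogSeries.

Section IntegralMonotone.
Local Open Scope ereal_scope.
Context d (T : measurableType d) (R : realType) (mu : {measure set T -> \bar R}).

(* Unlike [le_integral], this needs neither integrability nor measurability. *)
Lemma le_integral_gen (D : set T) (f g : T -> \bar R) :
  (forall x, D x -> f x <= g x) -> \int[mu]_(x in D) f x <= \int[mu]_(x in D) g x.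
Proof.
move=> fg.
have mono (f1 f2 : T -> \bar R) : (forall x, D x -> 0 <= f1 x) ->
    (forall x, D x -> 0 <= f2 x) -> (forall x, D x -> f1 x <= f2 x) ->
    \int[mu]_(x in D) f1 x <= \int[mu]_(x in D) f2 x.
  move=> f10 f20 f12; rewrite !ge0_integralE //.
  apply: le_ereal_sup => _ [h /= hf <-]; exists h => //= x.
  by apply: le_trans (hf x) _; apply: lee_restrict.
rewrite (integralE _ D f) (integralE _ D g); apply: leeB.
  apply: mono => x Dx; [exact: funepos_ge0|exact: funepos_ge0|].
  by apply: (@funepos_le _ _ D) => [y|]; rewrite inE //; exact: fg.
apply: mono => x Dx; [exact: funeneg_ge0|exact: funeneg_ge0|].
by rewrite !funenegE ge_max !le_max leeN2 fg //= lexx orbT.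
Qed.

End IntegralMonotone.

Section LogKernel.
Variables (R : realType) (s : R).
Hypothesis s_gt0 : 0 < s.
Implicit Types (x y : R) (N i k : nat).

(* [chord x y] is the squared cosine of the angle between [(s, x)] and [(s, y)], so that
   [log |x - y|] is [log (1 - chord x y) / 2] up to functions of one variable. *)
Definition den x : R := s ^+ 2 + x ^+ 2.
Definition chord x y : R := (s ^+ 2 + x * y) ^+ 2 / (den x * den y).
Definition conformal x : R := ln (den x / s) / 2.
Definition kern N x y : R := (log_partial R N).[chord x y] / 2.

Lemma den_gt0 x : 0 < den x.
Proof. by rewrite /den ltr_wpDr ?sqr_ge0 // exprn_gt0. Qed.

Lemma chordB x y : 1 - chord x y = s ^+ 2 * (x - y) ^+ 2 / (den x * den y).
Proof.
have dx := den_gt0 x; have dy := den_gt0 y.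
rewrite /chord; have : den x * den y != 0 by rewrite mulf_neq0 // gt_eqF.
move=> /divff <-; rewrite -mulrBl; congr (_ / _).
by rewrite /den; ring.
Qed.

Lemma chord_ge0 x y : 0 <= chord x y.
Proof. by rewrite divr_ge0 ?sqr_ge0 // mulr_ge0 // ltW // den_gt0. Qed.

Lemma chord_lt1 x y : x != y -> chord x y < 1.
Proof.
move=> xy; rewrite -subr_gt0 chordB; apply: divr_gt0; last by rewrite mulr_gt0 ?den_gt0.
apply: mulr_gt0; first exact: exprn_gt0.
by rewrite exprn_even_gt0 //= subr_eq0.
Qed.

Lemma chord_diag x : chord x x = 1.
Proof. by apply/eqP; rewrite eq_sym -subr_eq0 chordB subrr expr0n mulr0 mul0r. Qed.

Lemma log_chord x y : x != y ->
  - ln (1 - chord x y) / 2 = - ln `|x - y| + (conformal x + conformal y).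
Proof.
move=> xy; have xy0 : 0 < `|x - y| by rewrite normr_gt0 subr_eq0.
have dx := den_gt0 x; have dy := den_gt0 y.
have -> : 1 - chord x y = `|x - y| ^+ 2 / ((den x / s) * (den y / s)).
  by rewrite chordB real_normK ?num_real //; field; rewrite !gt_eqF.
have px : 0 < den x / s by rewrite divr_gt0.
have py : 0 < den y / s by rewrite divr_gt0.
have ps : 0 < `|x - y| ^+ 2 by rewrite exprn_gt0.
have pm : 0 < den x / s * (den y / s) by rewrite mulr_gt0.
rewrite (ln_div ps pm) (lnXn 2 xy0) (lnM px py) /conformal.
by rewrite -mulr_natl; field.
Qed.

Lemma kern_ge0 N x y : 0 <= kern N x y.
Proof.
rewrite divr_ge0 // log_partialE sumr_ge0 // => i _.
by rewrite divr_ge0 // exprn_ge0 // chord_ge0.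
Qed.

Lemma kern_nd x y : {homo (fun N => kern N x y) : m n / (m <= n)%N >-> m <= n}.
Proof.
by move=> m n mn; rewrite ler_pM2r ?invr_gt0 // log_partial_nd // chord_ge0.
Qed.

(** On the diagonal [chord] is 1 and the partial sums are harmonic, so they tend to +oo, the value
    of the logarithmic kernel there. Monotone convergence thus applies without removing the
    singularity. *)
Lemma cvg_kern x y : (fun N => (kern N x y)%:E) @ \oo -->
  (- lne (`|x - y|%:E) + (conformal x + conformal y)%:E)%E.
Proof.
have [->|xy] := eqVneq x y.
  rewrite subrr normr0 le0_lneNy //= addye //; apply/cvgeryP.
  rewrite /kern chord_diag; apply/cvgryPge => A.
  have /cvgryPge/(_ (A * 2)) := @dvg_log_partial1 R.
  by apply: filterS => N; rewrite ler_pdivlMr.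
rewrite lne_EFin ?normr_gt0 ?subr_eq0 // -EFinN -EFinD -log_chord //.
apply: cvg_EFin; first exact: nearW.
apply: cvgMl; apply: cvg_log_partial.
by rewrite chord_ge0 chord_lt1.
Qed.

Lemma kern_le N x y :
  ((kern N x y)%:E <= - lne (`|x - y|%:E) + (conformal x + conformal y)%:E)%E.
Proof.
have /cvg_lim <- // := @cvg_kern x y.
apply: lime_ge; first by apply/cvg_ex; eexists; exact: cvg_kern.
by near=> n; rewrite lee_fin kern_nd //; near: n; exact: nbhs_infty_ge.
Unshelve. all: by end_near. Qed.

(* Expanding the powers of [s ^ 2 + x * y] separates the variables in [kern]. *)
Definition feature i k x : R := x ^+ k / den x ^+ i.+1.

Definition weight i k : R :=
  (s ^+ 2) ^+ (2 * i.+1 - k) * 'C(2 * i.+1, k)%:R / i.+1%:R / 2.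

Lemma weight_ge0 i k : 0 <= weight i k.
Proof. by rewrite !divr_ge0 // mulr_ge0 // exprn_ge0 // sqr_ge0. Qed.

Lemma weight_gt0 i k : (k <= 2 * i.+1)%N -> 0 < weight i k.
Proof.
move=> ki; rewrite !divr_gt0 // mulr_gt0 ?exprn_gt0 //.
by rewrite ltr0n bin_gt0.
Qed.

Lemma kernE N x y : kern N x y = \sum_(i < N) \sum_(k < (2 * i.+1).+1)
  weight i k * feature i k x * feature i k y.
Proof.
rewrite /kern log_partialE mulr_suml; apply: eq_bigr => i _.
rewrite /chord expr_div_n -exprM exprDn !mulr_suml; apply: eq_bigr => k _.
have dx := den_gt0 x; have dy := den_gt0 y.
rewrite /weight /feature (exprMn k x y) (exprMn i.+1 (den x) (den y)) -mulr_natr.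
have : den x ^+ i.+1 != 0 by rewrite expf_neq0 // gt_eqF.
have : den y ^+ i.+1 != 0 by rewrite expf_neq0 // gt_eqF.
have : i.+1%:R != 0 :> R by rewrite pnatr_eq0.
move: (den x ^+ _) (den y ^+ _) (_ ^+ (_ - _)) (_%:R) (i.+1%:R) => A C D E F F0 C0 A0.
by field; rewrite F0 C0 A0.
Qed.

Lemma continuous_ratio (P Q : {poly R}) :
  (forall x, Q.[x] != 0) -> continuous (fun x => P.[x] / Q.[x]).
Proof.
move=> Q0 x; apply: continuousM; first exact: continuous_horner.
by apply: continuousV => //; exact: continuous_horner.
Qed.

Lemma continuous_feature i k : continuous (feature i k).
Proof.
have -> : feature i k = (fun x => ('X^k).[x] / (((s ^+ 2)%:P + 'X^2) ^+ i.+1).[x]).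
  by apply/funext => x; rewrite /feature horner_exp !hornerE.
apply: continuous_ratio => x; rewrite horner_exp !hornerE.
by rewrite expf_neq0 // gt_eqF // den_gt0.
Qed.

Lemma continuous_conformal : continuous conformal.
Proof.
rewrite /conformal => x; apply: (@continuousM _ _ (fun x => ln (den x / s)) (cst 2^-1)).
  2: exact: cst_continuous.
have E : (fun x => den x / s) = horner ((s ^-1)%:P * ((s ^+ 2)%:P + 'X^2)).
  by apply/funext => z; rewrite !hornerE mulrC.
apply: (@continuous_comp _ _ _ (fun x => den x / s) (@ln R)).
  by rewrite E; exact: continuous_horner.
by apply: continuous_ln; rewrite divr_gt0 // den_gt0.
Qed.

End LogKernel.

(** The integral is the difference of those of the positive and negative parts, and a difference
    with an infinite term is never finite. *)
Lemma integrable_fin_integral d (T : measurableType d) (R : realType)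
    (mu : {measure set T -> \bar R}) (D : set T) (f : T -> \bar R) :
  measurable D -> measurable_fun D f ->
  (\int[mu]_(x in D) f x)%E \is a fin_num -> mu.-integrable D f.
Proof.
move=> mD mf; rewrite integralE => fin.
have p0 : (0 <= \int[mu]_(x in D) (f^\+%E x))%E by apply: integral_ge0 => x _; exact: funepos_ge0.
have n0 : (0 <= \int[mu]_(x in D) (f^\-%E x))%E by apply: integral_ge0 => x _; exact: funeneg_ge0.
have [nfin pfin] : ((\int[mu]_(x in D) (f^\-%E x))%E < +oo /\ (\int[mu]_(x in D) (f^\+%E x))%E < +oo)%E.
  move: fin p0 n0; case: (integral mu D f^\+%E) => [p||] //; case: (integral mu D f^\-%E) => [q||] //=.
  by rewrite !ltry.
apply/integrableP; split=> //.
have -> : (fun x => `|f x|)%E = (f^\+ \+ f^\-)%E by rewrite -fune_abse.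
rewrite ge0_integralD //; first exact: lte_add_pinfty.
- exact: measurable_funepos.
- exact: measurable_funeneg.
Qed.

Lemma continuous_sum (R : realType) (n : nat) (f : 'I_n -> R -> R) : (forall i, continuous (f i)) ->
  continuous (fun x => \sum_(i < n) f i x).
Proof.
elim: n f => [|n IH] f cf.
  by rewrite (_ : (fun _ => _) = cst 0);
    [exact: cst_continuous|apply/funext => x; rewrite big_ord0].
rewrite (_ : (fun _ => _) = fun x =>
  \sum_(i < n) f (widen_ord (leqnSn n) i) x + f ord_max x); last first.
  by apply/funext => x; rewrite big_ord_recr.
by move=> x; apply: cvgD; [exact: (IH (fun i => f (widen_ord _ i)))|exact: cf].
Qed.

(** Up to continuous functions of one variable the kernel is the pointwise limit of the continuous
    [kern]; the scale is taken to be 1. *)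
Lemma measurable_log_dist (R : realType) (x : R) :
  measurable_fun setT (fun y : R => - lne (`|x - y|%:E))%E.
Proof.
have -> : (fun y => - lne (`|x - y|%:E))%E = (fun y =>
    (- lne (`|x - y|%:E) + (conformal 1 x + conformal 1 y)%:E) -
    (conformal 1 x + conformal 1 y)%:E)%E.
  by apply/funext => y; rewrite addeK.
have mconf : measurable_fun [set: R] (fun y => (conformal 1 x + conformal 1 y)%:E).
  apply/measurable_EFinP; apply: continuous_measurable_fun => y.
  by apply: cvgD; [exact: cvg_cst|exact: (continuous_conformal ltr01)].
apply: emeasurable_funB => //.
apply: (emeasurable_fun_cvg (fun N y => (kern 1 N x y)%:E)) => [N|y _]; last first.
  exact: (cvg_kern ltr01).
apply/measurable_EFinP; apply: continuous_measurable_fun.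
have -> : kern 1 N x = fun y => \sum_(i < N) \sum_(k < (2 * i.+1).+1)
    weight 1 i k * feature 1 i k x * feature 1 i k y.
  by apply/funext => y; rewrite (kernE ltr01).
apply: continuous_sum => i; apply: continuous_sum => k y.
by apply: cvgMr; exact: (continuous_feature ltr01).
Qed.

Section Means.
Variables (R : realType) (B : set R) (M : R).
Hypotheses (mB : measurable B) (BM : B `<=` `[- M, M]).
Implicit Types (mu nu : probability (measurableTypeR R) R) (f g : R -> R).

Definition mean mu f : R := \int[mu]_(x in B) f x.

Lemma integrable_continuous mu f : continuous f -> mu.-integrable B (EFin \o f).
Proof.
move=> cf; apply: measurable_bounded_integrable => //.
- by apply: le_lt_trans (probability_le1 mu mB) _; rewrite ltry.
- by apply: measurable_funTS; exact: continuous_measurable_fun.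
- have /compact_bounded : compact (f @` `[- M, M]).
    by apply: continuous_compact; [exact: continuous_subspaceT|exact: segment_compact].
  case=> C [Creal Cf]; exists C; split => // r Cr x Bx /=.
  by apply: (Cf r Cr); exists x => //; apply: BM.
Qed.

Lemma meanE mu f : continuous f -> (\int[mu]_(x in B) (f x)%:E = (mean mu f)%:E)%E.
Proof.
move=> cf; rewrite /mean /Rintegral fineK //.
by apply: integrable_fin_num => //; exact: integrable_continuous.
Qed.

Lemma meanD mu f g : continuous f -> continuous g ->
  mean mu (fun x => f x + g x) = mean mu f + mean mu g.
Proof. by move=> cf cg; rewrite /mean RintegralD //; exact: integrable_continuous. Qed.

Lemma meanZ mu c f : continuous f -> mean mu (fun x => c * f x) = c * mean mu f.
Proof. by move=> cf; rewrite /mean RintegralZl //; exact: integrable_continuous. Qed.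

Lemma mean_cst mu c : mu B = 1%E -> mean mu (cst c) = c.
Proof. by move=> muB; rewrite /mean Rintegral_cst //= muB mulr1. Qed.

Lemma mean_sum mu (n : nat) (f : 'I_n -> R -> R) : (forall i, continuous (f i)) ->
  mean mu (fun x => \sum_(i < n) f i x) = \sum_(i < n) mean mu (f i).
Proof.
elim: n f => [|n IH] f cf.
  rewrite big_ord0 (_ : (fun _ => _) = cst 0); last by apply/funext => x; rewrite big_ord0.
  by rewrite /mean Rintegral_cst // mul0r.
rewrite big_ord_recr /= -IH // -meanD //; last exact: continuous_sum.
by congr mean; apply/funext => x; rewrite big_ord_recr.
Qed.

Lemma le_mean mu f g : continuous f -> continuous g ->
  (forall x, B x -> f x <= g x) -> mean mu f <= mean mu g.
Proof.
move=> cf cg fg; rewrite -lee_fin -!meanE //; apply: le_integral_gen => x Bx.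
by rewrite lee_fin fg.
Qed.

End Means.

Section Uniqueness.
Variables (R : realType) (B : set R) (s : R).
Hypotheses (s_gt0 : 0 < s) (mB : measurable B) (Bs : B `<=` `[- s, s]).
Implicit Types (mu nu : probability (measurableTypeR R) R).

Let cfeat i k : continuous (feature s i k) := @continuous_feature R s s_gt0 i k.
Let cconf : continuous (conformal s) := @continuous_conformal R s s_gt0.

Let moment mu i k := mean B mu (feature s i k).

(** Mutual energy for the truncated kernel, in coordinates where it is a diagonal form with
    nonnegative weights; [pot] is the matching potential. *)
Let pairing N mu nu := \sum_(i < N) \sum_(k < (2 * i.+1).+1)
  weight s i k * moment mu i k * moment nu i k.

Let pot mu N x := \sum_(i < N) \sum_(k < (2 * i.+1).+1)
  weight s i k * feature s i k x * moment mu i k.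

Let cterm i k c : continuous (fun x => weight s i k * feature s i k x * c).
Proof.
move=> x; apply: cvgMl; apply: cvgMr; exact: cfeat.
Qed.

Let cpot mu N : continuous (pot mu N).
Proof. by apply: continuous_sum => i; apply: continuous_sum => k; exact: cterm. Qed.

Let ckern N x : continuous (kern s N x).
Proof.
rewrite (_ : kern s N x = fun y => \sum_(i < N) \sum_(k < (2 * i.+1).+1)
  weight s i k * feature s i k x * feature s i k y); last first.
  by apply/funext => y; rewrite kernE.
by apply: continuous_sum => i; apply: continuous_sum => k y; apply: cvgMr; exact: cfeat.
Qed.

Let mean_kern mu N x : mean B mu (kern s N x) = pot mu N x.
Proof.
rewrite (_ : kern s N x = fun y => \sum_(i < N) \sum_(k < (2 * i.+1).+1)
  weight s i k * feature s i k x * feature s i k y); last first.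
  by apply/funext => y; rewrite kernE.
have ct i k : continuous (fun y => weight s i k * feature s i k x * feature s i k y).
  by move=> y; apply: cvgMr; exact: cfeat.
rewrite (mean_sum mB Bs); last by move=> i; apply: continuous_sum.
apply: eq_bigr => i _; rewrite (mean_sum mB Bs) //.
by apply: eq_bigr => k _; rewrite (meanZ mB Bs).
Qed.

Let mean_pot mu nu N : mean B mu (pot nu N) = pairing N mu nu.
Proof.
rewrite /pot (mean_sum mB Bs); last by move=> i; apply: continuous_sum => k; exact: cterm.
apply: eq_bigr => i _; rewrite (mean_sum mB Bs); last by move=> k; exact: cterm.
apply: eq_bigr => k _; rewrite -(mulrAC _ (moment nu i k)) -(meanZ mB Bs) //.
by congr mean; apply/funext => x; rewrite mulrAC.
Qed.

(** The truncated energy of mu - nu is a sum of nonnegative terms, so it dominates each of them. The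
    index (k - 1, k) is kept because its feature is the k-th power of x / den x. *)
Let pairing_square N mu nu k : (0 < k <= N)%N ->
  weight s k.-1 k * (moment mu k.-1 k - moment nu k.-1 k) ^+ 2 <=
  pairing N mu mu - 2 * pairing N mu nu + pairing N nu nu.
Proof.
move=> /andP[k0 kN].
have -> : pairing N mu mu - 2 * pairing N mu nu + pairing N nu nu =
    \sum_(i < N) \sum_(k < (2 * i.+1).+1)
      weight s i k * (moment mu i k - moment nu i k) ^+ 2.
  rewrite /pairing mulr_sumr -sumrB -big_split; apply: eq_bigr => i _ /=.
  rewrite mulr_sumr -sumrB -big_split; apply: eq_bigr => l _ /=.
  ring.
have nn i l : 0 <= weight s i l * (moment mu i l - moment nu i l) ^+ 2.
  by rewrite mulr_ge0 ?sqr_ge0 // weight_ge0.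
have kN' : (k.-1 < N)%N by rewrite prednK.
rewrite (bigD1 (Ordinal kN')) //= ler_wpDr //.
  by apply: sumr_ge0 => i _; apply: sumr_ge0.
have kk : (k < (2 * k.-1.+1).+1)%N by rewrite prednK // ltnS leq_pmull.
by rewrite (bigD1 (Ordinal kk)) //= ler_wpDr // sumr_ge0.
Qed.

Variables (nu : probability (measurableTypeR R) R) (V : R).
Hypothesis nuB : nu B = 1%E.
Hypothesis nuV : forall x, B x ->
  (\int[nu]_(y in B) (- lne (`|x - y|%:E)) = V%:E)%E.

Let mean_conf mu := mean B mu (conformal s).

Let mkern x N : measurable_fun B (fun y => (kern s N x y)%:E).
Proof.
apply/measurable_EFinP; apply: measurable_funTS; apply: continuous_measurable_fun.
exact: ckern.
Qed.

Let kern_limn x y : limn (fun N => (kern s N x y)%:E) =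
  (- lne (`|x - y|%:E) + (conformal s x + conformal s y)%:E)%E.
Proof. by apply: cvg_lim => //; exact: cvg_kern. Qed.

Let mlog x : measurable_fun B (fun y => - lne (`|x - y|%:E))%E.
Proof. by apply: measurable_funTS; exact: measurable_log_dist. Qed.

Let cconfx x : continuous (fun y => conformal s x + conformal s y).
Proof. by move=> y; apply: cvgD; [exact: cvg_cst|exact: cconf]. Qed.

Let mean_confx mu x : mu B = 1%E ->
  mean B mu (fun y => conformal s x + conformal s y) = conformal s x + mean_conf mu.
Proof.
move=> muB; rewrite (@meanD _ _ _ mB Bs mu (cst (conformal s x))) ?(mean_cst mB) //.
exact: cst_continuous.
Qed.

Let pot_ge0 mu N x : 0 <= pot mu N x.
Proof.
by rewrite -mean_kern; apply: Rintegral_ge0 => y _; apply: kern_ge0.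
Qed.

Let pot_nd mu x : {homo (fun N => pot mu N x) : m n / (m <= n)%N >-> m <= n}.
Proof.
move=> m n mn; rewrite -!mean_kern; apply: (le_mean mB Bs) => // y _.
exact: kern_nd.
Qed.

Let cvg_pot x : B x ->
  (fun N => (pot nu N x)%:E) @ \oo --> (V + (conformal s x + mean_conf nu))%:E.
Proof.
move=> Bx.
have -> : (fun N => (pot nu N x)%:E) = (fun N => \int[nu]_(y in B) (kern s N x y)%:E)%E.
  by apply/funext => N; rewrite -mean_kern (meanE mB Bs).
have -> : (V + (conformal s x + mean_conf nu))%:E =
    (\int[nu]_(y in B) limn (fun N => (kern s N x y)%:E))%E.
  under eq_integral do rewrite kern_limn.
  rewrite integralD //=.
  - by rewrite nuV // (meanE mB Bs) // mean_confx.
  - apply: integrable_fin_integral => //; first exact: mlog.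
    suff : (\int[nu]_(y in B) - lne (`|x - y|%:E))%E \is a fin_num by [].
    by rewrite nuV.
  - exact: (integrable_continuous mB Bs).
apply: cvg_monotone_convergence => //.
- exact: mkern.
- by move=> N y _; rewrite lee_fin kern_ge0.
- by move=> y _ m n mn; rewrite lee_fin kern_nd.
Qed.

Let cvg_pairing mu : mu B = 1%E ->
  (fun N => pairing N mu nu) @ \oo --> V + mean_conf mu + mean_conf nu.
Proof.
move=> muB; suff : (fun N => (pairing N mu nu)%:E) @ \oo -->
    (V + mean_conf mu + mean_conf nu)%:E by move/fine_cvgP => [].
have -> : (fun N => (pairing N mu nu)%:E) = (fun N => \int[mu]_(x in B) (pot nu N x)%:E)%E.
  by apply/funext => N; rewrite -mean_pot (meanE mB Bs).
have cc : continuous (fun x => conformal s x + mean_conf nu).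
  by move=> x; apply: cvgD; [exact: cconf|exact: cvg_cst].
have -> : (V + mean_conf mu + mean_conf nu)%:E =
    (\int[mu]_(x in B) limn (fun N => (pot nu N x)%:E))%E.
  transitivity (\int[mu]_(x in B) (V + (conformal s x + mean_conf nu))%:E)%E.
    rewrite (meanE mB Bs); last by move=> x; apply: cvgD; [exact: cvg_cst|exact: cc].
    rewrite (@meanD _ _ _ mB Bs mu (cst V)) //; last exact: cst_continuous.
    rewrite (@meanD _ _ _ mB Bs mu _ (cst (mean_conf nu))) //; last exact: cst_continuous.
    by rewrite !(mean_cst mB) // addrA.
  by apply: eq_integral => x /set_mem Bx; apply/esym/cvg_lim => //; exact: cvg_pot.
apply: cvg_monotone_convergence => //.
- move=> N; apply/measurable_EFinP; apply: measurable_funTS.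
  by apply: continuous_measurable_fun; exact: cpot.
- by move=> N x _; rewrite lee_fin pot_ge0.
- by move=> x _ m n mn; rewrite lee_fin pot_nd.
Qed.

(** Truncation lowers the kernel, hence the energy. The comparison goes through [le_integral_gen],
    as integrability of the logarithm against mu is not known. *)
Let pairing_le mu N : mu B = 1%E -> (log_energy B mu <= V%:E)%E ->
  pairing N mu mu <= V + 2 * mean_conf mu.
Proof.
move=> muB le_mu; rewrite -lerBlDr -lee_fin; apply: le_trans le_mu.
have -> : (pairing N mu mu - 2 * mean_conf mu)%:E =
    (\int[mu]_(x in B) (pot mu N x - (conformal s x + mean_conf mu))%:E)%E.
  rewrite (meanE mB Bs); last first.
    by move=> x; apply: cvgB; [exact: cpot|apply: cvgD; [exact: cconf|exact: cvg_cst]].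
  congr EFin.
  have cc : continuous (fun x => (-1) * (conformal s x + mean_conf mu)).
    by move=> x; apply: cvgMr; apply: cvgD; [exact: cconf|exact: cvg_cst].
  rewrite (_ : (fun _ => _) = fun x => pot mu N x + -1 * (conformal s x + mean_conf mu)).
    rewrite (meanD mB Bs) // mean_pot (meanZ mB Bs); last first.
      by move=> x; apply: cvgD; [exact: cconf|exact: cvg_cst].
    rewrite (@meanD _ _ _ mB Bs mu _ (cst (mean_conf mu))) //; last exact: cst_continuous.
    by rewrite (mean_cst mB) // -/(mean_conf mu); ring.
  by apply/funext => x; rewrite mulN1r.
apply: le_integral_gen => x Bx.
have -> : (pot mu N x - (conformal s x + mean_conf mu))%:E =
    (\int[mu]_(y in B) (kern s N x y - (conformal s x + conformal s y))%:E)%E.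
  have cc : continuous (fun y => (-1) * (conformal s x + conformal s y)).
    by move=> y; apply: cvgMr; exact: cconfx.
  rewrite (_ : (fun _ => _) = EFin \o (fun y => kern s N x y + -1 * (conformal s x + conformal s y))).
    rewrite (meanE mB Bs); last by move=> y; apply: cvgD; [exact: ckern|exact: cc].
    by rewrite (meanD mB Bs) // mean_kern (meanZ mB Bs) // mean_confx // mulN1r.
  by apply/funext => y; rewrite /= mulN1r.
apply: le_integral_gen => y By.
by rewrite EFinB leeBlDr // kern_le.
Qed.

(** Write c for [mean_conf]. The truncated energy of mu - nu is at most (V + 2 c(mu)) + (V + 2
    c(nu)) minus twice the pairing. The pairing tends to V + c(mu) + c(nu), so this bound tends to
    0. *)
Lemma energy_moments mu k : (0 < k)%N -> mu B = 1%E ->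
  (log_energy B mu <= log_energy B nu)%E ->
  mean B mu (feature s k.-1 k) = mean B nu (feature s k.-1 k).
Proof.
move=> k0 muB.
have -> : log_energy B nu = V%:E.
  rewrite /log_energy (eq_integral (cst V%:E)); last first.
    by move=> x /set_mem Bx; rewrite nuV.
  by rewrite integral_cst //= nuB mule1.
move=> le_mu.
have le_nu : (log_energy B nu <= V%:E)%E.
  rewrite /log_energy (eq_integral (cst V%:E)); last first.
    by move=> x /set_mem Bx; rewrite nuV.
  by rewrite integral_cst //= nuB mule1.
pose W := weight s k.-1 k; pose z := moment mu k.-1 k - moment nu k.-1 k.
have W0 : 0 < W by apply: weight_gt0 => //; rewrite prednK // leq_pmull.
suff z0 : W * z ^+ 2 <= 0.
  apply/eqP; rewrite -subr_eq0 -sqrf_eq0 eq_le sqr_ge0 andbT.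
  by move: z0; rewrite pmulr_rle0.
have lim0 : (fun N => 2 * V + 2 * mean_conf mu + 2 * mean_conf nu -
    2 * pairing N mu nu) @ \oo --> (0 : R).
  rewrite (_ : 0 = 2 * V + 2 * mean_conf mu + 2 * mean_conf nu -
    2 * (V + mean_conf mu + mean_conf nu)); last by ring.
  by apply: cvgB; [exact: cvg_cst|apply: cvgMr; exact: cvg_pairing].
apply: (@ler_cvg_to _ _ _ _ (cst (W * z ^+ 2)) _ _ _ (cvg_cst _) lim0).
near=> N; have kN : (0 < k <= N)%N by rewrite k0 /=; near: N; exact: nbhs_infty_ge.
apply: le_trans (pairing_square mu nu kN) _.
by have := pairing_le N muB le_mu; have := pairing_le N nuB le_nu; rewrite /=; lra.
Unshelve. all: by end_near. Qed.

End Uniqueness.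

(** * Distribution functions from moments *)

Section StepPolynomials.
Variable R : realType.
Implicit Types (y z h : R) (n : nat).

(* [(1 - y ^ n) ^ (2 ^ n)] tends to the indicator function of [y < 1 / 2] on [0, 1]. *)
Definition step_poly n : {poly R} := (1 - 'X^n) ^+ (2 ^ n).

Lemma step_polyE n y : (step_poly n).[y] = (1 - y ^+ n) ^+ (2 ^ n).
Proof. by rewrite horner_exp !hornerE. Qed.

Lemma bernoulli_ineq n z : -1 <= z -> 1 + n%:R * z <= (1 + z) ^+ n.
Proof.
move=> z1; elim: n => [|n IH]; first by rewrite mul0r addr0 expr0.
have z0 : 0 <= 1 + z by rewrite addrC -lerBlDr sub0r.
have : (1 + z) * (1 + n%:R * z) <= (1 + z) ^+ n.+1 by rewrite exprS ler_wpM2l.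
apply: le_trans; rewrite -natr1.
have : 0 <= n%:R * (z * z) by rewrite mulr_ge0 // -expr2 sqr_ge0.
lra.
Qed.

Lemma step_poly_bounds n y : 0 <= y <= 1 -> 0 <= (step_poly n).[y] <= 1.
Proof.
move=> /andP[y0 y1]; rewrite step_polyE.
have h1 : y ^+ n <= 1 by rewrite exprn_ile1.
have h0 : 0 <= y ^+ n by rewrite exprn_ge0.
by rewrite exprn_ge0 ?subr_ge0 //= exprn_ile1 ?subr_ge0 // gerBl.
Qed.

Lemma step_poly_ge n y h : 0 <= y -> y <= 2^-1 - h -> 0 <= h ->
  1 - (1 - 2 * h) ^+ n <= (step_poly n).[y].
Proof.
move=> y0 yh h0; rewrite step_polyE.
have y1 : y ^+ n <= 1 by rewrite exprn_ile1 //; lra.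
(* Bernoulli bounds the power below by 1 - (2 y)^n, and 2 y <= 1 - 2 h. *)
have := @bernoulli_ineq (2 ^ n) (- y ^+ n); rewrite lerN2 => /(_ y1); apply: le_trans.
rewrite lerD2l mulrN lerN2 natrX -exprMn lerXn2r ?nnegrE; lra.
Qed.

Lemma step_poly_le n y h : y <= 1 -> 2^-1 + h <= y -> 0 <= h ->
  (step_poly n).[y] <= ((1 + 2 * h) ^+ n)^-1.
Proof.
move=> y1 yh h0; rewrite step_polyE.
have yn1 : y ^+ n <= 1 by rewrite exprn_ile1 //; lra.
have yn0 : 0 <= y ^+ n by rewrite exprn_ge0 //; lra.
have p0 : 0 < (1 + 2 * h) ^+ n by rewrite exprn_gt0 //; lra.
rewrite -[leRHS]mul1r ler_pdivlMr //.
have le1 : (1 + 2 * h) ^+ n <= (1 + y ^+ n) ^+ (2 ^ n).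
  have := @bernoulli_ineq (2 ^ n) (y ^+ n); rewrite natrX -exprMn => b.
  apply: (@le_trans _ _ ((2 * y) ^+ n)).
    by rewrite lerXn2r ?nnegrE; lra.
  by apply: le_trans (b _); lra.
(* The product is a power of 1 - y^(2n), hence at most 1, while by Bernoulli its second factor is at
   least (2 y)^n >= (1 + 2 h)^n. *)
apply: (@le_trans _ _ ((1 - y ^+ n) ^+ (2 ^ n) * (1 + y ^+ n) ^+ (2 ^ n))).
  by rewrite ler_wpM2l // exprn_ge0 // subr_ge0.
rewrite -exprMn exprn_ile1 //; nra.
Qed.

End StepPolynomials.

Section MomentsToCdf.
Variables (R : realType) (B : set R) (s : R).
Hypotheses (s_gt0 : 0 < s) (mB : measurable B) (Bs : B `<=` `[- s, s]).
Implicit Types (mu nu : probability (measurableTypeR R) R) (x y c e : R).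

(** Increasing on [-s, s], which contains B, with values between -1 / (2 s) and 1 / (2 s). Its
    powers are the features whose means are known to agree. *)
Let T x := x / den s x.

Let T_mono x y : - s <= x -> x <= y -> y <= s -> T x <= T y.
Proof.
move=> sx xy ys; have dx := den_gt0 s_gt0 x; have dy := den_gt0 s_gt0 y.
rewrite /T ler_pdivrMr // mulrAC ler_pdivlMr // /den -subr_ge0.
rewrite (_ : _ - _ = (y - x) * (s * s - x * y)); last by ring.
by rewrite mulr_ge0 ?subr_ge0 //; nra.
Qed.

Let T_lt x y : - s <= x -> x < y -> y <= s -> T x < T y.
Proof.
move=> sx xy ys; have dx := den_gt0 s_gt0 x; have dy := den_gt0 s_gt0 y.
rewrite /T ltr_pdivrMr // mulrAC ltr_pdivlMr // /den -subr_gt0.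
rewrite (_ : _ - _ = (y - x) * (s * s - x * y)); last by ring.
by rewrite mulr_gt0 ?subr_gt0 //; nra.
Qed.

Let T_bound x : `|T x| <= (2 * s)^-1.
Proof.
have dx := den_gt0 s_gt0 x.
rewrite /T normrM normfV [`|den s x|]gtr0_norm // ler_pdivrMr //.
rewrite [_ * den s x]mulrC ler_pdivlMr ?mulr_gt0 // /den -subr_ge0.
have [_|_] := ger0P x.
  by rewrite (_ : _ - _ = (s - x) ^+ 2) ?sqr_ge0 //; ring.
by rewrite (_ : _ - _ = (s + x) ^+ 2) ?sqr_ge0 //; ring.
Qed.

Let mean_poly mu nu (P : {poly R}) : mu B = 1%E -> nu B = 1%E ->
  (forall k, (0 < k)%N -> mean B mu (feature s k.-1 k) = mean B nu (feature s k.-1 k)) ->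
  mean B mu (fun x => P.[T x]) = mean B nu (fun x => P.[T x]).
Proof.
move=> muB nuB eqk.
have cT k : continuous (fun x => T x ^+ k).
  have -> : (fun x => T x ^+ k) = (fun x => ('X^k).[x] / (((s ^+ 2)%:P + 'X^2) ^+ k).[x]).
    by apply/funext => x; rewrite /T expr_div_n horner_exp !hornerE.
  apply: continuous_ratio => x; rewrite horner_exp !hornerE.
  by rewrite expf_neq0 // gt_eqF // (den_gt0 s_gt0).
have -> : (fun x => P.[T x]) = (fun x => \sum_(i < size P) P`_i * T x ^+ i).
  by apply/funext => x; rewrite horner_coef.
have ct (i : 'I_(size P)) : continuous (fun x => P`_i * T x ^+ i).
  by move=> x; apply: cvgMr; exact: cT.
rewrite !(mean_sum mB Bs) //; apply: eq_bigr => -[[|i] hi] _ /=.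
  rewrite !(meanZ mB Bs) //; congr (_ * _).
  by rewrite (_ : (fun _ => _) = cst 1) // !(mean_cst mB).
rewrite !(meanZ mB Bs) //; congr (_ * _).
have := eqk i.+1 isT; rewrite /feature /=.
rewrite (_ : (fun x => T x ^+ i.+1) = (fun x => x ^+ i.+1 / den s x ^+ i.+1)) //.
by apply/funext => x; rewrite expr_div_n.
Qed.

Definition ray c : set R := [set` `]-oo, c]].

(** The indicator of a ray is approximated by polynomials in T: the affine [Y] sends T c to 1/2 and
    the range of T into [0, 1], and [step_poly] after [Y] is then near 1 on the part of B left of c
    - e and near 0 on the part right of c + e. *)
Lemma moments_ray_le mu nu c e : 0 < e -> mu B = 1%E -> nu B = 1%E ->
  (forall k, (0 < k)%N -> mean B mu (feature s k.-1 k) = mean B nu (feature s k.-1 k)) ->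
  (mu (ray (c - e) `&` B) <= nu (ray (c + e) `&` B))%E.
Proof.
move=> e0 muB nuB eqk.
have mray z : measurable (ray z) by exact: measurable_itv.
(* If c - e < -s the left set is empty, and if c + e > s the right one is B. Otherwise both points
   lie in [-s, s], where T is increasing. *)
have [ce|ce] := ltP (c - e) (- s).
  rewrite (_ : ray (c - e) `&` B = set0) ?measure0 //.
  rewrite -subset0 => x []; rewrite /ray /= in_itv /= => xc /Bs /=; rewrite in_itv /= => /andP[xs _].
  by have := lt_le_trans (le_lt_trans xc ce) xs; rewrite ltxx.
have [ce'|ce'] := ltP s (c + e).
  rewrite [X in (_ <= nu X)%E](_ : _ = B); last first.
    apply/seteqP; split=> [x [] //|x Bx]; split=> //; rewrite /ray /= in_itv /=.
    by have := Bs Bx; rewrite /= in_itv /= => /andP[_ xs]; rewrite (le_trans xs) // ltW.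
  rewrite nuB; apply: probability_le1; apply: measurableI; [exact: mray|exact: mB].
pose Y := (2^-1)%:P + (s / 2)%:P * ('X - (T c)%:P).
have YE x : Y.[T x] = 2^-1 + s / 2 * (T x - T c) by rewrite /Y !hornerE.
have Y01 x : 0 <= Y.[T x] <= 1.
  have := T_bound x; have := T_bound c; rewrite !ler_norml => /andP[c1 c2] /andP[x1 x2].
  have sM : s / 2 * (2 * s)^-1 = 4^-1 by field; rewrite gt_eqF.
  have s2 : 0 <= s / 2 by rewrite divr_ge0 // ltW.
  have := ler_wpM2l s2 c1; have := ler_wpM2l s2 c2; have := ler_wpM2l s2 x1; have := ler_wpM2l s2 x2.
  by rewrite YE mulrBr !mulrN sM; lra.
pose h1 := s / 2 * (T c - T (c - e)); pose h2 := s / 2 * (T (c + e) - T c).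
have h10 : 0 < h1 by rewrite mulr_gt0 ?divr_gt0 // subr_gt0 T_lt //; lra.
have h20 : 0 < h2 by rewrite mulr_gt0 ?divr_gt0 // subr_gt0 T_lt //; lra.
have h11 : 2 * h1 <= 1.
  by have := Y01 (c - e); rewrite YE /h1; lra.
have xle x : B x -> x <= c - e -> Y.[T x] <= 2^-1 - h1.
  move=> /Bs /=; rewrite in_itv /= => /andP[sx xs] xc; rewrite YE /h1.
  have := T_mono sx xc; have s2 : 0 <= s / 2 by rewrite divr_ge0 // ltW.
  by move=> /(_ _)/(ler_wpM2l s2) H; have := H ltac:(lra); lra.
have xge x : B x -> c + e <= x -> 2^-1 + h2 <= Y.[T x].
  move=> /Bs /=; rewrite in_itv /= => /andP[sx xs] xc; rewrite YE /h2.
  have := @T_mono (c + e) x; have s2 : 0 <= s / 2 by rewrite divr_ge0 // ltW.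
  by move=> /(_ _ xc xs)/(ler_wpM2l s2) H; have := H ltac:(lra); lra.
pose q n x := ((step_poly R n) \Po Y).[T x].
have qE n x : q n x = (step_poly R n).[Y.[T x]] by rewrite /q horner_comp.
have q01 n x : 0 <= q n x <= 1 by rewrite qE step_poly_bounds.
have cq n : continuous (q n).
  move=> x; apply: (@continuous_comp _ _ _ T (horner _)); last exact: continuous_horner.
  have -> : T = (fun x => ('X).[x] / ((s ^+ 2)%:P + 'X^2).[x]).
    by apply/funext => z; rewrite /T !hornerE.
  by apply: continuous_ratio => z; rewrite !hornerE gt_eqF // (den_gt0 s_gt0).
have mr1 := mray (c - e); have mr2 := mray (c + e).
pose m1 := fine (mu (ray (c - e) `&` B)); pose m2 := fine (nu (ray (c + e) `&` B)).
have fm1 : mu (ray (c - e) `&` B) = m1%:E.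
  by rewrite fineK // fin_num_measure //; apply: measurableI => //; exact: mray.
have fm2 : nu (ray (c + e) `&` B) = m2%:E.
  by rewrite fineK // fin_num_measure //; apply: measurableI => //; exact: mray.
rewrite fm1 fm2 lee_fin.
have key n : (1 - (1 - 2 * h1) ^+ n) * m1 <= m2 + ((1 + 2 * h2) ^+ n)^-1.
  apply: (@le_trans _ _ (mean B mu (q n))).
    rewrite -lee_fin -(meanE mB Bs) // EFinM -fm1 -integral_indic //.
    rewrite -ge0_integralZl //; last 2 first.
    - by apply/measurable_EFinP; apply: measurable_funTS; exact: measurable_indic.
    - rewrite lee_fin subr_ge0 exprn_ile1 //; lra.
    apply: le_integral_gen => x Bx; rewrite -EFinM lee_fin indicE.
    case: (boolP (x \in _)) => [/set_mem xr|_]; last by rewrite mulr0; case/andP: (q01 n x).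
    rewrite mulr1 qE; apply: step_poly_ge; [by case/andP: (Y01 x)| |lra].
    by apply: xle => //; move: xr; rewrite /ray /= in_itv.
  rewrite (mean_poly _ muB nuB eqk) -/(q n).
  rewrite -lee_fin -(meanE mB Bs) // EFinD -fm2 -integral_indic //.
  have -> : (((1 + 2 * h2) ^+ n)^-1)%:E =
      (\int[nu]_(x in B) (((1 + 2 * h2) ^+ n)^-1)%:E)%E.
    by rewrite integral_cst //= nuB mule1.
  have i0 : 0 <= ((1 + 2 * h2) ^+ n)^-1 by rewrite invr_ge0 exprn_ge0 //; lra.
  rewrite -ge0_integralD //; last first.
    by apply/measurable_EFinP; apply: measurable_funTS; exact: measurable_indic.
  apply: le_integral_gen => x Bx; rewrite -EFinD lee_fin indicE.
  case: (boolP (x \in _)) => [_|/negP xr].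
    by apply: le_trans (proj2 (andP (q01 n x))) _; rewrite lerDl.
  rewrite add0r qE; apply: step_poly_le; [by case/andP: (Y01 x)| |lra].
  apply: xge => //; rewrite leNgt; apply/negP => xc; apply: xr; apply/mem_set.
  by rewrite /ray /= in_itv /= ltW.
have l1 : (fun n => (1 - (1 - 2 * h1) ^+ n) * m1) @ \oo --> m1.
  rewrite -[X in _ --> X](_ : (1 - 0) * m1 = m1); last by rewrite subr0 mul1r.
  apply: cvgMl; apply: cvgB; first exact: cvg_cst.
  by apply: cvg_expr; rewrite ltr_norml; lra.
have l2 : (fun n => m2 + ((1 + 2 * h2) ^+ n)^-1) @ \oo --> m2.
  rewrite -[X in _ --> X]addr0; apply: cvgD; first exact: cvg_cst.
  under eq_fun do rewrite -exprVn.
  apply: cvg_expr; rewrite ger0_norm ?invr_ge0; last lra.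
  by rewrite invf_lt1; lra.
by apply: (ler_cvg_to l1 l2); apply: nearW.
Qed.

Lemma ray_eq mu nu c : mu B = 1%E -> nu B = 1%E ->
  (forall k, (0 < k)%N -> mean B mu (feature s k.-1 k) = mean B nu (feature s k.-1 k)) ->
  nu [set c] = 0%E -> mu (ray c `&` B) = nu (ray c `&` B).
Proof.
move=> muB nuB eqk nuc.
have mray z : measurable (ray z `&` B).
  by apply: measurableI => //; exact: measurable_itv.
have ray_sub x y : x <= y -> ray x `&` B `<=` ray y `&` B.
  move=> xy z [zx Bz]; split=> //; move: zx; rewrite /ray /= !in_itv /= => zx.
  exact: le_trans zx xy.
(* [moments_ray_le] loses e on either side, so it is used with e = h n / 2 around c + h n / 2 or c -
   h n / 2, which makes one of the two rays end exactly at c. *)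
pose h n : R := 2 * n.+1%:R^-1.
have h0 n : 0 < h n by rewrite mulr_gt0 ?invr_gt0 ?ltr0n.
have h_nd m n : (m <= n)%N -> h n <= h m.
  by move=> mn; rewrite ler_pM2l // lef_pV2 ?posrE ?ltr0n // ler_nat.
have h_small e : 0 < e -> exists n, h n < e.
  move=> e0; exists (Num.truncn (2 / e)); have := truncnS_gt (2 / e).
  by rewrite ltr_pdivrMr // => lt; rewrite /h ltr_pdivrMr ?ltr0n // mulrC.
apply/eqP; rewrite eq_le; apply/andP; split.
  have lim : nu \o (fun n => ray (c + h n) `&` B) @ \oo --> nu (ray c `&` B).
    have -> : ray c `&` B = \bigcap_n (ray (c + h n) `&` B).
      apply/seteqP; split=> [z rz n _|z rz].
        by apply: ray_sub rz; rewrite lerDl ltW.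
      split; last by case: (rz 0 I).
      rewrite /ray /= in_itv /= leNgt; apply/negP => cz.
      have [n hn] := h_small (z - c) ltac:(by rewrite subr_gt0).
      by have [] := rz n I; rewrite /ray /= in_itv /=; lra.
    apply: nonincreasing_cvg_mu => //.
    - by apply: le_lt_trans (probability_le1 nu (mray _)) _; rewrite ltry.
    - by move=> i; exact: mray.
    - by apply: bigcapT_measurable => n; exact: mray.
    - by move=> m n mn; apply/subsetPset; apply: ray_sub; rewrite lerD2l h_nd.
  rewrite -(cvg_lim _ lim) //; apply: lime_ge; first by apply/cvg_ex; eexists; exact: lim.
  apply: nearW => n; have := @moments_ray_le mu nu (c + h n / 2) (h n / 2) _ muB nuB eqk.
  by rewrite addrK -addrA -splitr; apply; rewrite divr_gt0.
have lim : nu \o (fun n => ray (c - h n) `&` B) @ \oo --> nu (\bigcup_n (ray (c - h n) `&` B)).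
  apply: nondecreasing_cvg_mu => //.
  - by move=> i; exact: mray.
  - by apply: bigcup_measurable => n _; exact: mray.
  - by move=> m n mn; apply/subsetPset; apply: ray_sub; rewrite lerD2l lerN2 h_nd.
(* Rays ending before c exhaust everything but c itself, which nu does not charge. *)
have sub : ray c `&` B `<=` \bigcup_n (ray (c - h n) `&` B) `|` [set c].
  move=> z [zc Bz]; move: zc; rewrite /ray /= in_itv /= le_eqVlt => /orP[/eqP ->|zc]; first by right.
  have [n hn] := h_small (c - z) ltac:(by rewrite subr_gt0).
  by left; exists n => //; split=> //; rewrite /ray /= in_itv /=; lra.
have mU : measurable (\bigcup_n (ray (c - h n) `&` B)).
  by apply: bigcup_measurable => n _; exact: mray.
apply: (@le_trans _ _ (nu (\bigcup_n (ray (c - h n) `&` B)))).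
  apply: (@le_trans _ _ (nu (\bigcup_n (ray (c - h n) `&` B) `|` [set c]))).
    by apply: le_measure => //; rewrite inE; [exact: mray|exact: measurableU].
  by apply: le_trans (measureU2 nu mU (measurable_set1 c)) _; rewrite [X in (_ + X <= _)%E]nuc adde0.
rewrite -(cvg_lim _ lim) //; apply: lime_le; first by apply/cvg_ex; eexists; exact: lim.
apply: nearW => n; have := @moments_ray_le nu mu (c - h n / 2) (h n / 2) _ nuB muB.
rewrite subrK -addrA -opprD -splitr; apply; first by rewrite divr_gt0.
by move=> k k0; rewrite eqk.
Qed.

End MomentsToCdf.

(** * Bands *)

Section RealRooted.
Variable R : realType.
Implicit Types (x h t : R) (P : {poly R}).

(* For a product of real linear factors [P], [P (x + h) * P (x - h)] is the product of
   the [(x - r) ^ 2 - h ^ 2] over the roots [r]. *)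
Lemma real_rooted_midpoint (s : seq R) (c : R) x : s != [::] ->
  let P := c *: \prod_(r <- s) ('X - r%:P) in P.[x] != 0 ->
  exists2 h0, 0 < h0 & forall h, 0 < h < h0 -> P.[x + h] * P.[x - h] < P.[x] ^+ 2.
Proof.
move=> s0 P Px.
have PE z : P.[z] = c * \prod_(r <- s) (z - r).
  rewrite /P hornerZ horner_prod; congr (_ * _).
  by apply: eq_bigr => r _; rewrite hornerXsubC.
have c0 : c != 0 by apply: contraNneq Px => c0; rewrite PE c0 mul0r.
have [h0 h0_gt0 h0P] : exists2 h0, 0 < h0 & forall r, r \in s -> h0 <= `|x - r|.
  have : forall r, r \in s -> x - r != 0.
    move=> r rs; apply: contraNneq Px => xr.
    by rewrite PE (big_rem r) //= xr mul0r mulr0.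
  elim: (s) => [|r s' IH] xs; first by exists 1.
  have [|h1 h10 h1P] := IH; first by move=> z zs; apply: xs; rewrite inE zs orbT.
  exists (Num.min h1 `|x - r|).
    by rewrite lt_min h10 normr_gt0 xs // inE eqxx.
  move=> z; rewrite inE => /orP[/eqP ->|/h1P zh]; first by rewrite ge_min lexx orbT.
  by rewrite ge_min zh.
exists h0 => // h /andP[h_gt0 hh0].
have -> : P.[x + h] * P.[x - h] = c ^+ 2 * \prod_(r <- s) ((x - r) ^+ 2 - h ^+ 2).
  rewrite !PE mulrACA -expr2 -big_split /=; congr (_ * _).
  by apply: eq_bigr => r _; ring.
have -> : P.[x] ^+ 2 = c ^+ 2 * \prod_(r <- s) (x - r) ^+ 2.
  by rewrite PE exprMn prodrXl.
rewrite ltr_pM2l; last by rewrite exprn_even_gt0.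
rewrite big_seq [X in _ < X]big_seq; apply: ltr_prod.
  by case: (s) s0 => // r s' _; apply/hasP; exists r; rewrite inE eqxx.
move=> r rs; have h2 : 0 < h ^+ 2 by rewrite exprn_gt0.
rewrite gtrBl h2 andbT subr_ge0 -[leRHS]real_normK ?num_real //.
have hr := le_trans (ltW hh0) (h0P r rs).
by rewrite lerXn2r ?nnegrE ?(ltW h_gt0).
Qed.

Variables (D : {poly R}) (l u : R).
Hypothesis D_deg : (1 < size D)%N.
Hypothesis D_real : forall t, l < t < u -> exists s : seq R,
  D - t%:P = lead_coef D *: \prod_(r <- s) ('X - r%:P).

(** At a local minimum take t midway between l and D(x): both D(x + h) - t and D(x - h) - t are at
    least D(x) - t > 0, against [real_rooted_midpoint]. At a maximum take t between D(x) and u. *)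
Lemma no_local_extremum x h1 : l < D.[x] < u -> 0 < h1 ->
  ~ (forall h, 0 < h < h1 -> D.[x] <= D.[x + h] /\ D.[x] <= D.[x - h]) /\
  ~ (forall h, 0 < h < h1 -> D.[x + h] <= D.[x] /\ D.[x - h] <= D.[x]).
Proof.
move=> /andP[lx xu] h10.
have main t : l < t < u -> t != D.[x] -> exists2 h, 0 < h < h1 &
    (D.[x + h] - t) * (D.[x - h] - t) < (D.[x] - t) ^+ 2.
  move=> tlu tx; have [s sE] := D_real tlu.
  have s0 : s != [::].
    apply/eqP => s0; move: sE; rewrite s0 big_nil => E.
    have : (size (D - t%:P)%R <= 1)%N.
      by rewrite E alg_polyC size_polyC; case: (_ != 0).
    rewrite size_polyDl; first by rewrite leqNgt D_deg.
    by rewrite size_polyN (leq_ltn_trans (size_polyC_leq1 _)).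
  have ev z : (lead_coef D *: \prod_(r <- s) ('X - r%:P)).[z] = D.[z] - t.
    by rewrite -sE !hornerE.
  have [|h0 h00 h0P] := @real_rooted_midpoint s (lead_coef D) x s0.
    by rewrite ev subr_eq0 eq_sym.
  have m0 : 0 < Num.min h0 h1 by rewrite lt_min h00.
  exists (Num.min h0 h1 / 2).
    rewrite divr_gt0 //=; have := ge_min h1 h0 h1; rewrite lexx orbT => mh; lra.
  have := h0P (Num.min h0 h1 / 2); rewrite !ev; apply.
  rewrite divr_gt0 //=; have := ge_min h0 h0 h1; rewrite lexx => mh; lra.
split=> ext.
  have [||h hh] := main ((l + D.[x]) / 2); [lra|by rewrite lt_eqF //; lra|].
  by have [? ?] := ext h hh; nra.
have [||h hh] := main ((u + D.[x]) / 2); [lra|by rewrite gt_eqF //; lra|].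
by have [? ?] := ext h hh; nra.
Qed.

(** If D took the same value at x and y, its extrema on [x, y] could only have that value, so D
    would be constant there and the midpoint an interior maximum. *)
Lemma real_rooted_inj a b : (forall x, a < x < b -> l < D.[x] < u) ->
  {in `[a, b] &, injective (horner D)}.
Proof.
move=> ab.
have main x y : a <= x -> x < y -> y <= b -> D.[x] != D.[y].
  move=> ax xy yb; apply/eqP => Dxy.
  have cD : {within `[x, y], continuous (horner D)}.
    by apply: continuous_subspaceT; exact: continuous_horner.
  have inner c : x < c < y -> exists2 h1, 0 < h1 & forall h, 0 < h < h1 ->
      (c + h \in `[x, y]) && (c - h \in `[x, y]).
    move=> /andP[xc cy]; exists (Num.min (c - x) (y - c)).
      by rewrite lt_min !subr_gt0 xc.
    move=> h /andP[h0]; rewrite lt_min !in_itv /= => /andP[h1 h2].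
    by apply/andP; split; apply/andP; split; lra.
  have [c cxy cmax] := EVT_max (ltW xy) cD.
  have [d dxy dmin] := EVT_min (ltW xy) cD.
  have nomax e : x < e < y -> ~ (forall z, z \in `[x, y] -> D.[z] <= D.[e]).
    move=> xey emax; have [h1 h10 h1P] := inner _ xey.
    have [|_ []] := @no_local_extremum e h1 _ h10; first by apply: ab; lra.
    by move=> h /h1P/andP[? ?]; split; apply: emax.
  have nomin e : x < e < y -> ~ (forall z, z \in `[x, y] -> D.[e] <= D.[z]).
    move=> xey emin; have [h1 h10 h1P] := inner _ xey.
    have [|[]] := @no_local_extremum e h1 _ h10; first by apply: ab; lra.
    by move=> h /h1P/andP[? ?]; split; apply: emin.
  have xI : x \in `[x, y] by rewrite bound_itvE ltW.
  have edge e : e \in `[x, y] -> x < e < y \/ D.[e] = D.[x].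
    rewrite in_itv /= !le_eqVlt => /andP[/orP[/eqP ->|xe]]; first by right.
    by move=> /orP[/eqP ->|ey]; [right|left; rewrite xe].
  have [cin|Dc] := edge c cxy; first exact: (nomax c cin).
  have [din|Dd] := edge d dxy; first exact: (nomin d din).
  apply: (nomax ((x + y) / 2)); first by lra.
  move=> z zxy; apply: (le_trans (cmax z zxy)); rewrite Dc -Dd.
  by apply: dmin; rewrite in_itv /=; lra.
move=> x y; rewrite !in_itv /= => /andP[ax xb] /andP[ay yb] Dxy.
have [xy|yx|//] := ltgtP x y.
  by have := main x y ax xy yb; rewrite Dxy eqxx.
by have := main y x ay yx xb; rewrite Dxy eqxx.
Qed.

End RealRooted.

Lemma continuous_comp_within (R : realType) (A : set R) (f g : R -> R) :
  {within A, continuous g} -> continuous f -> (forall x, A (f x)) -> continuous (g \o f).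
Proof.
move=> /subspace_continuousP cg cf Af x.
apply: (@cvg_comp _ _ _ f g _ (within A (nbhs (f x)))); last exact: cg.
move=> V /= VA; have := cf x _ VA; apply: (@filterS _ (nbhs x)) => y /=; apply; exact: Af.
Qed.

Section Bands.
Variables (R : realType) (p : nat) (a b alpha beta : nat -> R).
Hypothesis p_gt0 : (1 <= p)%N.
Hypothesis jac : periodic_jacobi p a b.
Hypothesis bands : are_bands p a b alpha beta.

Let D := discriminant p a b.

Lemma band_lt j : (1 <= j <= p)%N -> alpha j < beta j.
Proof. by case: bands => h _ _; exact: h. Qed.

Lemma band_sep i j : (1 <= i)%N -> (i < j)%N -> (j <= p)%N -> beta i <= alpha j.
Proof.
case: bands => lt sep _ i1; elim: j => // j IH; rewrite ltnS leq_eqVlt => /orP[/eqP <-|ij] jp.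
  by apply: sep; rewrite i1.
apply: le_trans (IH ij (ltnW jp)) _; have j1 : (1 <= j)%N by apply: leq_trans (ltnW ij).
by apply: le_trans (ltW (lt j _)) (sep j _); rewrite j1 // ltnW.
Qed.

Lemma band_horner x : (map_poly (real_complex R) D).[real_complex R x] = real_complex R D.[x].
Proof. by rewrite horner_map. Qed.

Lemma band_in j x : (1 <= j <= p)%N -> alpha j < x < beta j -> -2 < D.[x] < 2.
Proof.
case: bands => _ _ /seteqP[_ sub] jp xj.
have [|t t2] := sub (real_complex R x).
  by exists j => //; exists x => //=; rewrite in_itv.
by rewrite band_horner => /complexI ->.
Qed.

Lemma band_out x : -2 < D.[x] < 2 -> exists2 j, (1 <= j <= p)%N & alpha j < x < beta j.
Proof.
case: bands => _ _ /seteqP[sub _] Dx.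
have [|j jp [y /= yj /complexI yx]] := sub (real_complex R x).
  by exists D.[x] => //; rewrite band_horner.
by exists j => //; rewrite -yx; move: yj; rewrite in_itv.
Qed.

Lemma size_D_gt1 : (1 < size D)%N.
Proof. by rewrite (size_discriminant p_gt0 jac). Qed.

(** The band condition speaks of complex z, so it places every complex root of D - t in a real
    interval. *)
Lemma discriminant_real_rooted t : -2 < t < 2 -> exists s : seq R,
  D - t%:P = lead_coef D *: \prod_(r <- s) ('X - r%:P).
Proof.
move=> t2; pose f := real_complex R.
have [r rE] := closed_field_poly_normal (map_poly f (D - t%:P)).
have real_r z : z \in r -> exists x, z = f x.
  move=> zr; have : (map_poly f (D - t%:P)).[z] = 0.
    by rewrite rE hornerZ horner_prod (big_rem z) //= hornerXsubC subrr mul0r mulr0.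
  rewrite rmorphB /= hornerD hornerN map_polyC hornerC => /eqP; rewrite subr_eq0 => /eqP Dz.
  case: bands => _ _ /seteqP[sub _].
  have [|j _ [y _ yz]] := sub z; first by exists t.
  by exists y.
have [s sE] : exists s, r = map f s.
  elim: (r) real_r => [|z r' IH] h; first by exists [::].
  have [|s ->] := IH; first by move=> w wr; apply: h; rewrite inE wr orbT.
  by have [|x ->] := h z; [rewrite inE eqxx|exists (x :: s)].
exists s; apply: (@map_poly_inj _ _ f); rewrite rE lead_coef_map sE big_map.
rewrite [in RHS]linearZ /= rmorph_prod /= lead_coefDl; last first.
  by rewrite size_polyN (leq_ltn_trans (size_polyC_leq1 _)) // size_D_gt1.
congr (_ *: _); apply: eq_bigr => x _.
by rewrite rmorphB /= map_polyX map_polyC.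
Qed.

Lemma band_inj j : (1 <= j <= p)%N -> {in `[alpha j, beta j] &, injective (horner D)}.
Proof.
move=> jp; apply: (@real_rooted_inj _ D (-2) 2 size_D_gt1 discriminant_real_rooted).
by move=> x; exact: band_in.
Qed.

(** An end lies in no open band, so D is not in (-2, 2) there. Were it beyond, D would take the
    value 2 or -2 inside the band on the way to the midpoint. *)
Lemma band_end j x : (1 <= j <= p)%N -> x = alpha j \/ x = beta j -> D.[x] ^+ 2 = 4.
Proof.
move=> jp xE.
have ab := band_lt jp.
have notin : ~~ (-2 < D.[x] < 2).
  apply/negP => /band_out[i ip xi].
  have [ij|ji|ij] := ltngtP i j.
  - have := band_sep (proj1 (andP ip)) ij (proj2 (andP jp)); lra.
  - have := band_sep (proj1 (andP jp)) ji (proj2 (andP ip)); lra.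
  - by move: xi; rewrite ij; case: xE => ->; rewrite ltxx ?andbF.
have mid := @band_in j ((alpha j + beta j) / 2) jp ltac:(lra).
have cD c d : {within `[c, d], continuous (horner D)}.
  by apply: continuous_subspaceT; exact: continuous_horner.
have noval v : (v = 2 \/ v = -2) -> (D.[x] - v) * (D.[(alpha j + beta j) / 2] - v) < 0 -> False.
  move=> v2; set m := (alpha j + beta j) / 2 => neg.
  have [xm|mx] := leP x m.
    have [z] := @poly_ivtoo R (D - v%:P) x m xm ltac:(by rewrite !hornerE).
    rewrite in_itv /= => /andP[xz zm]; rewrite rootE !hornerE subr_eq0 => /eqP Dz.
    have := @band_in j z jp; rewrite Dz; case: xE => xE.
      by rewrite -xE xz /= => h; have := h ltac:(rewrite /m in zm; lra); case: v2; lra.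
    by rewrite /m in xm; lra.
  have [z] := @poly_ivtoo R (D - v%:P) m x (ltW mx) ltac:(by rewrite !hornerE mulrC).
  rewrite in_itv /= => /andP[mz zx]; rewrite rootE !hornerE subr_eq0 => /eqP Dz.
  have := @band_in j z jp; rewrite Dz; case: xE => xE.
    by rewrite /m in mx; lra.
  by rewrite -xE zx andbT => h; have := h ltac:(rewrite /m in mz; lra); case: v2; lra.
have : D.[x] <= 2.
  rewrite leNgt; apply/negP => gt2; apply: (noval 2); first by left.
  by rewrite pmulr_rlt0; lra.
have : -2 <= D.[x].
  rewrite leNgt; apply/negP => lt2; apply: (noval (-2)); first by right.
  by rewrite nmulr_rlt0; lra.
rewrite le_eqVlt => /orP[/eqP <- _|h1]; first by ring.
rewrite le_eqVlt => /orP[/eqP ->|h2]; first by ring.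
by move: notin; rewrite h1 h2.
Qed.

(** The inverse of Delta on the band, composed with 2 cos. It is thus defined and continuous on the
    whole line, and runs through the band on [0, pi]. *)
Lemma band_param_ex j : (1 <= j <= p)%N -> exists X : R -> R,
  [/\ continuous X, forall th, alpha j <= X th <= beta j,
      forall th, D.[X th] = 2 * cos th &
      forall x, alpha j <= x <= beta j -> exists2 th, 0 <= th <= pi & X th = x].
Proof.
move=> jp; have ab := band_lt jp; set al := alpha j; set be := beta j.
pose g t := xget al [set x | x \in `[al, be] /\ D.[x] = t].
have inj := band_inj jp.
have gK : {in `[al, be], cancel (horner D) g}.
  move=> x xab; rewrite /g; case: xgetP => [y _ [yab Dy]|/(_ x)[]//].
  exact: inj.
have cD : {within `[al, be], continuous (horner D)}.
  by apply: continuous_subspaceT; exact: continuous_horner.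
have Da : D.[al] ^+ 2 = 4 by apply: band_end jp _; left.
have Db : D.[be] ^+ 2 = 4 by apply: band_end jp _; right.
have aI : al \in `[al, be] by rewrite bound_itvE ltW.
have bI : be \in `[al, be] by rewrite bound_itvE ltW.
have Dab : D.[al] != D.[be].
  by apply/eqP => /(inj _ _ aI bI) E; move: ab; rewrite -/al -/be E ltxx.
have sq2 z : z ^+ 2 = 4 -> z = 2 \/ z = -2 :> R.
  move=> z2; have : (z - 2) * (z + 2) = 0 by rewrite -[RHS](subrr 4) -[X in _ = X - _]z2; ring.
  by move=> /eqP; rewrite mulf_eq0 subr_eq0 addr_eq0 => /orP[/eqP|/eqP]; [left|right].
have DI x : x \in `[al, be] -> -2 <= D.[x] <= 2.
  rewrite in_itv /= !le_eqVlt => /andP[/orP[/eqP <-|ax]].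
    by move=> _; case: (sq2 _ Da) => ->; lra.
  move=> /orP[/eqP ->|xb]; first by case: (sq2 _ Db) => ->; lra.
  by have /andP[h1 h2] := @band_in j x jp ltac:(by rewrite ax xb); rewrite h1 h2 !orbT.
have surj t : -2 <= t <= 2 -> exists2 x, x \in `[al, be] & D.[x] = t.
  move=> t2; apply: (IVT (ltW ab) cD).
  have [Ea|Ea] := sq2 _ Da; have [Eb|Eb] := sq2 _ Db; rewrite Ea Eb in Dab *.
  - by rewrite eqxx in Dab.
  - by rewrite minEle maxEle; case: ifP; lra.
  - by rewrite minEle maxEle; case: ifP; lra.
  - by rewrite eqxx in Dab.
have gP t : -2 <= t <= 2 -> g t \in `[al, be] /\ D.[g t] = t.
  by move=> /surj[x xab <-]; rewrite gK.
have cg : {within `[-2, 2], continuous g}.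
  have [Ea|Ea] := sq2 _ Da; have [Eb|Eb] := sq2 _ Db; rewrite Ea Eb in Dab.
  - by rewrite eqxx in Dab.
  - by have := segment_can_ge_continuous (ltW ab) cD gK; rewrite -/al -/be Ea Eb.
  - by have := segment_can_le_continuous (ltW ab) cD gK; rewrite -/al -/be Ea Eb.
  - by rewrite eqxx in Dab.
have cos2 (th : R) : -2 <= 2 * cos th <= 2.
  by have := cos_geN1 th; have := cos_le1 th; lra.
exists (g \o (fun th => 2 * cos th)); split.
- apply: (continuous_comp_within cg); last by move=> x; rewrite /= in_itv /= cos2.
  by move=> x; apply: cvgMr; exact: continuous_cos.
- by move=> th; have [] := gP _ (cos2 th); rewrite in_itv.
- by move=> th; have [] := gP _ (cos2 th).
- move=> x xab; have xI : x \in `[al, be] by rewrite in_itv.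
  have Dx : -1 <= D.[x] / 2 <= 1 by have := DI x xI; lra.
  exists (acos (D.[x] / 2)); first by rewrite acos_ge0 // acos_lepi.
  rewrite /= acosK; last by rewrite in_itv.
  by rewrite mulrC divfK // gK.
Qed.

End Bands.

(** * The logarithmic potential of the band measure *)

Section LogCosine.
Variable R : realType.
Implicit Types (e t phi th : R).
Local Notation mu := (@lebesgue_measure R).

Lemma antiderivative (k : R -> R) (A : R) : continuous k ->
  exists G : R -> R, forall t, A < t -> is_derive t 1 G (k t).
Proof.
move=> ck; exists (fun x => \int[mu]_(t in [set` `[A, x]]) k t)%R => t At.
have t1 : t < t + 1 by rewrite ltrDl.
have int : mu.-integrable `[A, t + 1] (EFin \o k).
  apply: continuous_compact_integrable; first exact: segment_compact.
  exact: continuous_subspaceT.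
have [d E] := continuous_FTC1_closed t1 int At (ck t).
by apply: DeriveDef; [exact: d|rewrite -derive1E; exact: E].
Qed.

Lemma eq_of_derive0 (F : R -> R) (x y : R) : x <= y ->
  (forall t, x <= t <= y -> is_derive t 1 F 0) -> F x = F y.
Proof.
move=> xy dF; have [||c _ /eqP] := @MVT_segment _ F (fun=> 0) x y xy.
- by move=> t; rewrite in_itv /= => /andP[xt ty]; apply: dF; rewrite !ltW.
- apply: derivable_within_continuous => t; rewrite in_itv /= => xt.
  by case: (dF t xt).
by rewrite mul0r subr_eq0 => /eqP.
Qed.

(** A regularisation of log (1 - cos t). By [cos_mul_shift], log |cos phi - cos th| is half the sum
    of the limits at phi + th and phi - th. *)
Definition logcos e t : R := ln (1 + e - cos t).

Lemma logcos_arg_gt0 e t : 0 < e -> 0 < 1 + e - cos t.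
Proof. by move=> e0; have := cos_le1 t; lra. Qed.

Lemma continuous_logcos e : 0 < e -> continuous (logcos e).
Proof.
move=> e0 t; apply: (@continuous_comp _ _ _ (fun t => 1 + e - cos t) (@ln R)).
  by apply: cvgB; [exact: cvg_cst|exact: continuous_cos].
by apply: continuous_ln; exact: logcos_arg_gt0.
Qed.

Lemma logcos_period e t : logcos e (t + pi) = logcos e (t - pi).
Proof. by rewrite /logcos cosDpi cosB cospi sinpi mulr0 addr0 mulrN1. Qed.

(** (1 + e)^2 - cos^2 t = (1 + 4 e + 2 e^2 - cos 2t) / 2. *)
Lemma logcos_double e t : 0 < e ->
  logcos e t + logcos e (t + pi) = logcos (4 * e + 2 * e ^+ 2) (2 * t) - ln 2.
Proof.
move=> e0; have e0' : 0 < 4 * e + 2 * e ^+ 2 by have := exprn_gt0 2 e0; lra.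
have h1 := logcos_arg_gt0 t e0; have h2 := logcos_arg_gt0 (t + pi) e0.
have h3 := logcos_arg_gt0 (2 * t) e0'.
rewrite /logcos -lnM ?posrE // -ln_div ?posrE //; congr ln.
rewrite cosDpi (_ : 2 * t = t + t); last by ring.
rewrite cosD; have := cos2Dsin2 t; rewrite !expr2 => cs.
have -> : sin t * sin t = 1 - cos t * cos t by rewrite -cs; ring.
by move: (cos t) => c; field.
Qed.

(* Integrating [logcos_double] over a period halves the mean of [logcos] while
   multiplying the regularisation by at least 4, so the mean stays bounded as [e] tends to 0. *)
Lemma logcos_mean_ge (J : R -> R) :
  (forall e, 0 < e -> J e = J (4 * e + 2 * e ^+ 2) / 2 - pi * ln 2) ->
  (forall e, 0 < e -> 2 * pi * ln e <= J e) ->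
  forall e, 0 < e -> - (2 * pi * ln 2) <= J e.
Proof.
move=> Jd Jl e e0.
have pi0 := pi_gt0 R.
have base e' : 2^-1 <= e' -> - (2 * pi * ln 2) <= J e'.
  move=> he; have e'0 : 0 < e' by lra.
  apply: le_trans (Jl _ e'0); rewrite -mulrN -lnV ?posrE //.
  by rewrite ler_wpM2l ?mulr_ge0 ?(ltW pi0) // ler_ln ?posrE // invr_gt0.
(* The bound - 2 pi ln 2 is the fixed point of x = x / 2 - pi ln 2, so it passes from the doubled
   regularisation back to e'; k doublings bring e' to at least 4^k e'. *)
have step k e' : 0 < e' -> 2^-1 <= 4 ^+ k * e' -> - (2 * pi * ln 2) <= J e'.
  elim: k e' => [|k IH] e' e'0; first by rewrite expr0 mul1r; exact: base.
  move=> he; have := exprn_gt0 2 e'0 => sq.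
  have e2 : 0 < 4 * e' + 2 * e' ^+ 2 by lra.
  rewrite (Jd e') //.
  have : 2^-1 <= 4 ^+ k * (4 * e' + 2 * e' ^+ 2).
    apply: le_trans he _; rewrite [4 ^+ k.+1]exprSr -mulrA ler_wpM2l ?exprn_ge0 //; lra.
  by move=> /(IH _ e2); lra.
have [k hk] : exists k : nat, 2^-1 <= 4 ^+ k * e.
  exists (Num.truncn (2^-1 / e)).+1.
  have := truncnS_gt (2^-1 / e); rewrite ltr_pdivrMr // => /ltW h.
  apply: le_trans h _; rewrite ler_wpM2r ?(ltW e0) // -natrX ler_nat.
  by apply: ltnW; apply: ltn_expl.
exact: step hk.
Qed.

Lemma is_derive_shift (G : R -> R) (g c t : R) :
  is_derive (c + t) 1 G g -> is_derive t 1 (fun th => G (c + th)) g.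
Proof.
move=> dG; have : is_derive t 1 (G \o (cst c + id : R -> R)) (g * 1).
  by apply: is_derive1_comp; apply: is_derive_eq; rewrite add0r.
by rewrite mulr1.
Qed.

Lemma is_derive_shiftN (G : R -> R) (g c t : R) :
  is_derive (c - t) 1 G g -> is_derive t 1 (fun th => G (c - th)) (- g).
Proof.
move=> dG; have : is_derive t 1 (G \o (cst c - id : R -> R)) (g * -1).
  by apply: is_derive1_comp; apply: is_derive_eq; rewrite sub0r.
by rewrite mulrN1.
Qed.

(** The two terms together sweep [phi - pi, phi + pi], a full period, so the integral does not
    depend on phi. The constant [ln 3] makes the integrand nonnegative for e <= 1, in view of
    monotone convergence. *)
Lemma logcos_integral e : 0 < e -> exists2 J : R, - (2 * pi * ln 2) <= J &
  forall phi, 0 <= phi <= pi ->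
  (\int[mu]_(th in `[0%R, pi]) (- (logcos e (phi + th) + logcos e (phi - th)) / 2 + ln 3)%:E
   = (- J / 2 + pi * ln 3)%:E)%E.
Proof.
move=> e0; have pi0 := pi_gt0 R.
(* The antiderivative is evaluated between -2 pi and 2 pi; starting at -3 pi leaves room on the
   left. *)
have [Gf GfP] : exists Gf : R -> R -> R, forall e, 0 < e ->
    forall t, - 3 * pi < t -> is_derive t 1 (Gf e) (logcos e t).
  have /choice[Gf GfP] : forall e, exists G : R -> R, 0 < e ->
      forall t, - 3 * pi < t -> is_derive t 1 G (logcos e t).
    move=> e'; have [e'0|] := ltP 0 e'; last by exists id.
    by have [G GP] := antiderivative (- 3 * pi) (continuous_logcos e'0); exists G.
  by exists Gf.
pose J e := Gf e pi - Gf e (- pi).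
have JP e' phi : 0 < e' -> - pi <= phi <= pi -> Gf e' (phi + pi) - Gf e' (phi - pi) = J e'.
  move=> e'0 phiI.
  have E : forall x y, - pi <= x -> x <= y -> y <= pi -> Gf e' (x + pi) - Gf e' (x - pi) =
      Gf e' (y + pi) - Gf e' (y - pi).
    move=> x y x1 xy y1; apply: (@eq_of_derive0 (fun t => Gf e' (t + pi) - Gf e' (t - pi))) => // t tI.
    have d1 : is_derive t 1 (fun t => Gf e' (t + pi)) (logcos e' (t + pi)).
      have := @is_derive_shift (Gf e') (logcos e' (t + pi)) pi t.
      rewrite [pi + t]addrC; under eq_fun do rewrite addrC; apply.
      by apply: GfP => //; lra.
    have d2 : is_derive t 1 (fun t => Gf e' (t - pi)) (logcos e' (t - pi)).
      have := @is_derive_shift (Gf e') (logcos e' (t - pi)) (- pi) t.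
      rewrite [- pi + t]addrC; under eq_fun do rewrite addrC; apply.
      by apply: GfP => //; lra.
    rewrite -[0](subrr (logcos e' (t + pi))) {2}logcos_period.
    exact: is_deriveB.
  have := E (- pi) 0 _ _ _; have := E (- pi) phi _ _ _.
  rewrite add0r sub0r /J => h1 h2.
  by rewrite -h1 ?h2; lra.
have Jd e' : 0 < e' -> J e' = J (4 * e' + 2 * e' ^+ 2) / 2 - pi * ln 2.
  move=> e'0; set e2 := 4 * e' + 2 * e' ^+ 2.
  have e20 : 0 < e2 by have := exprn_gt0 2 e'0; rewrite /e2; lra.
  pose F t := Gf e' t + Gf e' (t + pi) - 2^-1 * Gf e2 (2 * t) + ln 2 * t.
  have F0 : F (- pi) = F 0.
    apply: eq_of_derive0; first by lra.
    move=> t tI.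
    have d0 : is_derive t 1 (Gf e') (logcos e' t) by apply: GfP => //; lra.
    have d1 : is_derive t 1 (fun t => Gf e' (t + pi)) (logcos e' (t + pi)).
      have := @is_derive_shift (Gf e') (logcos e' (t + pi)) pi t.
      rewrite [pi + t]addrC; under eq_fun do rewrite addrC; apply.
      by apply: GfP => //; lra.
    have d2 : is_derive t 1 (Gf e2 \o ( *%R 2)) (logcos e2 (2 * t) * 2).
      apply: is_derive1_comp; first by apply: GfP => //; lra.
      rewrite -[ *%R 2]/(2 \*: (id : R -> R)); apply: is_derive_eq.
      by rewrite /GRing.scale /= mulr1.
    rewrite -[F]/(Gf e' + (fun t => Gf e' (t + pi)) - 2^-1 \*: (Gf e2 \o ( *%R 2)) + ln 2 \*: id).
    apply: is_derive_eq.
    have := logcos_double t e'0; rewrite -/e2 => L.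
    by rewrite L /GRing.scale /= mulr1; field.
  have := JP e2 (- pi) e20 ltac:(lra); rewrite /F in F0.
  rewrite addNr (_ : - pi - pi = 2 * - pi); last by ring.
  move: F0; rewrite addNr !mulr0 add0r /J; lra.
exists (J e).
  apply: logcos_mean_ge => // e' e'0.
  pose F t := Gf e' t - ln e' * t.
  have [|||c cI] := @MVT_segment _ F (fun t => logcos e' t - ln e') (- pi) pi.
  - lra.
  - move=> t; rewrite in_itv /= => tI.
    have d0 : is_derive t 1 (Gf e') (logcos e' t) by apply: GfP => //; lra.
    rewrite -[F]/(Gf e' - ln e' \*: id); apply: is_derive_eq.
    by rewrite /GRing.scale /= mulr1.
  - apply: derivable_within_continuous => t; rewrite in_itv /= => tI.
    have d0 : is_derive t 1 (Gf e') (logcos e' t) by apply: GfP => //; lra.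
    have : is_derive t 1 F (logcos e' t - ln e').
      rewrite -[F]/(Gf e' - ln e' \*: id); apply: is_derive_eq.
      by rewrite /GRing.scale /= mulr1.
    by case.
  have le : ln e' <= logcos e' c.
    rewrite ler_ln ?posrE ?logcos_arg_gt0 //.
    by have := cos_le1 c; lra.
  rewrite /F /J opprK => Ec.
  have : 0 <= (logcos e' c - ln e') * (pi + pi) by rewrite mulr_ge0 ?subr_ge0 //; lra.
  by rewrite -Ec; lra.
move=> phi phiI.
pose F th := (- 2^-1) * (Gf e (phi + th) - Gf e (phi - th)) + ln 3 * th.
have dF th : 0 <= th <= pi -> is_derive th 1 F
    (- (logcos e (phi + th) + logcos e (phi - th)) / 2 + ln 3).
  move=> thI.
  have d1 : is_derive th 1 (fun th => Gf e (phi + th)) (logcos e (phi + th)).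
    by apply: is_derive_shift; apply: GfP => //; lra.
  have d2 : is_derive th 1 (fun th => Gf e (phi - th)) (- logcos e (phi - th)).
    by apply: is_derive_shiftN; apply: GfP => //; lra.
  rewrite -[F]/((- 2^-1) \*: ((fun th => Gf e (phi + th)) - (fun th => Gf e (phi - th))) + ln 3 \*: id).
  apply: is_derive_eq.
  by rewrite /GRing.scale /= mulr1; field.
rewrite (@continuous_FTC2 _ _ F).
- rewrite -EFinB; congr EFin; rewrite /F addr0 subr0 mulr0 subrr mulr0 addr0 subr0.
  by rewrite (JP e phi) //; [field|lra].
- exact: pi0.
- apply: continuous_subspaceT => th; apply: cvgD; last exact: cvg_cst.
  have cl := continuous_logcos e0.
  apply: cvgMl; apply: cvgN; apply: cvgD.
    by apply: (@continuous_comp _ _ _ (fun th => phi + th)); [apply: cvgD; [exact: cvg_cst|exact: cvg_id]|exact: cl].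
  by apply: (@continuous_comp _ _ _ (fun th => phi - th)); [apply: cvgB; [exact: cvg_cst|exact: cvg_id]|exact: cl].
- have cF : {within `[0, pi], continuous F}.
    by apply: derivable_within_continuous => th; rewrite in_itv /= => /dF[].
  have [_ l r] := (continuous_within_itvP F pi0).1 cF.
  split => // th; rewrite in_itv /= => /andP[th0 thp].
  by have [] := dF th ltac:(by rewrite !ltW).
- move=> th; rewrite in_itv /= => /andP[th0 thp].
  by rewrite derive1E; have [_ ->] := dF th ltac:(by rewrite !ltW).
Qed.

End LogCosine.

Section LogCosinePotential.
Variable R : realType.
Implicit Types (e t phi th : R) (n : nat).
Local Notation mu := (@lebesgue_measure R).

Lemma cos_mul_shift phi th :
  (1 - cos (phi + th)) * (1 - cos (phi - th)) = (cos phi - cos th) ^+ 2.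
Proof.
rewrite cosD cosB.
have h1 := cos2Dsin2 phi; have h2 := cos2Dsin2 th; rewrite !expr2 in h1 h2 *.
move: h1 h2; move: (cos phi) (sin phi) (cos th) (sin th) => x y z w h1 h2.
have E : y * y = 1 - x * x by rewrite -h1; ring.
have E' : w * w = 1 - z * z by rewrite -h2; ring.
have -> : (1 - (x * z - y * w)) * (1 - (x * z + y * w)) =
  (1 - x * z) * (1 - x * z) - (y * y) * (w * w) by ring.
by rewrite E E'; ring.
Qed.

Lemma logcos_le e t : 0 < e <= 1 -> logcos e t <= ln 3.
Proof.
move=> /andP[e0 e1]; rewrite ler_ln ?posrE ?logcos_arg_gt0 //.
by have := cos_geN1 t; lra.
Qed.

Lemma logcos_nd e1 e2 t : 0 < e1 <= e2 -> logcos e1 t <= logcos e2 t.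
Proof.
move=> /andP[e0 e12]; have e20 := lt_le_trans e0 e12.
by rewrite ler_ln ?posrE ?logcos_arg_gt0 //; lra.
Qed.

Lemma cvg_logcos phi th :
  (fun n => (- (logcos (@harmonic R n) (phi + th) + logcos (@harmonic R n) (phi - th)) / 2)%:E) @ \oo
    --> (- lne (`|cos phi - cos th|%:E))%E.
Proof.
have h0 n : 0 < @harmonic R n by rewrite /harmonic invr_gt0.
pose u n : R := (1 + @harmonic R n - cos (phi + th)) * (1 + @harmonic R n - cos (phi - th)).
have u0 n : 0 < u n by rewrite mulr_gt0 ?logcos_arg_gt0.
have -> : (fun n => (- (logcos (@harmonic R n) (phi + th) + logcos (@harmonic R n) (phi - th)) / 2)%:E) =
    (fun n => (- ln (u n) / 2)%:E).
  by apply/funext => n; rewrite /u /logcos lnM // posrE logcos_arg_gt0.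
have ulim : u @ \oo --> (cos phi - cos th) ^+ 2.
  rewrite -cos_mul_shift; apply: cvgM.
    by apply: cvgB; last exact: cvg_cst; rewrite -[X in _ --> X]addr0; apply: cvgD; [exact: cvg_cst|exact: cvg_harmonic].
  by apply: cvgB; last exact: cvg_cst; rewrite -[X in _ --> X]addr0; apply: cvgD; [exact: cvg_cst|exact: cvg_harmonic].
have [E|d0] := eqVneq (cos phi) (cos th).
  rewrite E subrr normr0 le0_lneNy //=; apply/cvgeryP/cvgryPge => A.
  have : \forall n \near \oo, u n <= expR (- (2 * A)).
    apply: (cvgr_le 0); last exact: expR_gt0.
    by move: ulim; rewrite E subrr expr0n.
  apply: filterS => n un; rewrite ler_pdivlMr // lerNr mulrC.
  by rewrite -(expRK (- (2 * A))) ler_ln ?posrE ?expR_gt0.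
have d1 : 0 < `|cos phi - cos th| by rewrite normr_gt0 subr_eq0.
rewrite lne_EFin //; apply: cvg_EFin; first exact: nearW.
rewrite (_ : (- ln `|cos phi - cos th|)%R = - ln ((cos phi - cos th) ^+ 2) / 2); last first.
  by rewrite -[(_ - _) ^+ 2]real_normK ?num_real // lnXn // -mulr_natl; field.
apply: cvgMl; apply: cvgN.
apply: (@cvg_comp _ _ _ u (@ln R) _ _ _ ulim).
by apply: continuous_ln; rewrite exprn_even_gt0 //= subr_eq0.
Qed.

(** As e decreases to 0, the integrals of [logcos_integral] increase to this one. They are
    independent of phi, hence so is the limit, and the lower bound on J keeps it finite. *)
Lemma log_cos_potential : exists W : R, forall phi, 0 <= phi <= pi ->
  (\int[mu]_(th in `[0%R, pi]) (- lne (`|cos phi - cos th|%:E) + (ln 3)%:E) = W%:E)%E.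
Proof.
have h0 n : 0 < @harmonic R n by rewrite /harmonic invr_gt0.
have h1 n : 0 < @harmonic R n <= 1.
  by rewrite h0 /harmonic invf_le1 // ler1n.
have pi0 := pi_gt0 R.
pose f phi n th := - (logcos (@harmonic R n) (phi + th) + logcos (@harmonic R n) (phi - th)) / 2 + ln 3.
have [J JP] : exists J : nat -> R, forall n, - (2 * pi * ln 2) <= J n /\
   forall phi, 0 <= phi <= pi ->
   (\int[mu]_(th in `[0%R, pi]) (f phi n th)%:E = (- J n / 2 + pi * ln 3)%:E)%E.
  have /choice[J JP] : forall n, exists J, - (2 * pi * ln 2) <= J /\
     forall phi, 0 <= phi <= pi ->
     (\int[mu]_(th in `[0%R, pi]) (f phi n th)%:E = (- J / 2 + pi * ln 3)%:E)%E.
    by move=> n; have [J J1 J2] := logcos_integral (h0 n); exists J.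
  by exists J.
have f0 phi n th : 0 <= f phi n th.
  by have := logcos_le (phi + th) (h1 n); have := logcos_le (phi - th) (h1 n); rewrite /f; lra.
have lim phi : 0 <= phi <= pi -> (fun n => (- J n / 2 + pi * ln 3)%:E) @ \oo -->
    (\int[mu]_(th in `[0%R, pi]) (- lne (`|cos phi - cos th|%:E) + (ln 3)%:E))%E.
  move=> phiI.
  have -> : (fun n => (- J n / 2 + pi * ln 3)%:E) =
      (fun n => \int[mu]_(th in `[0%R, pi]) (f phi n th)%:E)%E.
    by apply/funext => n; rewrite (proj2 (JP n)).
  have limE th : limn (fun n => (f phi n th)%:E) = (- lne (`|cos phi - cos th|%:E) + (ln 3)%:E)%E.
    apply: cvg_lim => //; under eq_fun do rewrite /f EFinD.
    by apply: cvgeD; [exact: fin_num_adde_defl|exact: cvg_logcos|exact: cvg_cst].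
  under eq_integral do rewrite -limE.
  apply: cvg_monotone_convergence => //.
  - move=> n; apply/measurable_EFinP; apply: measurable_funTS.
    apply: continuous_measurable_fun => th; apply: cvgD; last exact: cvg_cst.
    have cl := continuous_logcos (h0 n).
    apply: cvgMl; apply: cvgN; apply: cvgD.
      by apply: (@continuous_comp _ _ _ (fun th => phi + th)); [apply: cvgD; [exact: cvg_cst|exact: cvg_id]|exact: cl].
    by apply: (@continuous_comp _ _ _ (fun th => phi - th)); [apply: cvgB; [exact: cvg_cst|exact: cvg_id]|exact: cl].
  - by move=> n th _; rewrite lee_fin.
  - move=> th _ m n mn; rewrite lee_fin /f lerD2r ler_pM2r ?invr_gt0 // lerN2.
    have hh : 0 < @harmonic R n <= @harmonic R m.
      by rewrite h0 /harmonic lef_pV2 ?posrE ?ltr0n // ler_nat.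
    by apply: lerD; apply: logcos_nd.
have I0 : 0 <= (0 : R) <= pi by rewrite lexx ltW.
have [W WE] : exists W : R,
    (\int[mu]_(th in `[0%R, pi]) (- lne (`|cos 0 - cos th|%:E) + (ln 3)%:E) = W%:E)%E.
  set I := (\int[mu]_(th in `[0%R, pi]) (- lne (`|cos 0 - cos th|%:E) + (ln 3)%:E))%E.
  have Ile : (I <= (pi * ln 2 + pi * ln 3)%:E)%E.
    rewrite /I -(cvg_lim _ (lim _ I0)) //; apply: lime_le; first by apply/cvg_ex; eexists; exact: lim I0.
    by apply: nearW => n; rewrite lee_fin; have [? _] := JP n; lra.
  have Ige : (0 <= I)%E.
    rewrite /I -(cvg_lim _ (lim _ I0)) //; apply: lime_ge; first by apply/cvg_ex; eexists; exact: lim I0.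
    apply: nearW => n; rewrite -(proj2 (JP n) _ I0); apply: integral_ge0 => th _.
    by rewrite lee_fin.
  exists (fine I); rewrite fineK // fin_real // (lt_le_trans _ Ige) ?ltNyr //=.
  by rewrite (le_lt_trans Ile) // ltry.
exists W => phi phiI; rewrite -WE.
by apply: (cvg_unique _ (lim _ phiI) (lim _ I0)).
Qed.

End LogCosinePotential.

Section LneProduct.
Variable R : realType.

Lemma lne_normM (x y : R) : (- lne (`|x * y|%:E) = - lne (`|x|%:E) - lne (`|y|%:E))%E.
Proof.
have lne0 : lne (`|0 : R|%:E) = -oo%E by rewrite normr0 le0_lneNy.
have [->|x0] := eqVneq x 0.
  rewrite mul0r lne0; have [->|y0] := eqVneq y 0; first by rewrite lne0.
  by rewrite lne_EFin ?normr_gt0.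
have [->|y0] := eqVneq y 0.
  by rewrite mulr0 lne0 lne_EFin ?normr_gt0.
rewrite !lne_EFin ?normr_gt0 ?mulf_neq0 // normrM lnM ?posrE ?normr_gt0 //.
by rewrite -!EFinN -EFinD opprD.
Qed.

Lemma lne_norm_prod n (u : 'I_n -> R) :
  (\sum_(i < n) - lne (`|u i|%:E) = - lne (`|\prod_(i < n) u i|%:E))%E.
Proof.
elim: n u => [|n IH] u; first by rewrite !big_ord0 normr1 lne1 oppe0.
by rewrite !big_ord_recr /= IH lne_normM.
Qed.

End LneProduct.

(** * The image of the uniform angle on the bands and its potential *)

Section BandMeasure.
Variables (R : realType) (n : nat).
Variable X : nat -> {mfun measurableTypeR R >-> measurableTypeR R}.
Local Notation mu := (@lebesgue_measure R).

Definition unif : probability (measurableTypeR R) R := uniform_prob (pi_gt0 R).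

Definition band_measure : set (measurableTypeR R) -> \bar R :=
  mscale (n.+1%:R^-1)%:nng (msum (fun j => distribution unif (X j.+1)) n.+1).

HB.instance Definition _ := Measure.on band_measure.

Lemma band_measureE A : band_measure A =
  ((n.+1%:R^-1)%:E * \sum_(j < n.+1) unif (X j.+1 @^-1` A))%E.
Proof. by []. Qed.

Let band_measureT : band_measure setT = 1%E.
Proof.
rewrite band_measureE (eq_bigr (fun=> 1%E)); last first.
  by move=> j _; rewrite preimage_setT probability_setT.
by rewrite sumEFin big_const_ord iter_addr_0 -EFinM mulVf ?pnatr_eq0.
Qed.

HB.instance Definition _ :=
  Measure_isProbability.Build _ _ R band_measure band_measureT.

Variable B : set R.
Hypothesis mB : measurable B.
Hypothesis XB : forall j th, (1 <= j <= n.+1)%N -> B (X j th).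

Lemma band_measure_support : band_measure B = 1%E.
Proof.
rewrite -band_measureT !band_measureE; congr (_ * _)%E.
apply: eq_bigr => j _; congr (unif _).
by apply/seteqP; split=> th _ //=; apply: XB; rewrite ltn_ord.
Qed.

Lemma band_measure_integral (f : R -> \bar R) : measurable_fun B f ->
  (forall y, B y -> 0 <= f y)%E ->
  (\int[band_measure]_(y in B) f y =
   (n.+1%:R^-1)%:E * ((pi - 0)^-1%:E *
     \int[mu]_(th in `[0%R, pi]) (\sum_(j < n.+1) f (X j.+1 th))%E))%E.
Proof.
move=> mf f0.
have mfX (j : 'I_n.+1) : measurable_fun setT (fun th => f (X j.+1 th)).
  apply: (measurable_comp mB) => //; last exact: (measurable_funPT (X j.+1)).
  by move=> _ [th _ <-]; apply: XB; rewrite ltn_ord.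
have f0X (j : 'I_n.+1) th : (0 <= f (X j.+1 th))%E.
  by apply: f0; apply: XB; rewrite ltn_ord.
rewrite ge0_integral_mscale // ge0_integral_measure_sum //; congr (_ * _)%E.
rewrite ge0_integral_sum //; last by move=> j; apply: measurable_funTS; exact: mfX.
rewrite ge0_sume_distrr; last first.
  by move=> j _; apply: integral_ge0 => th _; exact: f0X.
apply: eq_bigr => j _.
rewrite ge0_integral_pushforward //; last by move=> y /set_mem; exact: f0.
rewrite (_ : _ @^-1` B = setT); last first.
  by apply/seteqP; split=> th _ //=; apply: XB; rewrite ltn_ord.
rewrite (integral_uniform (pi_gt0 R)) //; [exact: mfX|exact: f0X].
Qed.

Variables (s c : R) (D : R -> R).
Hypotheses (s_gt0 : 0 < s) (Bs : B `<=` `[- s, s]) (c_gt0 : 0 < c).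
Hypothesis DB : forall x, B x -> exists2 phi, 0 <= phi <= pi & D x = 2 * cos phi.
Hypothesis DX : forall x th, 0 < th < pi ->
  D x - 2 * cos th = c * \prod_(j < n.+1) (x - X j.+1 th).

(** Summed over the bands, log |x - X_j th| is log |D x - 2 cos th| minus log c. As D x = 2 cos phi
    for x in B, this reduces to [log_cos_potential] at phi. *)
Lemma band_potential : exists V : R, forall x, B x ->
  (\int[band_measure]_(y in B) (- lne (`|x - y|%:E)) = V%:E)%E.
Proof.
have [W WP] := log_cos_potential R.
have pi0 := pi_gt0 R.
(* On B one has |x - y| <= 2 s, so adding [C] makes the kernel nonnegative, as
   [band_measure_integral] requires. [K] collects the remaining constants. *)
pose C := ln (2 * s).
pose K := n.+1%:R * C - ln (2 / c) - ln 3.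
pose V' := n.+1%:R^-1 * ((pi - 0)^-1 * (W + K * pi)).
exists (V' - C) => x Bx.
have [phi phiI Dphi] := DB Bx.
have fge y : B y -> (0 <= - lne (`|x - y|%:E) + C%:E)%E.
  move=> By; have [->|xy] := eqVneq x y; first by rewrite subrr normr0 le0_lneNy //= leey.
  have xy0 : 0 < `|x - y| by rewrite normr_gt0 subr_eq0.
  rewrite lne_EFin // -EFinN -EFinD lee_fin addrC subr_ge0 ler_ln ?posrE ?mulr_gt0 //.
  have := Bs Bx; have := Bs By; rewrite /= !in_itv /= => /andP[??] /andP[??].
  by rewrite ler_norml; lra.
have mlog : measurable_fun B (fun y => - lne (`|x - y|%:E))%E.
  by apply: measurable_funTS; exact: measurable_log_dist.
have mf : measurable_fun B (fun y => - lne (`|x - y|%:E) + C%:E)%E.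
  by apply: emeasurable_funD => //.
have int_f : (\int[band_measure]_(y in B) (- lne (`|x - y|%:E) + C%:E) = V'%:E)%E.
  rewrite band_measure_integral //.
  have mlc : measurable_fun setT (fun th : R => - lne (`|cos phi - cos th|%:E))%E.
    apply: (measurableT_comp (measurable_log_dist (cos phi))).
    by apply: continuous_measurable_fun; exact: continuous_cos.
  rewrite (_ : (\int[mu]_(th in _) _)%E =
     (\int[mu]_(th in `[0%R, pi]) (- lne (`|cos phi - cos th|%:E) + (ln 3)%:E + K%:E))%E).
    have mpi : mu `[0%R, pi] = pi%:E.
      by rewrite lebesgue_measure_itv /= lte_fin pi0 -EFinB subr0.
    have i1 : mu.-integrable `[0%R, pi] (fun th => - lne (`|cos phi - cos th|%:E) + (ln 3)%:E)%E.
      apply: integrable_fin_integral => //; last by rewrite WP.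
      by apply: measurable_funTS; apply: emeasurable_funD.
    have i2 : mu.-integrable `[0%R, pi] (fun=> K%:E).
      apply/integrableP; split=> //.
      by rewrite integral_cst //= mpi -EFinM ltry.
    rewrite integralD //.
    by rewrite WP // integral_cst //= mpi /V' 2!EFinM (EFinD W) (EFinM K).
  have m1 : measurable_fun `]0%R, pi[ (fun th => (\sum_(j < n.+1)
      (- lne (`|x - X j.+1 th|%:E) + C%:E))%E).
    apply: emeasurable_sum => j; apply: measurable_funTS.
    apply: (measurable_comp mB _ mf); last exact: (measurable_funPT (X j.+1)).
    by move=> _ [th _ <-]; apply: XB; rewrite ltn_ord.
  have m2 : measurable_fun `]0%R, pi[ (fun th =>
      (- lne (`|cos phi - cos th|%:E) + (ln 3)%:E + K%:E)%E).
    by apply: measurable_funTS; apply: emeasurable_funD => //; apply: emeasurable_funD.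
  (* The end points are null, and the factorisation [DX] is available strictly between them. *)
  rewrite [LHS](integral_itv_bndoo _ _ m1) [RHS](integral_itv_bndoo _ _ m2).
  apply: eq_integral => th /set_mem /=; rewrite in_itv /= => thI.
  rewrite big_split /= lne_norm_prod sumEFin big_const_ord iter_addr_0.
  have -> : \prod_(i < n.+1) (x - X i.+1 th) = (2 / c) * (cos phi - cos th).
    apply: (mulfI (negbT (gt_eqF c_gt0))); rewrite -DX // Dphi; field.
    by rewrite gt_eqF.
  rewrite lne_normM [`|2 / c|]gtr0_norm ?divr_gt0 // lne_EFin ?divr_gt0 //.
  rewrite addeAC addeC -[RHS]addeA; congr (_ + _)%E.
  by rewrite -EFinN -!EFinD; congr EFin; rewrite /K -mulr_natl; ring.
have i1 : band_measure.-integrable B (fun y => - lne (`|x - y|%:E) + C%:E)%E.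
  by apply: integrable_fin_integral => //; rewrite int_f.
have i2 : band_measure.-integrable B (fun=> (- C)%:E).
  apply/integrableP; split=> //.
  by rewrite integral_cst // [X in (_ * X)%E]band_measure_support mule1 ltry.
rewrite (_ : (fun y => - lne (`|x - y|%:E))%E =
  (fun y => (- lne (`|x - y|%:E) + C%:E) + (- C)%:E)%E); last first.
  by apply/funext => y; rewrite EFinN addeK.
rewrite integralD // int_f integral_cst //.
by rewrite [X in (_ + _ * X)%E]band_measure_support mule1 -EFinD.
Qed.

End BandMeasure.

Section UniformLaw.
Variable R : realType.
Local Notation mu := (@lebesgue_measure R).

Lemma unifE (A : set R) : measurable A ->
  unif R A = ((pi^-1)%:E * mu (A `&` `[0%R, pi]))%E.
Proof.
move=> mA; have -> : unif R A = (\int[unif R]_x (\1_A x)%:E)%E.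
  by rewrite integral_indic // setIT.
rewrite (integral_uniform (pi_gt0 R)) ?subr0 //; last first.
  by apply/measurable_EFinP; exact: measurable_indic.
by rewrite integral_indic.
Qed.

Lemma unif_fiber (X : R -> R) x : continuous X ->
  {in `[0%R, pi] &, injective X} -> unif R (X @^-1` [set x]) = 0%E.
Proof.
move=> cX inj.
have mX : measurable (X @^-1` [set x]).
  by rewrite -[X in measurable X]setTI; apply: continuous_measurable_fun.
rewrite unifE //.
have [[t [tx tI]]|none] := pselect (exists t, X t = x /\ t \in `[0%R, pi]).
  rewrite (_ : _ `&` _ = [set t]) ?lebesgue_measure_set1 ?mule0 //.
  apply/seteqP; split=> [u [/= ux uI]|u /= ->]; last by split.
  by apply: inj => //; rewrite tx.
rewrite (_ : _ `&` _ = set0) ?measure0 ?mule0 //.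
by rewrite -subset0 => t [tx tI]; apply: none; exists t.
Qed.

End UniformLaw.

(** * The distribution function of the equilibrium measure *)

Section EquilibriumCdf.
Variables (R : realType) (n : nat) (a b alpha beta : nat -> R).
Let p := n.+1.
Hypothesis jac : periodic_jacobi p a b.
Hypothesis bands : are_bands p a b alpha beta.
Let D := discriminant p a b.
Variable X : nat -> R -> R.
Hypothesis cX : forall j, continuous (X j).
Hypothesis X_band : forall j th, (1 <= j <= p)%N -> alpha j <= X j th <= beta j.
Hypothesis X_cos : forall j th, (1 <= j <= p)%N -> D.[X j th] = 2 * cos th.
Hypothesis X_surj : forall j x, (1 <= j <= p)%N -> alpha j <= x <= beta j ->
  exists2 th, 0 <= th <= pi & X j th = x.

Lemma cos_lt1 (th : R) : 0 < th < pi -> -1 < cos th < 1.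
Proof.
move=> thI; have s0 : 0 < sin th by apply: sin_gt0_pi.
have := cos2Dsin2 th; have := exprn_gt0 2 s0; nra.
Qed.

Lemma X_inj j : (1 <= j <= p)%N -> {in `[0%R, pi] &, injective (X j)}.
Proof.
move=> jp s t sI tI E; apply: cos_inj => //.
by have := X_cos s jp; rewrite E (X_cos t jp) => /(mulfI _); rewrite pnatr_eq0 => /(_ isT).
Qed.

Lemma X_open j th : (1 <= j <= p)%N -> 0 < th < pi -> alpha j < X j th < beta j.
Proof.
move=> jp /cos_lt1 c1.
have nend : D.[X j th] ^+ 2 != 4.
  by rewrite X_cos // lt_eqF //; nra.
have /andP[h1 h2] := X_band th jp; rewrite !lt_neqAle h1 h2 !andbT.
apply/andP; split; apply: contraNneq nend => E; apply/eqP.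
  by apply: (band_end bands jp); left.
by apply: (band_end bands jp); right.
Qed.

(** For th strictly between 0 and pi the points X_j th lie in disjoint open bands, so they are p
    distinct roots of a polynomial of degree p. At th = 0 or pi, touching bands may share a
    point. *)
Lemma discriminant_factor x th : 0 < th < pi ->
  D.[x] - 2 * cos th = lead_coef D * \prod_(j < p) (x - X j.+1 th).
Proof.
move=> thI; pose rs := [seq X j.+1 th | j <- iota 0 p].
pose P := D - (2 * cos th)%:P.
have sc : (size (- (2 * cos th)%:P) < size D)%N.
  by rewrite size_polyN (leq_ltn_trans (size_polyC_leq1 _)) // (size_discriminant _ jac).
have sP : size P = (size rs).+1.
  by rewrite /P size_polyDl // size_map size_iota (size_discriminant _ jac).
have rP : all (root P) rs.
  apply/allP => z /mapP[j]; rewrite mem_iota add0n => /andP[_ jp] ->.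
  by rewrite rootE /P !hornerE X_cos ?subrr.
have uP : poly.uniq_roots rs.
  rewrite uniq_rootsE map_inj_in_uniq ?iota_uniq // => i j.
  rewrite !mem_iota !add0n => /andP[_ ip] /andP[_ jp'] E.
  have /andP[i1 i2] := @X_open i.+1 th ip thI; have /andP[j1 j2] := @X_open j.+1 th jp' thI.
  have [ij|ji|//] := ltngtP i j.
    have h := @band_sep R p a b alpha beta bands i.+1 j.+1 isT ij jp'.
    by have := lt_trans (lt_le_trans i2 h) j1; rewrite E ltxx.
  have h := @band_sep R p a b alpha beta bands j.+1 i.+1 isT ji ip.
  by have := lt_trans (lt_le_trans j2 h) i1; rewrite E ltxx.
have := congr1 (horner^~ x) (all_roots_prod_XsubC sP rP uP).
rewrite /P lead_coefDl // !hornerE horner_prod => ->; congr (_ * _).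
rewrite /rs big_map -[iota 0 p]/(index_iota 0 p) big_mkord.
by apply: eq_bigr => j _; rewrite hornerXsubC.
Qed.

Let B := band_union p alpha beta.

Lemma measurable_band_union : measurable B.
Proof. by apply: bigcup_measurable => j _; exact: measurable_itv. Qed.

Lemma band_union_bounded : exists2 s : R, 0 < s & B `<=` `[- s, s].
Proof.
exists (`|alpha 1%N| + `|beta p| + 1).
  by rewrite ltr_wpDl // addr_ge0.
move=> x [j /= /andP[j1 jp]]; rewrite !in_itv /= => /andP[ax xb].
have a1 : alpha 1%N <= alpha j.
  case: (ltngtP 1%N j) j1 => // [j1 _|<- //].
  by apply: le_trans (@band_sep _ _ _ _ _ _ bands 1 j isT j1 jp); rewrite ltW // (band_lt bands).
have bp : beta j <= beta p.
  case: (ltngtP j p) jp => // [jp' _|-> //].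
  apply: le_trans (@band_sep _ _ _ _ _ _ bands j p j1 jp' (leqnn _)) _.
  by rewrite ltW // (band_lt bands) // leqnn.
have := ler_norm (- alpha 1%N); have := ler_norm (beta p); rewrite normrN.
have := normr_ge0 (alpha 1%N); have := normr_ge0 (beta p).
by move=> ????; apply/andP; split; lra.
Qed.

Variable dk : probability (measurableTypeR R) R.
Hypothesis dk_eq : equilibrium_measure B dk.

Lemma eq_cdfE x : eq_cdf alpha dk x = fine (dk (ray x `&` B)).
Proof.
have mB := measurable_band_union.
have mI : measurable ([set` `[alpha 1%N, x]] : set R) by exact: measurable_itv.
rewrite /eq_cdf Rintegral_cst // mul1r; congr fine.
have [dkB _] := dk_eq.
transitivity (dk ([set` `[alpha 1%N, x]] `&` B)).
  rewrite (measureDI dk mI mB) -[RHS]add0e; congr (_ + _)%E.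
  have dkC : dk (~` B) = 0%E by rewrite probability_setC // dkB subee.
  apply/eqP; rewrite -measure_le0 -dkC; apply: le_measure.
  - by rewrite inE; exact: measurableD.
  - by rewrite inE; exact: measurableC.
  - by move=> y [].
congr (dk _); apply/seteqP; split=> y [/= yx By]; split=> //.
  by move: yx; rewrite /ray /= !in_itv /= => /andP[].
move: yx; rewrite /ray /= !in_itv /= => ->; rewrite andbT.
case: By => j /= /andP[j1 jp]; rewrite in_itv /= => /andP[ay _].
apply: le_trans ay; case: (ltngtP 1%N j) j1 => // [j1 _|<- //].
by apply: le_trans (@band_sep _ _ _ _ _ _ bands 1 j isT j1 jp); rewrite ltW // (band_lt bands).
Qed.

Let mX j : measurable_fun [set: measurableTypeR R] (X j : measurableTypeR R -> measurableTypeR R).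
Proof. exact: continuous_measurable_fun. Qed.

Let Xm j : {mfun measurableTypeR R >-> measurableTypeR R} :=
  HB.pack (X j : measurableTypeR R -> measurableTypeR R)
    (isMeasurableFun.Build _ _ (measurableTypeR R) (measurableTypeR R) (X j) (@mX j)).

Let nu : probability (measurableTypeR R) R := band_measure n Xm.

Let XB j th : (1 <= j <= p)%N -> B (Xm j th).
Proof. by move=> jp; exists j => //=; rewrite in_itv /=; exact: X_band. Qed.

(** The measure [nu] has constant potential on B, so the minimiser has the same moments; and it has
    no atoms, so all rays can be compared. *)
Lemma dk_ray x : dk (ray x `&` B) = nu (ray x `&` B).
Proof.
have mB := measurable_band_union; have [s s0 Bs] := band_union_bounded.
have [dkB dk_min] := dk_eq.
have nuB : nu B = 1%E by apply: band_measure_support; exact: XB.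
have lead0 : 0 < lead_coef D by apply: lead_discriminant_gt0.
have DB y : B y -> exists2 phi, 0 <= phi <= pi & D.[y] = 2 * cos phi.
  case=> j /= jp; rewrite in_itv /= => /(X_surj jp)[phi phiI <-].
  by exists phi => //; exact: X_cos.
have [V VP] := @band_potential R n Xm B mB XB s (lead_coef D) (horner D) s0 Bs lead0 DB
  discriminant_factor.
apply: (ray_eq s0 mB Bs) => // [k k0|].
  by apply: (energy_moments s0 mB Bs nuB VP) => //; exact: dk_min.
rewrite [LHS]band_measureE big1 ?mule0 // => j _.
by apply: unif_fiber; [exact: cX|apply: X_inj; rewrite ltn_ord].
Qed.

Lemma unif_band j s t : (1 <= j <= p)%N -> 0 <= s <= pi -> 0 <= t <= pi -> X j s <= X j t ->
  unif R (X j @^-1` [set` `]X j s, X j t]]) = (`|s - t| / pi)%:E.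
Proof.
move=> jp sI tI st.
have mA : measurable (X j @^-1` [set` `]X j s, X j t]]).
  by rewrite -[X in measurable X]setTI; apply: continuous_measurable_fun => //; exact: cX.
have sI' : s \in `[0%R, pi] by rewrite in_itv.
have tI' : t \in `[0%R, pi] by rewrite in_itv.
rewrite unifE // mulrC EFinM; congr (_ * _)%E.
have cXI : {within `[0%R, pi], continuous (X j)}.
  by apply: continuous_subspaceT; exact: cX.
case: (itv_continuous_inj_mono cXI (X_inj jp)) => mono.
  have le := le_mono_in mono; have lt := leW_mono_in le.
  rewrite le // in st.
  rewrite (_ : _ `&` _ = [set` `]s, t]]); last first.
    apply/seteqP; split=> u /=; rewrite !in_itv /=.
      move=> [/andP[u1 u2] uI]; have uI' : u \in `[0%R, pi] by rewrite in_itv.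
      by rewrite -(lt s u) // -(le u t) // u1.
    move=> /andP[su ut]; have uI : 0 <= u <= pi by lra.
    have uI' : u \in `[0%R, pi] by rewrite in_itv.
    by split=> //; rewrite lt // le // su.
  rewrite lebesgue_measure_itv /= lte_fin distrC ger0_norm ?subr_ge0 //.
  by case: ltgtP st => // -> _; rewrite subrr.
have le := le_nmono_in mono; have lt := leW_nmono_in le.
rewrite le // in st.
rewrite (_ : _ `&` _ = [set` `[t, s[]); last first.
  apply/seteqP; split=> u /=; rewrite !in_itv /=.
    move=> [/andP[u1 u2] uI]; have uI' : u \in `[0%R, pi] by rewrite in_itv.
    by rewrite -(lt s u) // u1 andbT -(le u t).
  move=> /andP[tu us]; have uI : 0 <= u <= pi by lra.
  have uI' : u \in `[0%R, pi] by rewrite in_itv.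
  by split=> //; rewrite lt // le // tu us.
rewrite lebesgue_measure_itv /= lte_fin ger0_norm ?subr_ge0 //.
by case: ltgtP st => // -> _; rewrite subrr.
Qed.

Lemma eq_cdf_band j s t : (1 <= j <= p)%N -> 0 <= s <= pi -> 0 <= t <= pi -> X j s <= X j t ->
  eq_cdf alpha dk (X j t) - eq_cdf alpha dk (X j s) = `|s - t| / (pi * p%:R).
Proof.
move=> jp sI tI st; have mB := measurable_band_union.
have mray x : measurable (ray x `&` B).
  by apply: measurableI => //; exact: measurable_itv.
rewrite !eq_cdfE !dk_ray.
have sub : ray (X j s) `&` B `<=` ray (X j t) `&` B.
  move=> z [zs Bz]; split=> //; move: zs; rewrite /ray /= !in_itv /= => zs.
  exact: le_trans zs st.
have fin x : nu (ray x `&` B) \is a fin_num by rewrite fin_num_measure //; exact: mray.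
rewrite -fineB // -[RHS]/(fine (`|s - t| / (pi * p%:R))%:E); congr fine.
transitivity (nu ((ray (X j t) `&` B) `\` (ray (X j s) `&` B))).
  have := @measureD _ _ _ nu _ _ (mray (X j t)) (mray (X j s)).
  by rewrite (setIidr sub) => ->//; rewrite ltey_eq fin.
rewrite [LHS]band_measureE.
have j1p : (j.-1 < p)%N by case: j jp {st sub} => // j /andP[].
rewrite (bigD1 (Ordinal j1p)) //= big1 ?adde0; last first.
  (* Another band meets the interval from X j s to X j t at most in its own end points, whose fibres
     are null. *)
  move=> i ij; have ip : (1 <= i.+1 <= p)%N by rewrite ltn_ord.
  have ne : i.+1 != j.
    by apply: contraNneq ij => E; apply/eqP/val_inj; rewrite /= -E.
  have fib x : unif R (X i.+1 @^-1` [set x]) = 0%E.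
    by apply: unif_fiber; [exact: cX|exact: X_inj].
  have mfib x : measurable (X i.+1 @^-1` [set x]).
    by rewrite -[X in measurable X]setTI; apply: (continuous_measurable_fun (@cX i.+1)) => //; exact: measurable_set1.
  have mpre : measurable (X i.+1 @^-1` ((ray (X j t) `&` B) `\` (ray (X j s) `&` B))).
    rewrite -[X in measurable X]setTI; apply: (continuous_measurable_fun (@cX i.+1)) => //.
    by apply: measurableD; exact: mray.
  apply/eqP; rewrite -measure_le0.
  apply: (@le_trans _ _ (unif R (X i.+1 @^-1` [set alpha i.+1] `|` X i.+1 @^-1` [set beta i.+1]))).
    apply: le_measure; [by rewrite inE|by rewrite inE; apply: measurableU; exact: mfib|].
    move=> th [[/= tht _] nths].
    have th1 : X j s < X i.+1 th.
      rewrite ltNge; apply/negP => les; apply: nths; split; first by rewrite /ray /= in_itv.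
      exact: (XB th ip).
    have th2 : X i.+1 th <= X j t by move: tht; rewrite /ray /= in_itv.
    have /andP[a1 b1] := X_band th ip; have /andP[as_ bs] := X_band s jp.
    have /andP[at_ bt] := X_band t jp; have /andP[jp1 jp2] := jp.
    case: (ltngtP i.+1 j) ne => // [lt|gt] _.
      right; apply/eqP; rewrite eq_le b1 /=.
      have := @band_sep R p a b alpha beta bands i.+1 j isT lt jp2.
      by move=> h; apply: le_trans h _; apply: le_trans as_ (ltW th1).
    left; apply/eqP; rewrite eq_le a1 andbT.
    have := @band_sep R p a b alpha beta bands j i.+1 jp1 gt (ltn_ord i).
    by move=> h; apply: le_trans th2 _; apply: le_trans bt h.
  apply: le_trans (measureU2 (unif R) (mfib _) (mfib _)) _.
  by rewrite [X in (X + _ <= _)%E]fib [X in (_ + X <= _)%E]fib adde0.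
rewrite prednK; last by case/andP: jp.
rewrite (_ : X j @^-1` _ = X j @^-1` [set` `]X j s, X j t]]).
  by rewrite unif_band // -EFinM; congr EFin; rewrite [LHS]mulrC invfM mulrA.
apply/seteqP; split=> th /=.
  move=> [[tht _] nths]; rewrite in_itv /=; apply/andP; split.
    rewrite ltNge; apply/negP => les; apply: nths; split; first by rewrite /ray /= in_itv.
    exact: (XB th jp).
  by move: tht; rewrite /ray /= in_itv.
rewrite in_itv /= => /andP[h1 h2]; split; first by split; [rewrite /ray /= in_itv|exact: (XB th jp)].
by move=> [+ _]; rewrite /ray /= in_itv /= leNgt h1.
Qed.

End EquilibriumCdf.

(** * Counting zeros *)

Section GapCount.
Variable R : realType.
Implicit Types (s t : seq R) (x : R).

Lemma path_lt_last s x : path <%R x s -> forall r, r \in x :: s -> x <= r <= last x s.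
Proof.
elim: s x => [|y s IH] x /=; first by move=> _ r; rewrite inE => /eqP ->; rewrite lexx.
move=> /andP[xy ys] r; rewrite inE => /orP[/eqP ->|rs].
  have /andP[_ yl] := IH y ys y (mem_head _ _).
  by rewrite lexx (le_trans (ltW xy)).
by have /andP[yr ->] := IH y ys r rs; rewrite (le_trans (ltW xy)).
Qed.

(** The gaps from x to the first element of [s], and from each element to the next, are disjoint and
    each contains an element of [t]. [C] is the condition on the left end of a gap. *)
Lemma gap_count (C : R -> Prop) s t x : path <%R x s -> C x ->
  (forall v, v \in s -> C v) ->
  (forall u v, C u -> v \in s -> u < v -> exists2 w, w \in t & u < w < v) ->
  (size s <= count (fun w => x < w < last x s)%R t)%N.
Proof.
elim: s x => [//|y s IH] x /= /andP[xy ys] Cx Cs gap.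
have [w wt /andP[xw wy]] := gap x y Cx (mem_head _ _) xy.
have IHy := IH y ys (Cs _ (mem_head _ _)) _ _.
have {}IHy : (size s <= count (fun w => y < w < last y s)%R t)%N.
  by apply: IHy => [v vs|u v Cu vs]; [apply: Cs|apply: gap Cu _]; rewrite inE vs orbT.
have /andP[_ yl] := path_lt_last ys (mem_head y s).
have c1 : (1 <= count (fun w => x < w < y)%R t)%N.
  by rewrite -has_count; apply/hasP; exists w; rewrite // xw.
apply: (@leq_trans (count (fun w => x < w < y)%R t + count (fun w => y < w < last y s)%R t)).
  by rewrite -add1n leq_add.
rewrite -count_predUI [X in (_ + X)%N](_ : _ = 0%N) ?addn0; last first.
  rewrite (eq_count (a2 := pred0)) ?count_pred0 // => z /=.
  by apply/negP => /andP[/andP[_ zy] /andP[yz _]]; have := lt_trans zy yz; rewrite ltxx.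
apply: sub_count => z /= /orP[/andP[xz zy]|/andP[yz zl]].
  by rewrite xz (lt_le_trans zy yl).
by rewrite zl (lt_trans xy yz).
Qed.

End GapCount.

Section Interlacing.
Variables (R : realType) (P Q : {poly R}).
Hypothesis W_gt0 : forall x, 0 < Q^`().[x] * P.[x] - Q.[x] * P^`().[x].
Implicit Types x u v : R.

Lemma ratio_mean_value (F G : {poly R}) u v : u < v ->
  (forall c, u <= c <= v -> G.[c] != 0) ->
  exists2 c, u <= c <= v & F.[v] / G.[v] - F.[u] / G.[u] =
    (F^`().[c] * G.[c] - F.[c] * G^`().[c]) / G.[c] ^+ 2 * (v - u).
Proof.
move=> uv G0.
have dr c : G.[c] != 0 -> is_derive c 1 (fun x => F.[x] / G.[x])
    ((F^`().[c] * G.[c] - F.[c] * G^`().[c]) / G.[c] ^+ 2).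
  move=> Gc; rewrite -[fun _ => _]/((horner F) * (fun x => (horner G x)^-1)).
  have dG : is_derive c 1 (fun x => (horner G x)^-1) (- G.[c] ^- 2 *: G^`().[c]).
    by apply: is_deriveV.
  apply: is_derive_eq.
  by rewrite /GRing.scale /=; field.
have [||c] := @MVT_segment _ (fun x => F.[x] / G.[x])
   (fun c => (F^`().[c] * G.[c] - F.[c] * G^`().[c]) / G.[c] ^+ 2) u v (ltW uv).
- by move=> c; rewrite in_itv /= => /andP[uc cv]; apply: dr; apply: G0; rewrite !ltW.
- apply: derivable_within_continuous => c; rewrite in_itv /= => /G0/dr.
  by case.
by rewrite in_itv /= => cI E; exists c.
Qed.

(** By [W_gt0] the derivative of P / Q is negative. Without a zero of Q in between, P / Q would
    decrease from a value <= 0 to the value 0. *)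
Lemma interlace_root u v : P.[u] * Q.[u] <= 0 -> Q.[u] != 0 -> P.[v] = 0 -> u < v ->
  exists2 w, root Q w & u < w < v.
Proof.
move=> PQu Qu Pv uv.
have [[w [wr wI]]|none] := pselect (exists w, root Q w /\ u < w < v); first by exists w.
have Qv : Q.[v] != 0.
  by apply/eqP => Qv; have := W_gt0 v; rewrite Pv Qv mulr0 mul0r subr0 ltxx.
have Q0 c : u <= c <= v -> Q.[c] != 0.
  rewrite !le_eqVlt => /andP[/orP[/eqP <- //|uc] /orP[/eqP -> //|cv]].
  by apply/negP => Qc; apply: none; exists c; rewrite uc.
have [c cI] := @ratio_mean_value P Q u v uv Q0.
rewrite Pv mul0r sub0r => E.
have : 0 <= - (P.[u] / Q.[u]).
  have Q2 : 0 < Q.[u] ^+ 2 by rewrite exprn_even_gt0.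
  rewrite oppr_ge0 (_ : _ / _ = P.[u] * Q.[u] / Q.[u] ^+ 2).
    by rewrite mulr_le0_ge0 // invr_ge0 ltW.
  by field.
rewrite E pmulr_lge0 ?subr_gt0 // pmulr_lge0 ?invr_gt0 ?exprn_even_gt0 ?Q0 //.
by have := W_gt0 c; lra.
Qed.

Lemma interlace_root_dual u v : 0 <= P.[u] * Q.[u] -> P.[u] != 0 -> Q.[v] = 0 -> u < v ->
  exists2 w, root P w & u < w < v.
Proof.
move=> PQu Pu Qv uv.
have [[w [wr wI]]|none] := pselect (exists w, root P w /\ u < w < v); first by exists w.
have Pv : P.[v] != 0.
  by apply/eqP => Pv; have := W_gt0 v; rewrite Pv Qv mulr0 mul0r subr0 ltxx.
have P0 c : u <= c <= v -> P.[c] != 0.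
  rewrite !le_eqVlt => /andP[/orP[/eqP <- //|uc] /orP[/eqP -> //|cv]].
  by apply/negP => Pc; apply: none; exists c; rewrite uc.
have [c cI] := @ratio_mean_value Q P u v uv P0.
rewrite Qv mul0r sub0r => E.
have : - (Q.[u] / P.[u]) <= 0.
  have P2 : 0 < P.[u] ^+ 2 by rewrite exprn_even_gt0.
  rewrite oppr_le0 (_ : _ / _ = P.[u] * Q.[u] / P.[u] ^+ 2).
    by rewrite mulr_ge0 // invr_ge0 ltW.
  by field.
rewrite E pmulr_lle0 ?subr_gt0 // pmulr_lle0 ?invr_gt0 ?exprn_even_gt0 ?P0 //.
by have := W_gt0 c; lra.
Qed.

Hypotheses (P_lead : 0 < lead_coef P) (Q_lead : 0 < lead_coef Q).

Lemma lead_gt0_large (F : {poly R}) x : 0 < lead_coef F -> exists2 y, x < y & 0 < F.[y].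
Proof.
move=> lF; have [z zP] := poly_pinfty_gt_lc lF.
exists (Num.max z (x + 1)); first by rewrite lt_max ltrDl ltr01 orbT.
by apply: lt_le_trans lF _; apply: zP; rewrite le_max lexx.
Qed.

(** The same argument with v far to the right, where P / Q is positive because both leading
    coefficients are. *)
Lemma interlace_top u : P.[u] * Q.[u] <= 0 -> Q.[u] != 0 ->
  (forall w, root P w -> w <= u) -> exists2 w, root Q w & u < w.
Proof.
move=> PQu Qu Ptop.
have [[w [wr wI]]|none] := pselect (exists w, root Q w /\ u < w); first by exists w.
have [y0 uy0 Py0] := lead_gt0_large u P_lead.
have pos (F : {poly R}) y z : u <= y -> y < z -> (forall w, root F w -> w < y \/ z < w) ->
    0 < F.[z] -> 0 < F.[y].
  move=> uy yz Fno Fz; rewrite ltNge; apply/negP => Fy.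
  have [Fy0|Fy0] := eqVneq F.[y] 0.
    by have [] := Fno y ltac:(by rewrite rootE Fy0); rewrite ?ltxx // ltNge ltW.
  have Fyz : F.[y] * F.[z] < 0 by rewrite pmulr_llt0 // lt_neqAle Fy0.
  have [w] := poly_ivtoo (ltW yz) Fyz; rewrite in_itv /= => /andP[yw wz] /Fno.
  by case=> h; [have := lt_trans yw h|have := lt_trans wz h]; rewrite ltxx.
have Qgt w : u <= w -> 0 < Q.[w].
  move=> uw; have [z wz Qz] := lead_gt0_large w Q_lead.
  apply: (pos Q w z uw wz) => // r rQ; left; rewrite ltNge; apply/negP => wr.
  have := le_trans uw wr; rewrite le_eqVlt => /orP[/eqP ur|ur]; last by apply: none; exists r.
  by move: Qu; rewrite ur -rootE rQ.
have [c cI] := @ratio_mean_value P Q u y0 uy0 (fun c cI => negbT (gt_eqF (Qgt c (proj1 (andP cI))))).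
move=> E.
have Pu : P.[u] <= 0 by move: PQu; rewrite pmulr_lle0 // Qgt.
have q1 := Qgt u (lexx _); have q2 := Qgt y0 (ltW uy0); have q3 := Qgt c (proj1 (andP cI)).
have l : 0 < P.[y0] / Q.[y0] - P.[u] / Q.[u].
  rewrite subr_gt0; apply: (@le_lt_trans _ _ 0); last by rewrite divr_gt0.
  by rewrite mulr_le0_ge0 // invr_ge0 ltW.
move: l; rewrite E pmulr_lgt0 ?subr_gt0 // pmulr_lgt0 ?invr_gt0 ?exprn_gt0 //.
by have := W_gt0 c; lra.
Qed.

Let P0 : P != 0. Proof. by rewrite -lead_coef_eq0 gt_eqF. Qed.
Let Q0 : Q != 0. Proof. by rewrite -lead_coef_eq0 gt_eqF. Qed.

Definition roots_above (F : {poly R}) x : nat := count (fun r => x < r) (rootsR F).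

Lemma mem_rootsR (F : {poly R}) x : F != 0 -> (x \in rootsR F) = root F x.
Proof. by move=> F0; have := roots_on_rootsR F0 x; rewrite in_itv /=. Qed.

Let above_path (F : {poly R}) x : path <%R x [seq r <- rootsR F | x < r].
Proof.
rewrite path_min_sorted; last by apply/allP => r; rewrite mem_filter => /andP[].
by apply: sorted_filter; [exact: lt_trans|exact: sorted_roots].
Qed.

(** A zero of P at x counts as a sign change and a zero of Q does not, because roots are counted
    strictly above x. By interlacing the number grows by 0 or 1, and the sign of P Q at x decides
    which. *)
Lemma roots_above_step x : roots_above Q x =
  (roots_above P x + ((P.[x] * Q.[x] <= 0)%R && (Q.[x] != 0)%R))%N.
Proof.
have coprimePQ z : P.[z] = 0 -> Q.[z] != 0.
  by move=> Pz; apply/eqP => Qz; have := W_gt0 z; rewrite Pz Qz mulr0 mul0r subr0 ltxx.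
have lower z : P.[z] * Q.[z] <= 0 -> Q.[z] != 0 -> (roots_above P z < roots_above Q z)%N.
  move=> PQz Qz; rewrite /roots_above -size_filter.
  set s := [seq r <- rootsR P | z < r].
  have sP v : v \in s -> root P v by rewrite mem_filter mem_rootsR // => /andP[].
  pose C u := P.[u] * Q.[u] <= 0 /\ Q.[u] != 0.
  have Cs v : v \in s -> C v.
    by move=> /sP /rootP Pv; split; [rewrite Pv mul0r|exact: coprimePQ].
  have g := @gap_count R C s (rootsR Q) z (above_path P z) (conj PQz Qz) Cs.
  have Cl : C (last z s).
    by case: (s) Cs => [|r s'] Cs' /=; [|apply: Cs'; exact: mem_last].
  have /andP[_ zl] := path_lt_last (above_path P z) (mem_head z _).
  have [w wr lw] : exists2 w, root Q w & last z s < w.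
    apply: interlace_top; [by case: Cl|by case: Cl|].
    move=> r rP; have [zr|rz] := ltP z r; last exact: le_trans rz zl.
    have rs : r \in z :: s by rewrite inE mem_filter zr mem_rootsR // rP orbT.
    by have /andP[] := path_lt_last (above_path P z) rs.
  have c1 : (1 <= count (fun w => last z s < w)%R (rootsR Q))%N.
    by rewrite -has_count; apply/hasP; exists w; rewrite ?mem_rootsR.
  apply: (@leq_trans (count (fun w => z < w < last z s)%R (rootsR Q) +
      count (fun w => last z s < w)%R (rootsR Q))).
    rewrite -addn1 leq_add // g // => u v [c2 c3] vs uv.
    have [w' w'r w'I] := interlace_root c2 c3 (rootP (sP _ vs)) uv.
    by exists w'; rewrite ?mem_rootsR.
  rewrite -count_predUI [X in (_ + X)%N](_ : _ = 0%N) ?addn0; last first.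
    rewrite (eq_count (a2 := pred0)) ?count_pred0 // => y /=.
    by apply/negP => /andP[/andP[_ yl] ly]; have := lt_trans yl ly; rewrite ltxx.
  apply: sub_count => y /= /orP[/andP[]//|ly]; exact: le_lt_trans zl ly.
have upper z : 0 <= P.[z] * Q.[z] -> P.[z] != 0 -> (roots_above Q z <= roots_above P z)%N.
  move=> PQz Pz; rewrite /roots_above -size_filter.
  set s := [seq r <- rootsR Q | z < r].
  have sQ v : v \in s -> root Q v by rewrite mem_filter mem_rootsR // => /andP[].
  pose C u := 0 <= P.[u] * Q.[u] /\ P.[u] != 0.
  have Cs v : v \in s -> C v.
    move=> /sQ /rootP Qv; split; first by rewrite Qv mulr0.
    by apply/eqP => /coprimePQ; rewrite Qv eqxx.
  have g := @gap_count R C s (rootsR P) z (above_path Q z) (conj PQz Pz) Cs.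
  apply: leq_trans (g _) _.
    move=> u v [c2 c3] vs uv.
    have [w' w'r w'I] := interlace_root_dual c2 c3 (rootP (sQ _ vs)) uv.
    by exists w'; rewrite ?mem_rootsR.
  by apply: sub_count => y /= /andP[].
have first_root (F : {poly R}) : F != 0 -> (0 < roots_above F x)%N ->
    exists z, [/\ F.[z] = 0, x < z & roots_above F x = (roots_above F z).+1].
  move=> F0; rewrite /roots_above -!size_filter; set s := [seq r <- rootsR F | x < r] => s0.
  case E: s s0 => [//|z s'] _; exists z.
  have zs : z \in s by rewrite E mem_head.
  move: (zs); rewrite mem_filter mem_rootsR // => /andP[xz /rootP Fz]; split=> //.
  rewrite -size_filter /=; congr (_.+1).
  have -> : [seq r <- rootsR F | z < r] = [seq r <- s | z < r].
    rewrite -filter_predI; apply: eq_filter => r /=.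
    by case: ltP => //= zr; rewrite (lt_trans xz zr).
  rewrite E /= ltxx; have := above_path F x; rewrite -/s E /= => /andP[_ zs'].
  by move: zs'; rewrite path_sortedE; [move=> /andP[/all_filterP -> _]|exact: lt_trans].
have mono (F : {poly R}) y z : y <= z -> (roots_above F z <= roots_above F y)%N.
  by move=> yz; apply: sub_count => r /= zr; exact: le_lt_trans yz zr.
(* Without a sign condition at x itself, the comparison starts at the first root above x, where the
   condition holds. *)
have le1 : (roots_above P x <= roots_above Q x)%N.
  have [->//|] := posnP (roots_above P x).
  move=> /(first_root _ P0)[z [Pz xz ->]].
  by apply: leq_trans (lower z _ (coprimePQ _ Pz)) (mono _ _ _ (ltW xz)); rewrite Pz mul0r.
have le2 : (roots_above Q x <= (roots_above P x).+1)%N.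
  have [->//|] := posnP (roots_above Q x).
  move=> /(first_root _ Q0)[z [Qz xz ->]]; rewrite ltnS.
  apply: leq_trans (upper z _ _) (mono _ _ _ (ltW xz)); first by rewrite Qz mulr0.
  by apply/eqP => /coprimePQ; rewrite Qz eqxx.
have [/andP[PQ Qx]|] := boolP ((P.[x] * Q.[x] <= 0) && (Q.[x] != 0)).
  by apply/eqP; rewrite eqn_leq addn1 le2 lower.
rewrite negb_and negbK -ltNge => h; apply/eqP; rewrite addn0 eqn_leq le1 andbT.
case/orP: h => [PQ|/eqP Qx].
  apply: upper; first exact: ltW.
  by apply: contraTneq PQ => ->; rewrite mul0r ltxx.
apply: upper; first by rewrite Qx mulr0.
by apply/eqP => /coprimePQ; rewrite Qx eqxx.
Qed.

End Interlacing.

Lemma eventually_below (k : nat) (E : nat -> nat -> Prop) :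
  (forall r, (r < k)%N -> exists M, forall m, (M <= m)%N -> E r m) ->
  exists M, forall r m, (r < k)%N -> (M <= m)%N -> E r m.
Proof.
elim: k => [|k IH] h; first by exists 0%N.
have [|M MP] := IH; first by move=> r rk; apply: h; exact: ltnW.
have [M' MP'] := h k (ltnSn k).
exists (maxn M M') => r m; rewrite ltnS leq_eqVlt geq_max => /orP[/eqP ->|rk] /andP[m1 m2].
  exact: MP'.
exact: MP.
Qed.

Lemma linear_growth_le (p N c k l : nat) (f g : nat -> nat) :
  (forall n, (N <= n)%N -> f (n + p)%N = (f n + k)%N) ->
  (forall n, (N <= n)%N -> g (n + p)%N = (g n + l)%N) ->
  (forall m, (f (N + m * p) <= g (N + m * p) + c)%N) -> (k <= l)%N.
Proof.
move=> fp gp fg.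
have fm m : f (N + m * p)%N = (f N + m * k)%N.
  elim: m => [|m IH]; first by rewrite !mul0n !addn0.
  by rewrite mulSn addnCA addnC fp ?leq_addr // IH mulSn addnCA addnC.
have gm m : g (N + m * p)%N = (g N + m * l)%N.
  elim: m => [|m IH]; first by rewrite !mul0n !addn0.
  by rewrite mulSn addnCA addnC gp ?leq_addr // IH mulSn addnCA addnC.
rewrite leqNgt; apply/negP => lk.
by have := fg (g N + c).+1; rewrite fm gm; nia.
Qed.

(** * Growth of the zero counts over one period *)

Section ZeroCounts.
Variables (R : realType) (p : nat) (a b alpha beta : nat -> R).
Hypothesis p_gt0 : (1 <= p)%N.
Hypothesis jac : periodic_jacobi p a b.
Let D := discriminant p a b.
Let P n := opoly a b n.
Implicit Types (x th : R) (n m r j : nat).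

Let a_gt0 n : (1 <= n)%N -> 0 < a n.
Proof. by case: jac => h _ _ _; apply: h. Qed.

(** The characteristic equation z^2 - 2 tau z + 1 = 0 has the double root tau, so solutions of the
    period recursion are tau^m times an affine function of m. *)
Lemma opoly_edge r m x tau : tau ^+ 2 = 1 -> D.[x] = 2 * tau ->
  tau ^+ m * (P (r + m * p)).[x] = (P r).[x] + m%:R * (tau * (P (r + p)).[x] - (P r).[x]).
Proof.
move=> tau2 Dx.
suff [] : tau ^+ m * (P (r + m * p)).[x] = (P r).[x] + m%:R * (tau * (P (r + p)).[x] - (P r).[x]) /\
   tau ^+ m.+1 * (P (r + m.+1 * p)).[x] = (P r).[x] + m.+1%:R * (tau * (P (r + p)).[x] - (P r).[x]).
  by [].
elim: m => [|m [IH1 IH2]].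
  by rewrite mul0n mul1n addn0 expr0 expr1; split; ring.
split=> //.
have -> : (r + m.+2 * p = r + m * p + p + p)%N by rewrite !mulSn; lia.
rewrite /P (opoly_period2 p_gt0 jac) hornerD hornerN hornerM -/D Dx.
have -> : (r + m * p + p = r + m.+1 * p)%N by rewrite mulSn; lia.
rewrite mulrBr.
have -> : tau ^+ m.+2 * (2 * tau * (opoly a b (r + m.+1 * p)).[x]) =
    2 * tau ^+ 2 * (tau ^+ m.+1 * (opoly a b (r + m.+1 * p)).[x]).
  by rewrite [tau ^+ m.+2]exprS; ring.
have -> : tau ^+ m.+2 * (opoly a b (r + m * p)).[x] =
    tau ^+ 2 * (tau ^+ m * (opoly a b (r + m * p)).[x]).
  by rewrite [tau ^+ m.+2]exprSr [tau ^+ m.+1]exprSr; ring.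
by rewrite tau2 IH1 IH2 -!natr1; ring.
Qed.

Lemma linear_sign (c d : R) : exists M s, forall m, (M <= m)%N -> Num.sg (c + m%:R * d) = s.
Proof.
have [->|d0] := eqVneq d 0.
  by exists 0%N, (Num.sg c) => m _; rewrite mulr0 addr0.
exists (Num.truncn (`|c| / `|d|)).+1, (Num.sg d) => m Mm.
have d1 : 0 < `|d| by rewrite normr_gt0.
have cm : `|c| < m%:R * `|d|.
  rewrite -ltr_pdivrMr //; apply: lt_le_trans (truncnS_gt _) _.
  by rewrite ler_nat.
have := ler_norm c; have := ler_norm (- c); rewrite normrN => c1 c2.
case: (ltgtP d 0) d0 => // dd _.
  by rewrite (ltr0_sg dd) ltr0_sg //; rewrite (ltr0_norm dd) mulrN in cm; lra.
by rewrite (gtr0_sg dd) gtr0_sg //; rewrite (gtr0_norm dd) in cm; lra.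
Qed.

Lemma edge_sign_period x : D.[x] ^+ 2 = 4 -> exists tau N, tau ^+ 2 = 1 /\
  forall n, (N <= n)%N -> Num.sg (P (n + p)).[x] = tau * Num.sg (P n).[x].
Proof.
move=> Dx; pose tau := D.[x] / 2.
have tau2 : tau ^+ 2 = 1 by rewrite /tau expr_div_n Dx; field.
have DE : D.[x] = 2 * tau by rewrite /tau mulrC divfK.
have tau_sg : Num.sg tau = tau.
  have : (tau - 1) * (tau + 1) = 0 by rewrite -(subrr (tau ^+ 2)) [X in _ = _ - X]tau2; ring.
  move=> /eqP; rewrite mulf_eq0 subr_eq0 addr_eq0 => /orP[/eqP ->|/eqP ->].
    by rewrite sgr1.
  by rewrite sgrN sgr1.
have [M MP] : exists M, forall r m, (r < p)%N -> (M <= m)%N ->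
    Num.sg (P (r + m.+1 * p)).[x] = tau * Num.sg (P (r + m * p)).[x].
  apply: eventually_below => r rp.
  have [M [s Ms]] := linear_sign (P r).[x] (tau * (P (r + p)).[x] - (P r).[x]).
  exists M => m Mm.
  have key k : (M <= k)%N -> Num.sg (P (r + k * p)).[x] = tau ^+ k * s.
    move=> /Ms <-; rewrite -(opoly_edge r k tau2 DE) sgrM sgrX tau_sg mulrA -exprMn -expr2 tau2.
    by rewrite expr1n mul1r.
  by rewrite !key ?(leqW Mm) // exprS mulrA.
exists tau, (M * p)%N; split=> // n Mn.
have -> : (n + p = n %% p + (n %/ p).+1 * p)%N by rewrite {1}(divn_eq n p) mulSn; lia.
rewrite MP ?ltn_mod // ?leq_divRL //.
by rewrite [(_ %% _ + _)%N]addnC -divn_eq.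
Qed.

Lemma roots_above_period x : D.[x] ^+ 2 = 4 -> exists k N, forall n, (N <= n)%N ->
  roots_above (P (n + p)) x = (roots_above (P n) x + k)%N /\
  root (P (n + p)) x = root (P n) x.
Proof.
move=> /edge_sign_period[tau [N [tau2 sgP]]].
have tau0 : tau != 0.
  by apply/eqP => t0; move: tau2 => /eqP; rewrite t0 expr0n eq_sym oner_eq0.
pose d n := ((P n).[x] * (P n.+1).[x] <= 0) && ((P n.+1).[x] != 0).
have step n : roots_above (P n.+1) x = (roots_above (P n) x + d n)%N.
  apply: roots_above_step; last 2 first.
  - exact: lead_opoly_gt0.
  - exact: lead_opoly_gt0.
  by move=> z; have := wronskian_gt0 b a_gt0 n z; rewrite wronskianE.
have rootE n : (N <= n)%N -> ((P (n + p)).[x] == 0) = ((P n).[x] == 0).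
  by move=> Nn; rewrite -sgr_eq0 sgP // mulf_eq0 (negbTE tau0) /= sgr_eq0.
have dp n : (N <= n)%N -> d (n + p)%N = d n.
  move=> Nn; have Nn1 : (N <= n.+1)%N by exact: leqW.
  rewrite /d -addSn (rootE _ Nn1); congr (_ && _).
  rewrite -sgr_le0 -[RHS]sgr_le0 !sgrM (sgP _ Nn1) (sgP _ Nn).
  by rewrite mulrACA -expr2 tau2 mul1r.
have nd k l : (k <= l)%N -> (roots_above (P k) x <= roots_above (P l) x)%N.
  move=> /subnK <-; elim: (l - k)%N => [|i IH]; first by rewrite add0n.
  by apply: leq_trans IH _; rewrite addSn step leq_addr.
exists (roots_above (P (N + p)%N) x - roots_above (P N) x)%N; exists N => n Nn.
split; last exact: rootE.
elim: n Nn => [|n IH].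
  by rewrite leqn0 => /eqP ->; rewrite subnKC // nd // leq_addr.
rewrite leq_eqVlt => /orP[/eqP <-|]; first by rewrite subnKC // nd // leq_addr.
rewrite ltnS => Nn; rewrite addSn !step dp // IH //; lia.
Qed.

(** The band is closed, so a zero at its left end is counted apart; the sum form avoids truncated
    subtraction. *)
Lemma num_zerosE n j : alpha j < beta j ->
  (num_zeros a b alpha beta n j + roots_above (P n) (beta j) =
   roots_above (P n) (alpha j) + root (P n) (alpha j))%N.
Proof.
move=> ab; rewrite /num_zeros /band_zeros -/(P n) size_filter /roots_above.
have P0 : P n != 0 by exact: opoly_neq0.
have -> : (root (P n) (alpha j) : nat) = count_mem (alpha j) (rootsR (P n)).
  by rewrite count_uniq_mem ?mem_rootsR //; exact: uniq_roots.
have disj (A B : pred R) s : (forall x, A x -> B x -> False) ->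
    (count A s + count B s = count (predU A B) s)%N.
  move=> AB; rewrite -count_predUI [X in (_ + X)%N](_ : _ = 0%N) ?addn0 //.
  rewrite (eq_count (a2 := pred0)) ?count_pred0 // => z /=.
  by apply/negP => /andP[/AB h /h].
rewrite !disj.
- apply: eq_count => r /=; rewrite in_itv /= eq_sym.
  by case: (ltgtP (alpha j) r) => ar; case: (ltgtP (beta j) r) => br //=; lra.
- by move=> r /= ar /eqP ra; move: ar; rewrite ra ltxx.
- by move=> r; rewrite in_itv /= => /andP[_ rb] br; have := lt_le_trans br rb; rewrite ltxx.
Qed.

Lemma opoly_sin r m x th : D.[x] = 2 * cos th ->
  sin th * (P (r + m * p)).[x] =
  sin (m%:R * th) * ((P (r + p)).[x] - cos th * (P r).[x]) +
  cos (m%:R * th) * (sin th * (P r).[x]).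
Proof.
move=> Dx; set v := (P r).[x]; set w := _ - _.
suff [] : sin th * (P (r + m * p)).[x] = sin (m%:R * th) * w + cos (m%:R * th) * (sin th * v) /\
   sin th * (P (r + m.+1 * p)).[x] = sin (m.+1%:R * th) * w + cos (m.+1%:R * th) * (sin th * v).
  by [].
elim: m => [|m [IH1 IH2]].
  rewrite mul0n mul1n addn0 mul0r mul1r sin0 cos0 /w -/v; split; ring.
split=> //.
have -> : (r + m.+2 * p = r + m * p + p + p)%N by rewrite !mulSn; lia.
rewrite /P (opoly_period2 p_gt0 jac) hornerD hornerN hornerM -/D Dx -/P.
have -> : (r + m * p + p = r + m.+1 * p)%N by rewrite mulSn; lia.
rewrite mulrBr IH1 mulrCA IH2.
have -> : m.+2%:R * th = m.+1%:R * th + th by rewrite -natr1; ring.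
have -> : m%:R * th = m.+1%:R * th - th by rewrite -natr1; ring.
rewrite sinB cosB sinD cosD; ring.
Qed.

Hypothesis bands : are_bands p a b alpha beta.

Lemma opoly_period_ends j : (1 <= j <= p)%N -> exists k l N, forall n, (N <= n)%N ->
  (roots_above (P (n + p)) (alpha j) = roots_above (P n) (alpha j) + k)%N /\
  (roots_above (P (n + p)) (beta j) = roots_above (P n) (beta j) + l)%N /\
  (num_zeros a b alpha beta (n + p) j + l = num_zeros a b alpha beta n j + k)%N.
Proof.
move=> jp; have ab := band_lt bands jp.
have [k [N1 h1]] := roots_above_period (band_end bands jp (or_introl (erefl (alpha j)))).
have [l [N2 h2]] := roots_above_period (band_end bands jp (or_intror (erefl (beta j)))).
exists k, l, (maxn N1 N2) => n; rewrite geq_max => /andP[/h1[e1 r1] /h2[e2 _]].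
split=> //; split=> //.
have := num_zerosE (n + p) ab; have := num_zerosE n ab.
by rewrite e1 e2 r1; lia.
Qed.

(** Among the angles k pi / m, those with 0 < k < m have sin th non-zero, so that [opoly_sin] can be
    divided by it. They give m - 2 intervals with a sign change. *)
Lemma num_zeros_mulp m j : (1 <= j <= p)%N -> (m <= (num_zeros a b alpha beta (m * p) j).+2)%N.
Proof.
move=> jp; set M := m.
have [X [cX Xb Xc Xs]] := band_param_ex p_gt0 jac bands jp.
pose t k : R := k%:R * pi / M%:R.
have tI k : (0 < k < M)%N -> 0 < t k < pi.
  move=> /andP[k0 kM]; have M0 : (0 : R) < M%:R by rewrite ltr0n (leq_ltn_trans _ kM).
  have k0' : (0 : R) < k%:R by rewrite ltr0n.
  have kM' : (k%:R : R) < M%:R by rewrite ltr_nat.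
  have p0 := pi_gt0 R; rewrite /t; apply/andP; split; first by rewrite divr_gt0 // mulr_gt0.
  by rewrite ltr_pdivrMr // mulrC ltr_pM2l.
have inj : {in `[0%R, pi] &, injective X}.
  move=> u v uI vI E; apply: cos_inj => //.
  by have := Xc u; rewrite E Xc => /(mulfI _); rewrite pnatr_eq0 => /(_ isT).
pose F u := (P (M * p)).[X u].
have cF : continuous F.
  by move=> u; apply: continuous_comp; [exact: cX|exact: continuous_horner].
have Ft k : (0 < k < M)%N -> F (t k) = (-1) ^+ k.
  move=> kM; have := opoly_sin 0 M (Xc (t k)).
  have -> : M%:R * t k = k%:R * pi.
    by rewrite /t mulrC divfK // pnatr_eq0 -lt0n; case/andP: kM => _; apply: leq_ltn_trans.
  have s0 : sin (t k) != 0 by rewrite gt_eqF // sin_gt0_pi // tI.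
  have [sk ck] : sin (k%:R * pi : R) = 0 /\ cos (k%:R * pi : R) = (-1) ^+ k.
    elim: k {kM s0} => [|k [IH1 IH2]]; first by rewrite mul0r sin0 cos0 expr0.
    by rewrite -natr1 mulrDl mul1r sinDpi cosDpi IH1 IH2 oppr0 exprS mulN1r.
  rewrite sk ck mul0r add0r add0n /P opoly0 hornerC mulr1 mulrC.
  by move=> /(mulIf s0).
have /choice[c cP] : forall k, exists u, (0 < k < M.-1)%N -> t k < u < t k.+1 /\ F u = 0.
  move=> k; have [kM|nk] := boolP (0 < k < M.-1)%N; last by exists 0.
  have kM1 : (0 < k < M)%N by lia.
  have kM2 : (0 < k.+1 < M)%N by lia.
  have tt : t k < t k.+1.
    have M0 : (0 : R) < M%:R by rewrite ltr0n; lia.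
    by rewrite /t ltr_pM2r ?invr_gt0 // ltr_pM2r ?pi_gt0 // ltr_nat.
  have FF : F (t k) * F (t k.+1) = -1.
    by rewrite !Ft // -exprD addnS exprS addnn -mul2n exprM sqrrN !expr1n mulr1.
  have [||u uI Fu] := @IVT R F (t k) (t k.+1) 0 (ltW tt).
  - by apply: continuous_subspaceT.
  - rewrite !Ft // exprS mulN1r; case: (odd k) (signr_odd R k) => <-;
    rewrite ?expr1 ?expr0; rewrite ge_min le_max; lra.
  exists u => _; split=> //; move: uI; rewrite in_itv /= !le_eqVlt.
  move=> /andP[/orP[/eqP E|->] /orP[/eqP E'|->]] //; exfalso; move: FF.
  - by rewrite E Fu => /eqP; rewrite mul0r eq_sym oppr_eq0 oner_eq0.
  - by rewrite E Fu => /eqP; rewrite mul0r eq_sym oppr_eq0 oner_eq0.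
  - by rewrite -E' Fu => /eqP; rewrite mulr0 eq_sym oppr_eq0 oner_eq0.
have tmono k l : (k <= l)%N -> t k <= t l.
  move=> kl; rewrite /t ler_wpM2r ?invr_ge0 ?ler0n // ler_wpM2r ?ler_nat //.
  exact/ltW/pi_gt0.
pose s := [seq X (c k) | k <- iota 1 M.-2].
have mem_s k : k \in iota 1 M.-2 -> (0 < k < M.-1)%N by rewrite mem_iota; lia.
have cI k : (0 < k < M.-1)%N -> c k \in `[0%R, pi].
  move=> kM; have [/andP[c1 c2] _] := cP k kM.
  have /andP[t1 _] := tI k ltac:(lia); have /andP[_ t2] := tI k.+1 ltac:(lia).
  by rewrite in_itv /= !ltW // ?(lt_trans c2) // (lt_trans t1).
have us : uniq s.
  rewrite map_inj_in_uniq ?iota_uniq // => k l /mem_s kM /mem_s lM /inj E.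
  have {}E := E (cI _ kM) (cI _ lM).
  have [/andP[k1 k2] _] := cP k kM; have [/andP[l1 l2] _] := cP l lM.
  have [kl|lk|//] := ltngtP k l.
    by have := lt_trans (lt_le_trans k2 (tmono _ _ kl)) l1; rewrite E ltxx.
  by have := lt_trans (lt_le_trans l2 (tmono _ _ lk)) k1; rewrite E ltxx.
have : (size s <= num_zeros a b alpha beta (M * p) j)%N.
  apply: uniq_leq_size us _ => x /mapP[k /mem_s kM ->].
  rewrite mem_filter mem_rootsR; last exact: opoly_neq0.
  by rewrite in_itv /= Xb rootE; apply/eqP; case: (cP k kM).
by rewrite size_map size_iota; lia.
Qed.

Lemma size_rootsR_le n : (size (rootsR (P n)) <= n)%N.
Proof.
have P0 : P n != 0 by exact: opoly_neq0.
have := @max_poly_roots _ (P n) (rootsR (P n)) P0 _ (uniq_roots _ _ _).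
rewrite size_opoly // ltnS; apply.
by apply/allP => r; rewrite mem_rootsR.
Qed.

Lemma num_zeros_le n j : (num_zeros a b alpha beta n j <= n)%N.
Proof. by apply: leq_trans (size_rootsR_le n); rewrite /num_zeros size_filter count_size. Qed.

Lemma num_zeros_period : exists N, forall j n, (1 <= j <= p)%N -> (N <= n)%N ->
  num_zeros a b alpha beta (n + p) j = (num_zeros a b alpha beta n j).+1.
Proof.
pose za n j := roots_above (P n) (alpha j); pose zb n j := roots_above (P n) (beta j).
have /choice[T TP] : forall j, exists T : nat * nat * nat, (1 <= j <= p)%N ->
    forall n, (T.2 <= n)%N -> za (n + p)%N j = (za n j + T.1.1)%N /\
      zb (n + p)%N j = (zb n j + T.1.2)%N /\
      (num_zeros a b alpha beta (n + p) j + T.1.2 = num_zeros a b alpha beta n j + T.1.1)%N.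
  move=> j; have [jp|nj] := boolP (1 <= j <= p)%N; last by exists (0%N, 0%N, 0%N).
  by have [k [l [N NP]]] := opoly_period_ends jp; exists (k, l, N).
pose ka j := (T j).1.1; pose kb j := (T j).1.2.
(* [ka (j + 1) <= kb j < ka j] and [ka 1 <= p] leave no choice but [ka j = kb j + 1]. *)
have kba j : (1 <= j <= p)%N -> (kb j < ka j)%N.
  (* Otherwise the count would stop increasing along the multiples of p, against
     [num_zeros_mulp]. *)
  move=> jp; rewrite ltnNge; apply/negP => kab; pose N := (T j).2.
  have le m : (num_zeros a b alpha beta ((N + m) * p) j <= num_zeros a b alpha beta (N * p) j)%N.
    elim: m => [|m IH]; first by rewrite addn0.
    apply: leq_trans IH; rewrite addnS mulSn addnC.
    have NN : (N <= (N + m) * p)%N by nia.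
    by have [_ [_]] := TP j jp _ NN; rewrite -/(ka j) -/(kb j); lia.
  have := le (num_zeros a b alpha beta (N * p) j).+3.
  by have := num_zeros_mulp (N + (num_zeros a b alpha beta (N * p) j).+3) jp; lia.
have kab j : (1 <= j < p)%N -> (ka j.+1 <= kb j)%N.
  move=> jp; have jp1 : (1 <= j <= p)%N by lia.
  have jp2 : (1 <= j.+1 <= p)%N by lia.
  apply: (@linear_growth_le p (maxn (T j).2 (T j.+1).2) 0 _ _ (za^~ j.+1) (zb^~ j)) => /=.
  - by move=> n; rewrite geq_max => /andP[_ /(TP _ jp2)[]].
  - by move=> n; rewrite geq_max => /andP[/(TP _ jp1)[_ []]].
  - move=> m; rewrite addn0; apply: sub_count => r /= ar; apply: le_lt_trans ar.
    by apply: (band_sep bands); lia.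
have ka1 : (ka 1 <= p)%N.
  have p1 : (1 <= 1 <= p)%N by rewrite p_gt0.
  apply: (@linear_growth_le p (T 1).2 0 _ _ (za^~ 1%N) id) => //=.
  - by move=> n /(TP _ p1)[].
  - by move=> m; rewrite addn0; exact: leq_trans (count_size _ _) (size_rootsR_le _).
(* [up] and [down] together give ka j = p + 1 - j. *)
have up j : (1 <= j <= p)%N -> (ka j + j <= p.+1)%N.
  elim: j => [//|[|j] IH] jp; first by rewrite addn1.
  have j1 : (1 <= j.+1 <= p)%N by lia.
  by have := IH j1; have := kba _ j1; have := kab j.+1 jp; lia.
have down i : (i < p)%N -> (i < ka (p - i))%N.
  elim: i => [|i IH] ip; first by rewrite (leq_ltn_trans _ (kba _ _)) //; lia.
  have := IH (ltnW ip); have := kba (p - i.+1)%N ltac:(lia); have := kab (p - i.+1)%N ltac:(lia).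
  by rewrite (_ : (p - i.+1).+1 = p - i)%N; lia.
have kE j : (1 <= j <= p)%N -> ka j = (kb j).+1.
  move=> jp; have := up j jp; have := kba j jp.
  have [jlt|jge] := ltnP j p.
    have := kab j ltac:(lia); have := down (p - j.+1)%N ltac:(lia).
    by rewrite (_ : p - (p - j.+1) = j.+1)%N; lia.
  by lia.
have [N NP] : exists N, forall j n, (j < p.+1)%N -> (N <= n)%N -> (1 <= j)%N ->
    num_zeros a b alpha beta (n + p) j = (num_zeros a b alpha beta n j).+1.
  apply: eventually_below => j; rewrite ltnS => jp; exists (T j).2 => n Nn j1.
  have jI : (1 <= j <= p)%N by rewrite j1.
  by have [_ [_]] := TP j jI n Nn; rewrite -/(ka j) -/(kb j) kE //; lia.
by exists N => j n /andP[j1 jp] Nn; apply: NP.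
Qed.

Lemma num_zeros_affine : exists N, forall j n m, (1 <= j <= p)%N -> (N <= n)%N ->
  num_zeros a b alpha beta (n + m * p) j = (num_zeros a b alpha beta n j + m)%N.
Proof.
have [N NP] := num_zeros_period; exists N => j n m jp Nn.
elim: m => [|m IH]; first by rewrite mul0n !addn0.
rewrite mulSn addnCA addnC NP // ?IH ?addnS //.
exact: leq_trans (leq_addr _ _).
Qed.

End ZeroCounts.

(** * Phase and spacing of the zeros *)

Section Phase.
Variables (R : realType) (E1 E2 : R -> R).
Hypothesis E_unit : forall th, 0 <= th <= pi -> E1 th ^+ 2 + E2 th ^+ 2 = 1.
Hypothesis E_unif : forall e, 0 < e -> exists2 d, 0 < d & forall s t,
  0 <= s <= pi -> 0 <= t <= pi -> `|s - t| < d ->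
  `|E1 s - E1 t| < e /\ `|E2 s - E2 t| < e.

Let inner s t := E1 s * E1 t + E2 s * E2 t.

(** For unit vectors the inner product is 1 minus half the squared distance. *)
Lemma inner_close e s t : 0 <= s <= pi -> 0 <= t <= pi ->
  `|E1 s - E1 t| < e -> `|E2 s - E2 t| < e -> 1 - e ^+ 2 < inner s t.
Proof.
move=> /E_unit Es /E_unit Et d1 d2; rewrite /inner.
have h1 : (E1 s - E1 t) ^+ 2 < e ^+ 2.
  by rewrite -real_normK ?num_real // ltr_pXn2r ?nnegrE // ltW // (le_lt_trans _ d1).
have h2 : (E2 s - E2 t) ^+ 2 < e ^+ 2.
  by rewrite -real_normK ?num_real // ltr_pXn2r ?nnegrE // ltW // (le_lt_trans _ d1).
lra.
Qed.

(* The hypotheses on [sigma] place the unit vector [(sin, cos) (m th)] at [s] and [t] on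
   opposite normals to [(E1, E2)], which itself moves little from [s] to [t]. *)
Lemma phase_spacing eta : 0 < eta -> exists M : nat, forall (m : nat) sigma s t, (M <= m)%N ->
  0 <= s -> s < t -> t <= pi ->
  sin (m%:R * s) = - sigma * E2 s -> cos (m%:R * s) = sigma * E1 s ->
  sin (m%:R * t) = sigma * E2 t -> cos (m%:R * t) = - sigma * E1 t ->
  (forall u w, s < u -> u < w -> w < t ->
    0 < (E1 u * sin (m%:R * u) + E2 u * cos (m%:R * u)) *
        (E1 w * sin (m%:R * w) + E2 w * cos (m%:R * w))) ->
  `|m%:R * (t - s) - pi| <= eta.
Proof.
move=> eta0; have pi2 : 2 <= pi :> R by exact: pi_ge2.
pose et := Num.min eta 1; have et0 : 0 < et by rewrite lt_min eta0 ltr01.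
have et1 : et <= 1 by rewrite ge_min lexx orbT.
have c1 : cos et < 1.
  by rewrite -(cos0 R) ltr_cos ?in_itv /= ?lexx ?ltW //; lra.
(* e <= 1/2 keeps inner products of nearby vectors positive, and e^2 < 1 - cos et makes them exceed
   cos et. *)
pose e := Num.min (1 / 2) (1 - cos et).
have e0 : 0 < e by rewrite lt_min; lra.
have e12 : e <= 1 / 2 by rewrite ge_min lexx.
have ec : e ^+ 2 < 1 - cos et.
  by apply: (@lt_le_trans _ _ e); [nra|rewrite ge_min lexx orbT].
have [d d0 dP] := E_unif e0.
exists (Num.truncn (3 * pi / 2 / d)).+1 => m sigma s t Mm s0 st tpi ss cs si ct noF.
have md : 3 * pi / 2 < m%:R * d.
  rewrite -ltr_pdivrMr //; apply: lt_le_trans (truncnS_gt _) _.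
  by rewrite ler_nat.
have m0 : (0 : R) < m%:R by rewrite -(pmulr_lgt0 _ d0); lra.
have sI : 0 <= s <= pi by rewrite s0; lra.
have tI : 0 <= t <= pi by rewrite tpi andbT; lra.
have sig2 : sigma ^+ 2 = 1.
  by have := cos2Dsin2 (m%:R * s); rewrite ss cs; have := E_unit sI => E; move=> <-; rewrite -[LHS]mulr1 -E; ring.
have step c : 0 < c -> c <= 3 * pi / 2 -> c / m%:R < d.
  by move=> c0 c3; rewrite ltr_pdivrMr // mulrC; lra.
(* Otherwise the points u with m u = m s + pi/2 and m s + 3 pi/2 both precede t. There (sin, cos)
   takes opposite values while (E1, E2) has hardly moved from s, so the expression in [noF] changes
   sign. *)
have w32 : m%:R * (t - s) <= 3 * pi / 2.
  rewrite leNgt; apply/negP => w.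
  have near c : 0 < c -> c <= 3 * pi / 2 -> s < s + c / m%:R < t /\ 0 < inner (s + c / m%:R) s.
    move=> c0 c3; have cm : 0 < c / m%:R by rewrite divr_gt0.
    have ut : s + c / m%:R < t.
      by rewrite -ltrBrDl ltr_pdivrMr // mulrC; lra.
    split; first by rewrite ut andbT; lra.
    have uI : 0 <= s + c / m%:R <= pi by apply/andP; split; lra.
    have [|h1 h2] := dP _ _ uI sI.
      by rewrite addrAC subrr add0r gtr0_norm // step.
    by apply: lt_trans (inner_close uI sI h1 h2); nra.
  have [/andP[u1 u2] i1] := near (pi / 2) ltac:(lra) ltac:(lra).
  have [/andP[w1 w2] i2] := near (3 * pi / 2) ltac:(lra) ltac:(lra).
  have uw : s + pi / 2 / m%:R < s + 3 * pi / 2 / m%:R.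
    by rewrite ltrD2l ltr_pM2r ?invr_gt0 //; lra.
  have := noF _ _ u1 uw w2.
  have -> : m%:R * (s + pi / 2 / m%:R) = m%:R * s + pi / 2 by field; rewrite gt_eqF.
  have -> : m%:R * (s + 3 * pi / 2 / m%:R) = m%:R * s + pi / 2 + pi by field; rewrite gt_eqF.
  rewrite sinDpi cosDpi sinDpihalf cosDpihalf ss cs.
  have -> : forall x y z w : R, (x * (sigma * E1 s) + y * - (- sigma * E2 s)) *
     (z * - (sigma * E1 s) + w * - - (- sigma * E2 s)) =
     - (sigma ^+ 2 * ((x * E1 s + y * E2 s) * (z * E1 s + w * E2 s))).
    by move=> x y z w'; ring.
  by rewrite sig2 mul1r oppr_gt0 ltNge ltW // mulr_gt0.
have ts : `|t - s| < d.
  by rewrite gtr0_norm ?subr_gt0 //; rewrite -(ltr_pM2l m0); lra.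
have [h1 h2] := dP _ _ tI sI ts.
have := inner_close tI sI h1 h2; rewrite /inner => ic.
set w := m%:R * (t - s) in w32 *.
(* The cosine controls w - pi because |w - pi| <= pi, which is what [w32] and w > 0 provide. *)
have cw : cos (w - pi) = inner t s.
  have -> : cos (w - pi) = - cos w by rewrite cosB cospi sinpi; ring.
  rewrite /w mulrBr cosB ss cs si ct /inner -[RHS]mul1r -sig2; ring.
have w0 : 0 < w by rewrite mulr_gt0 // subr_gt0.
have cn : cos `|w - pi| = cos (w - pi).
  by case: (leP 0 (w - pi)) => h; [rewrite ger0_norm|rewrite ltr0_norm // cosN].
have wl : `|w - pi| <= pi by rewrite ler_norml; lra.
rewrite leNgt; apply/negP => ew.
have : cos `|w - pi| < cos et.
  rewrite ltr_cos ?in_itv /= ?normr_ge0 //; last by lra.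
  by apply: le_lt_trans ew; rewrite ge_min lexx.
by rewrite cn cw /inner; lra.
Qed.

End Phase.

(** * Continuous extension of the phase to the band edges *)

Section Extension.
Variable R : realType.
Implicit Types (f : R -> R) (F G K N : {poly R}) (a b x : R).

Lemma continuous_unif f a b e : continuous f -> 0 < e -> exists2 d, 0 < d &
  forall s t, a <= s <= b -> `|s - t| < d -> `|f s - f t| < e.
Proof.
move=> cf e0.
have e20 : 0 < e / 2 by rewrite divr_gt0.
have /compact_near_coveringP cov := @segment_compact R a b.
have Q : \forall d \near 0^'+, `[a, b] `<=`
    (fun s => forall t, `|s - t| < d -> `|f s - f t| < e).
  apply: cov => x _.
  have /cvgrPdist_lt /(_ _ e20) /nbhs_ballP[r /= r0 rP] := cf x.
  have r20 : 0 < r / 2 by rewrite divr_gt0.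
  near=> x' d => t td.
  have xx' : `|x - x'| < r / 2 by near: x'; exact: nbhsx_ballx.
  have dr : d < r / 2 by near: d; exact: nbhs_right_lt.
  have h1 : `|f x - f x'| < e / 2 by apply: rP; apply: lt_trans xx' _; lra.
  have h2 : `|f x - f t| < e / 2.
    apply: rP; rewrite /ball /=; apply: le_lt_trans (ler_distD x' x t) _.
    by rewrite [ltRHS]splitr ltrD // (lt_trans td).
  by have := ler_distD (f x) (f x') (f t); rewrite (distrC (f x') (f x)); lra.
have [d [dP d0]] := filter_ex (filterI Q (nbhs_right_gt (0 : R))).
by exists d => // s t sI; apply: dP; rewrite /= in_itv.
Unshelve. all: by end_near. Qed.

(** A bounded quotient has no pole at an end: a zero of N there is also a zero of G, and cancelling
    the common factor lowers the degree of N. *)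
Lemma bounded_ratio a b G N : a < b ->
  (forall x, a < x < b -> N.[x] != 0 /\ `|G.[x]| <= `|N.[x]|) ->
  exists G0 N0, G * N0 = G0 * N /\ forall x, a <= x <= b -> N0.[x] != 0.
Proof.
move=> ab; have [n] := ubnP (size N); elim: n => // n IH in G N *; rewrite ltnS => sN GN.
have [ends|noends] := pselect (N.[a] != 0 /\ N.[b] != 0).
  exists G, N; split=> // x /andP[]; rewrite !le_eqVlt.
  move=> /orP[/eqP <- _|ax /orP[/eqP ->|xb]]; [by case: ends|by case: ends|].
  by have [] := GN x; rewrite ?ax.
have N0 : N != 0.
  have [|Nm _] := GN ((a + b) / 2); first by apply/andP; split; lra.
  by apply: contraNneq Nm => ->; rewrite horner0.
(* The bound |G| <= |N| reaches the end points through this polynomial: positive at an end, it would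
   be positive nearby inside. *)
pose p := G ^+ 2 - N ^+ 2.
have p_le0 x : a < x < b -> p.[x] <= 0.
  move=> /GN[_ h]; rewrite /p hornerD hornerN !horner_exp.
  rewrite -[G.[x] ^+ 2]real_normK ?num_real // -[N.[x] ^+ 2]real_normK ?num_real //.
  by rewrite subr_le0 lerXn2r ?nnegrE.
have pa : p.[a] <= 0.
  rewrite leNgt; apply/negP => pa; have pa0 : p.[a] != 0 by rewrite gt_eqF.
  have p0 : p != 0 by apply: contraNneq pa0 => ->; rewrite horner0.
  have [y yI] := neighpr_wit ab p0.
  have := sgr_neighprN pa0 yI; rewrite (gtr0_sg pa) => /eqP; rewrite sgr_cp0 => py.
  move: yI; rewrite /neighpr in_itv /= => /andP[ay yn].
  have := next_root_in p a b; rewrite in_itv /= max_l ?(ltW ab) // => /andP[_ nb].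
  have yb : y < b by apply: lt_le_trans nb.
  by have := p_le0 y; rewrite ay yb => /(_ isT); rewrite leNgt py.
have pb : p.[b] <= 0.
  rewrite leNgt; apply/negP => pb; have pb0 : ~~ root p b by rewrite rootE gt_eqF.
  have p0 : p != 0 by apply: contraNneq pb0 => ->; rewrite root0.
  have [y yI] := neighpl_wit ab p0.
  have := sgr_neighplN pb0 yI; rewrite (gtr0_sg pb) => /eqP; rewrite sgr_cp0 => py.
  move: yI; rewrite /neighpl in_itv /= => /andP[ay yn].
  have := prev_root_in p a b; rewrite in_itv /= min_l ?(ltW ab) // => /andP[na _].
  have ya : a < y by apply: le_lt_trans ay.
  by have := p_le0 y; rewrite ya yn => /(_ isT); rewrite leNgt py.
have [x0 [x0P Nx0 Gx0]] : exists x0, [/\ x0 = a \/ x0 = b, root N x0 & root G x0].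
  have get z : p.[z] <= 0 -> N.[z] = 0 -> root G z.
    move=> pz Nz; move: pz; rewrite /p hornerD hornerN !horner_exp Nz expr0n subr0 => h.
    by rewrite rootE -sqrf_eq0 eq_le h sqr_ge0.
  have [Na|Na] := eqVneq N.[a] 0.
    by exists a; split; [left|rewrite rootE Na|apply: get].
  have [Nb|Nb] := eqVneq N.[b] 0.
    by exists b; split; [right|rewrite rootE Nb|apply: get].
  by case: noends.
have [N1 N1E] := factor_theorem _ _ Nx0; have [G1 G1E] := factor_theorem _ _ Gx0.
have N10 : N1 != 0 by apply: contraNneq N0 => h; rewrite N1E h mul0r.
have sN1 : (size N1 < n)%N.
  by move: sN; rewrite N1E size_Mmonic ?monicXsubC // size_XsubC addn2.
have [|G2 [N2 [GN2 N2P]]] := IH G1 N1 sN1.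
  move=> x xI; have [Nx Gx] := GN x xI.
  have xx0 : x - x0 != 0.
    by rewrite subr_eq0; apply: contraTneq xI => ->; case: x0P => ->; rewrite ltxx ?andbF.
  move: Nx Gx; rewrite N1E G1E !hornerM !hornerXsubC mulf_eq0 negb_or => /andP[-> _].
  by rewrite !normrM ler_pM2r // normr_gt0.
by exists G2, N2; split=> //; rewrite G1E N1E mulrAC GN2 mulrA.
Qed.

Lemma sgp_near_right F a b : a < b -> exists s, \forall x \near a^'+, Num.sg F.[x] = s.
Proof.
move=> ab; have [->|F0] := eqVneq F 0.
  by exists 0; near=> x; rewrite horner0 sgr0.
exists (sgp_right F a); near=> x.
apply: (@sgr_neighpr _ b); rewrite /neighpr in_itv /=; apply/andP; split; near: x.
  exact: nbhs_right_gt.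
by apply: nbhs_right_lt; rewrite next_root_gt.
Unshelve. all: by end_near. Qed.

Lemma sgp_near_left F a b : a < b -> exists s, \forall x \near b^'-, Num.sg F.[x] = s.
Proof.
move=> ab; have [->|F0] := eqVneq F 0.
  by exists 0; near=> x; rewrite horner0 sgr0.
have [y yI] := neighpl_wit ab F0; exists (Num.sg F.[y]); near=> x.
apply: (@sgr_neighpl_same _ F a b) => //.
rewrite /neighpl in_itv /=; apply/andP; split; near: x.
  by apply: nbhs_left_gt; rewrite prev_root_lt.
exact: nbhs_left_lt.
Unshelve. all: by end_near. Qed.

(* [N] may vanish at [a] and [b], where the quotient then has to be reduced. *)
Lemma signed_ratio_extension a b F K N : a < b ->
  (forall x, a < x < b -> [/\ 0 <= K.[x], 0 < N.[x] & F.[x] ^+ 2 * K.[x] <= N.[x]]) ->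
  exists2 h, {within `[a, b], continuous h} &
    forall x, a < x < b -> h x = F.[x] * Num.sqrt K.[x] / Num.sqrt N.[x].
Proof.
move=> ab FKN; pose e x := F.[x] * Num.sqrt K.[x] / Num.sqrt N.[x].
(* The square of the quotient is rational and at most 1, so it can be reduced. The sign lost by
   squaring is that of F, which is constant near each end. *)
have [|G0 [N0 [GN0 N0P]]] := @bounded_ratio a b (F ^+ 2 * K) N ab.
  move=> x /FKN[K0 Np le]; split; first by rewrite gt_eqF.
  by rewrite hornerM horner_exp (ger0_norm (ltW Np)) ger0_norm // mulr_ge0 ?sqr_ge0.
pose g x := Num.sqrt (G0.[x] / N0.[x]).
have eE x : a < x < b -> e x = Num.sg F.[x] * g x.
  move=> xI; have [K0 Np _] := FKN x xI.
  have N0x : N0.[x] != 0 by apply: N0P; case/andP: xI => /ltW -> /ltW ->.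
  have -> : g x = Num.sqrt (F.[x] ^+ 2 * K.[x] / N.[x]).
    congr Num.sqrt; have := congr1 (horner^~ x) GN0; rewrite hornerM [(_ * K).[x]]hornerM horner_exp hornerM => E.
    by apply/eqP; rewrite eqr_div ?(gt_eqF Np) // -E mulrC.
  have h1 : 0 <= F.[x] ^+ 2 * K.[x] by rewrite mulr_ge0 ?sqr_ge0.
  rewrite (sqrtrM _ h1) (sqrtrM _ (sqr_ge0 _)) sqrtr_sqr (sqrtrV (ltW Np)).
  by rewrite /e [F.[x] in LHS]numEsg !mulrA.
have gc x : a <= x <= b -> {for x, continuous g}.
  move=> xI; apply: continuous_comp; last exact: sqrt_continuous.
  apply: cvgM; first exact: continuous_horner.
  by apply: cvgV; [apply: N0P|exact: continuous_horner].
have [sa saP] := sgp_near_right F ab; have [sb sbP] := sgp_near_left F ab.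
exists (fun x => if x <= a then sa * g a else if b <= x then sb * g b else e x); last first.
  by move=> x /andP[ax xb]; rewrite leNgt ax /= leNgt xb.
set h := fun x => _.
have hE x : a < x < b -> h x = e x.
  by move=> /andP[ax xb]; rewrite /h leNgt ax /= leNgt xb.
apply/continuous_within_itvP => //; split.
- move=> x; rewrite in_itv /= => xI.
  have ec : {for x, continuous e}.
    have [_ Np _] := FKN x xI.
    apply: cvgM; last first.
      apply: cvgV; first by rewrite gt_eqF // sqrtr_gt0.
      apply: continuous_comp; [exact: continuous_horner|exact: sqrt_continuous].
    apply: cvgM; first exact: continuous_horner.
    apply: continuous_comp; [exact: continuous_horner|exact: sqrt_continuous].
  rewrite /continuous_at hE //; apply: cvg_trans ec; apply: near_eq_cvg.
  near=> y; rewrite hE //; apply/andP; split; near: y.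
    by apply: lt_nbhsr; case/andP: xI.
  by apply: lt_nbhsl; case/andP: xI.
- have -> : h a = sa * g a by rewrite /h lexx.
  have cg : (fun x => sa * g x) @ a^'+ --> sa * g a.
    apply: cvgM; first exact: cvg_cst.
    by apply: cvg_at_right_filter; apply: gc; rewrite lexx ltW.
  apply: cvg_trans cg; apply: near_eq_cvg; near=> y.
  have yI : a < y < b.
    by apply/andP; split; near: y; [exact: nbhs_right_gt|exact: nbhs_right_lt].
  by rewrite hE // eE //; congr (_ * _); apply/esym; near: y.
- have -> : h b = sb * g b by rewrite /h lexx leNgt ab.
  have cg : (fun x => sb * g x) @ b^'- --> sb * g b.
    apply: cvgM; first exact: cvg_cst.
    by apply: cvg_at_left_filter; apply: gc; rewrite lexx ltW.
  apply: cvg_trans cg; apply: near_eq_cvg; near=> y.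
  have yI : a < y < b.
    by apply/andP; split; near: y; [exact: nbhs_left_gt|exact: nbhs_left_lt].
  by rewrite hE // eE //; congr (_ * _); apply/esym; near: y.
Unshelve. all: by end_near. Qed.

End Extension.

(** Gives the value at an edge of an extension known only inside: its one-sided limit is that of any
    continuous formula valid nearby. *)
Lemma edge_limit (R : realType) (h g : R -> R) (a b x : R) : a < b ->
  {within `[a, b], continuous h} -> {for x, continuous g} -> x = a \/ x = b ->
  (\forall y \near x, a < y < b -> h y = g y) -> h x = g x.
Proof.
move=> ab /(continuous_within_itvP _ ab)[_ ha hb] gx xe hg.
case: xe => xE; rewrite {x}xE in gx hg *.
  apply: (@cvg_unique _ (@Rhausdorff R) (h @ a^'+)) => //.
  apply: cvg_trans (cvg_at_right_filter gx); apply: near_eq_cvg; near=> y.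
  have yI : a < y < b.
    by apply/andP; split; near: y; [exact: nbhs_right_gt|exact: nbhs_right_lt].
  apply/esym; move: yI; near: y; exact: cvg_within.
apply: (@cvg_unique _ (@Rhausdorff R) (h @ b^'-)) => //.
apply: cvg_trans (cvg_at_left_filter gx); apply: near_eq_cvg; near=> y.
have yI : a < y < b.
  by apply/andP; split; near: y; [exact: nbhs_left_gt|exact: nbhs_left_lt].
apply/esym; move: yI; near: y; exact: cvg_within.
Unshelve. all: by end_near. Qed.

Section BandPhase.
Variables (R : realType) (p : nat) (a b alpha beta : nat -> R).
Hypothesis p_gt0 : (1 <= p)%N.
Hypothesis jac : periodic_jacobi p a b.
Hypothesis bands : are_bands p a b alpha beta.
Let D := discriminant p a b.
Let P n := opoly a b n.

Let a_gt0 n : (1 <= n)%N -> 0 < a n.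
Proof. by case: jac => h _ _ _; apply: h. Qed.

Variables (j r : nat).
Hypothesis jp : (1 <= j <= p)%N.
Let al := alpha j.
Let be := beta j.
Let Q := period_wronskian p a b r.
Let N := amplitude p a b r.
Let f := P (r + p) - (2^-1)%:P * D * P r.
(** Equal to sin^2 th where Delta = 2 cos th. *)
Let K := 1 - ((2^-1)%:P * D) ^+ 2.

Let ab : al < be. Proof. exact: (band_lt bands). Qed.

Let KE x : K.[x] = 1 - (D.[x] / 2) ^+ 2.
Proof. by rewrite /K hornerD hornerN horner_exp hornerM !hornerC mulrC. Qed.

Let fE x : f.[x] = (P (r + p)).[x] - D.[x] / 2 * (P r).[x].
Proof. by rewrite /f hornerD hornerN !hornerM hornerC (mulrC 2^-1). Qed.

Let NE x : N.[x] = f.[x] ^+ 2 + K.[x] * (P r).[x] ^+ 2.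
Proof. by rewrite /N amplitude_square fE KE. Qed.

Let D4 x : al < x < be -> D.[x] ^+ 2 < 4.
Proof. by move=> /(band_in bands jp) /andP[h1 h2]; rewrite -/D in h1 h2; nra. Qed.

Let K_gt0 x : al < x < be -> 0 < K.[x].
Proof. by move=> /D4 h; rewrite KE; lra. Qed.

Let N_gt0 x : al < x < be -> 0 < N.[x].
Proof. by move=> /D4; apply: amplitude_gt0. Qed.

Lemma period_wronskian_sg : exists2 c, c ^+ 2 = 1 & forall x, al < x < be -> Num.sg Q.[x] = c.
Proof.
have mI : al < (al + be) / 2 < be by rewrite !(midf_lt ab).
have Q0 x : al < x < be -> Q.[x] != 0 by move=> /D4; apply: period_wronskian_neq0.
exists (Num.sg Q.[(al + be) / 2]); first by rewrite sqr_sg Q0.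
move=> x xI; apply: (@polyrN0_itv _ `]al, be[); rewrite ?in_itv //.
Qed.

(** The sign of [Q], constant on the open band, is built in so that at a zero of p_(r + m p) the
    vector (sin, cos) (m th) equals (- e2, e1) times the sign of the next polynomial. The last
    clause gives the values needed to keep this true at an edge. *)
Lemma phase_functions : exists e1 e2 : R -> R,
  [/\ {within `[al, be], continuous e1}, {within `[al, be], continuous e2},
      forall x, al <= x <= be -> e1 x ^+ 2 + e2 x ^+ 2 = 1,
      forall x, al < x < be -> e1 x = Num.sg Q.[x] * f.[x] / Num.sqrt N.[x] /\
        e2 x = Num.sg Q.[x] * (P r).[x] * Num.sqrt K.[x] / Num.sqrt N.[x] &
      forall x, x = al \/ x = be -> (P r).[x] = 0 -> (P (r + p)).[x] = 0 ->
        e1 x = Num.sg (P r.+1).[x] /\ e2 x = 0].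
Proof.
have [c c2 cP] := period_wronskian_sg.
have [|e1 ce1 e1P] := @signed_ratio_extension R al be (c *: f) 1 N ab.
  move=> x xI; have K0 := K_gt0 xI; rewrite hornerC ler01 N_gt0 //; split=> //.
  by rewrite hornerZ exprMn c2 mul1r mulr1 NE lerDl mulr_ge0 ?sqr_ge0 // ltW.
have [|e2 ce2 e2P] := @signed_ratio_extension R al be (c *: P r) K N ab.
  move=> x xI; rewrite ltW ?K_gt0 // N_gt0 //; split=> //.
  by rewrite hornerZ exprMn c2 mul1r NE mulrC lerDr sqr_ge0.
have e1E x : al < x < be -> e1 x = Num.sg Q.[x] * f.[x] / Num.sqrt N.[x].
  by move=> xI; rewrite e1P // hornerC sqrtr1 mulr1 hornerZ cP.
have e2E x : al < x < be ->
    e2 x = Num.sg Q.[x] * (P r).[x] * Num.sqrt K.[x] / Num.sqrt N.[x].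
  by move=> xI; rewrite e2P // hornerZ cP.
have ee x : al < x < be -> e1 x ^+ 2 + e2 x ^+ 2 = 1.
  move=> xI; have N0 := N_gt0 xI; have K0 := K_gt0 xI.
  rewrite e1E // e2E // !(exprMn, exprVn) !sqr_sqrtr ?ltW // cP // c2 !mul1r.
  by rewrite -mulrDl (mulrC _ K.[x]) -NE divff // gt_eqF.
have eedge x : x = al \/ x = be -> e1 x ^+ 2 + e2 x ^+ 2 = 1.
  move=> xe; rewrite !expr2.
  apply: (@edge_limit R (fun x => e1 x * e1 x + e2 x * e2 x) (cst 1) al be x ab) => //.
  - by move=> y; apply: cvgD; apply: cvgM; (exact: ce1 || exact: ce2).
  - exact: cvg_cst.
  - by near=> y => /ee; rewrite !expr2.
exists e1, e2; split=> //.
- move=> x; rewrite !le_eqVlt => /andP[/orP[/eqP E|ax] /orP[/eqP E'|xb]].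
  + by apply: eedge; left.
  + by apply: eedge; left.
  + by apply: eedge; right.
  + by apply: ee; rewrite ax.
- by move=> x xI; rewrite e1E // e2E.
- move=> x xe v0 v10.
  have Dx : D.[x] ^+ 2 = 4 by apply: (band_end bands jp).
  have [f1 [Q1 [N1 [f1E Q1E N1E N1x pos]]]] := edge_zero_expansion p_gt0 jac Dx v0 v10.
  have f10 : f1.[x] != 0 by apply: contraTneq pos => ->; rewrite !mul0r ltxx.
  have Q10 : Q1.[x] != 0 by apply: contraTneq pos => ->; rewrite mulr0 ltxx.
  have u0 : (P r.+1).[x] != 0 by apply: contraTneq pos => ->; rewrite mulr0 mul0r ltxx.
  have e1x : e1 x = Num.sg (P r.+1).[x].
    pose g y := Num.sg Q1.[x] * f1.[y] / Num.sqrt N1.[y].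
    have -> : Num.sg (P r.+1).[x] = g x.
      have fs : f1.[x] / `|f1.[x]| = Num.sg f1.[x].
        by rewrite {1}[f1.[x]]numEsg mulfK ?normr_eq0.
      rewrite /g N1x sqrtr_sqr -mulrA fs.
      have := gtr0_sg pos; rewrite !sgrM => E.
      rewrite -[LHS]mulr1 -E.
      have := sqr_sg (P r.+1).[x]; rewrite u0 => E'.
      rewrite (_ : _ * _ = Num.sg (P r.+1).[x] ^+ 2 * (Num.sg Q1.[x] * Num.sg f1.[x])).
        by rewrite E' mul1r.
      by ring.
    apply: (@edge_limit R e1 g al be x ab) => //.
      apply: cvgM; last first.
        apply: cvgV; first by rewrite gt_eqF // sqrtr_gt0 N1x exprn_even_gt0.
        apply: continuous_comp; [exact: continuous_horner|exact: sqrt_continuous].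
      by apply: cvgM; [exact: cvg_cst|exact: continuous_horner].
    near=> y => yI; rewrite e1E // /g.
    have yx : y - x != 0.
      by rewrite subr_eq0; apply: contraTneq yI => ->; case: xe => ->; rewrite ltxx ?andbF.
    have sgy : Num.sg Q1.[y] = Num.sg Q1.[x].
      have Qn : 0 < Q1.[y] * Q1.[x].
        near: y; apply: (@cvgr_gt _ _ _ _ (fun y => Q1.[y] * Q1.[x]) (Q1.[x] * Q1.[x])).
          by apply: cvgM; [exact: continuous_horner|exact: cvg_cst].
        by rewrite -expr2 exprn_even_gt0.
      have := gtr0_sg Qn; rewrite sgrM => E.
      have := sqr_sg Q1.[x]; rewrite Q10 expr2 => E'.
      by rewrite -[LHS]mulr1 -[X in _ * X]E' mulrA E mul1r.
    have Qy : Q.[y] = (y - x) * Q1.[y] by rewrite /Q Q1E hornerM hornerXsubC.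
    have fy : f.[y] = (y - x) * f1.[y] by rewrite /f f1E hornerM hornerXsubC.
    have Ny : N.[y] = (y - x) ^+ 2 * N1.[y].
      by rewrite /N N1E hornerM horner_exp hornerXsubC.
    rewrite Qy fy Ny sgrM sgy (sqrtrM _ (sqr_ge0 _)) sqrtr_sqr.
    have n0 : `|y - x| != 0 by rewrite normr_eq0.
    have N10 : Num.sqrt N1.[y] != 0.
      rewrite gt_eqF // sqrtr_gt0; near: y.
      apply: (@cvgr_gt _ _ _ _ (fun y => N1.[y]) N1.[x]); first exact: continuous_horner.
      by rewrite N1x exprn_even_gt0.
    have n1 : Num.sg (y - x) * (y - x) = `|y - x| by rewrite [RHS]normrEsg.
    apply/eqP; rewrite eqr_div ?mulf_neq0 // -n1; apply/eqP; ring.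
  split=> //; have := eedge x xe; rewrite e1x sqr_sg u0 => /eqP.
  by rewrite -subr_eq0 addrAC subrr add0r sqrf_eq0 => /eqP.
Unshelve. all: by end_near. Qed.

(** Up to sign the values are affine in m and of eventually constant sign; a zero at a late m makes
    the affine function vanish identically. *)
Lemma edge_zero_eventually : exists M : nat, forall m x, (M <= m)%N -> x = al \/ x = be ->
  (P (r + m * p)).[x] = 0 -> (P r).[x] = 0 /\ (P (r + p)).[x] = 0.
Proof.
suff edge x : D.[x] ^+ 2 = 4 -> exists M, forall m, (M <= m)%N ->
    (P (r + m * p)).[x] = 0 -> (P r).[x] = 0 /\ (P (r + p)).[x] = 0.
  have [M1 h1] := edge al (band_end bands jp (or_introl erefl)).
  have [M2 h2] := edge be (band_end bands jp (or_intror erefl)).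
  exists (maxn M1 M2) => m x; rewrite geq_max => /andP[m1 m2] [] ->.
    exact: h1.
  exact: h2.
move=> Dx; pose tau := D.[x] / 2.
have tau2 : tau ^+ 2 = 1 by rewrite /tau expr_div_n Dx; field.
have tau0 : tau != 0.
  by apply/eqP => t0; move: tau2 => /eqP; rewrite t0 expr0n eq_sym oner_eq0.
have DE : D.[x] = 2 * tau by rewrite /tau mulrC divfK.
set c := (P r).[x]; set d := tau * (P (r + p)).[x] - c.
have [M [s sP]] := linear_sign c d.
exists M => m Mm Pm.
have lin k : tau ^+ k * (P (r + k * p)).[x] = c + k%:R * d by apply: opoly_edge.
have s0 : s = 0 by rewrite -(sP m Mm) -lin Pm mulr0 sgr0.
have z k : (M <= k)%N -> c + k%:R * d = 0.
  by move=> /sP; rewrite s0 => /eqP; rewrite sgr_eq0 => /eqP.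
have d0 : d = 0.
  have := z M.+1 (leqnSn M); rewrite -natr1; have := z M (leqnn M); lra.
have c0 : c = 0 by have := z M (leqnn M); rewrite d0 mulr0 addr0.
split=> //; move: d0; rewrite /d c0 subr0 => /eqP.
by rewrite mulf_eq0 (negbTE tau0) => /eqP.
Qed.

Lemma phase_at_zero (e1 e2 : R -> R) m x th :
  (forall x, al < x < be -> e1 x = Num.sg Q.[x] * f.[x] / Num.sqrt N.[x] /\
     e2 x = Num.sg Q.[x] * (P r).[x] * Num.sqrt K.[x] / Num.sqrt N.[x]) ->
  (forall x, x = al \/ x = be -> (P r).[x] = 0 -> (P (r + p)).[x] = 0 ->
     e1 x = Num.sg (P r.+1).[x] /\ e2 x = 0) ->
  (forall x, x = al \/ x = be -> (P (r + m * p)).[x] = 0 ->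
     (P r).[x] = 0 /\ (P (r + p)).[x] = 0) ->
  al <= x <= be -> 0 <= th <= pi -> D.[x] = 2 * cos th ->
  (P (r + m * p)).[x] = 0 ->
  sin (m%:R * th) = - Num.sg (P (r + m * p).+1).[x] * e2 x /\
  cos (m%:R * th) = Num.sg (P (r + m * p).+1).[x] * e1 x.
Proof.
move=> einner eedge edge0 xI thI Dx Px.
set S := sin _; set C := cos _; set um := (P _.+1).[x].
have [inner|xe] : al < x < be \/ (x = al \/ x = be).
  move: xI; rewrite !le_eqVlt => /andP[/orP[/eqP E|ax] /orP[/eqP E'|xb]].
  + by right; left. + by right; left. + by right; right. + by left; rewrite ax.
- have [-> ->] := einner x inner.
  have N0 := N_gt0 inner; have K0 := K_gt0 inner.
  set v := (P r).[x]; set s := sin th; set g := f.[x].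
  have s0 : 0 < s.
    rewrite lt_neqAle sin_ge0_pi // andbT eq_sym.
    apply: contraTneq (D4 inner) => s0; rewrite -leNgt Dx.
    by have := cos2Dsin2 th; rewrite -/s s0; lra.
  have Ks : Num.sqrt K.[x] = s.
    rewrite KE Dx (_ : 1 - _ = s ^+ 2); first by rewrite sqrtr_sqr gtr0_norm.
    by have := cos2Dsin2 th; rewrite -/s => E; lra.
  have gE : g = (P (r + p)).[x] - cos th * v by rewrite /g fE Dx -/v; field.
  have NE' : N.[x] = g ^+ 2 + s ^+ 2 * v ^+ 2.
    by rewrite NE -/g -/v -Ks sqr_sqrtr // ltW.
  have Pz : S * g + C * (s * v) = 0.
    have := opoly_sin p_gt0 jac r m Dx; rewrite -/P Px mulr0 -/S -/C -/s -/v -gE.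
    by move=> <-.
  have uz : s * um = S * ((P (r.+1 + p)).[x] - cos th * (P r.+1).[x]) + C * (s * (P r.+1).[x]).
    by have := opoly_sin p_gt0 jac r.+1 m Dx.
  have SC : C ^+ 2 + S ^+ 2 = 1 by exact: cos2Dsin2.
  (* At the zero, (g, s v) is orthogonal to (S, C), so it is t times (C, - S), and t^2 is the
     amplitude. *)
  pose t := C * g - S * (s * v).
  have t2 : t ^+ 2 = N.[x].
    rewrite NE' -[RHS]mul1r -SC -[LHS]addr0 -[X in _ + X](expr0n R 2) -Pz /t; ring.
  have Ct : C * t = g.
    rewrite -[RHS]mul1r -SC (_ : C * t = C ^+ 2 * g + S ^+ 2 * g - S * (S * g + C * (s * v))).
      by rewrite Pz mulr0 subr0 mulrDl.
    by rewrite /t; ring.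
  have St : S * t = - (s * v).
    rewrite -[s * v]mul1r -SC (_ : S * t = - ((C ^+ 2 + S ^+ 2) * (s * v)) + C * (S * g + C * (s * v))).
      by rewrite Pz mulr0 addr0.
    by rewrite /t; ring.
  (* The next polynomial has the value Q / t, so its sign and that of Q recover the sign of t. *)
  have ut : um * t = Q.[x].
    apply: (mulfI (lt0r_neq0 s0)); rewrite mulrA uz mulrDl mulrAC St mulrAC Ct gE.
    rewrite /Q /period_wronskian hornerD hornerN !hornerM -/(P _) -/v; ring.
  have rho : Num.sqrt N.[x] = `|t| by rewrite -t2 sqrtr_sqr.
  have t0 : t != 0 by rewrite -sqrf_eq0 t2 gt_eqF.
  have Q0 : Q.[x] != 0 by rewrite period_wronskian_neq0 // D4.
  have um0 : um != 0 by apply: contraNneq Q0 => u0; rewrite -ut u0 mul0r.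
  have sgQ : Num.sg um * Num.sg Q.[x] = Num.sg t.
    by rewrite -ut sgrM mulrA -expr2 sqr_sg um0 mul1r.
  have tt : Num.sg t / `|t| = t^-1.
    by rewrite normrEsg invfM mulrA divff ?sgr_eq0 // mul1r.
  rewrite rho Ks; split.
    apply: (mulIf t0); rewrite St.
    rewrite (_ : _ * t = - (Num.sg um * Num.sg Q.[x]) / `|t| * t * (v * s)); last by ring.
    by rewrite sgQ mulNr tt mulNr mulVf // mulN1r mulrC.
  apply: (mulIf t0); rewrite Ct.
  rewrite (_ : _ * t = (Num.sg um * Num.sg Q.[x]) / `|t| * t * g); last by ring.
  by rewrite sgQ tt mulVf // mul1r.
- have [v0 v10] := edge0 x xe Px; have [-> ->] := eedge x xe v0 v10.
  rewrite mulr0.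
  have Dx4 : D.[x] ^+ 2 = 4 by apply: (band_end bands jp).
  have tau2 : cos th ^+ 2 = 1 by move: Dx4; rewrite Dx; lra.
  have s0 : sin th = 0.
    by apply/eqP; rewrite -sqrf_eq0; apply/eqP; have := cos2Dsin2 th; rewrite tau2; lra.
  have [S0 C0] : S = 0 /\ C = cos th ^+ m.
    rewrite /S /C; elim: m {S C um Px edge0} => [|m [IH1 IH2]].
      by rewrite mul0r sin0 cos0 expr0.
    by rewrite -natr1 mulrDl mul1r sinD cosD s0 IH1 IH2 exprSr; split; ring.
  split=> //.
  have u0 : (P r.+1).[x] != 0 by exact: opoly_coprime.
  (* Here C' = 0 and A = cos th = +-1, so a period multiplies p_(r+1) by cos th, and the affine
     function of [opoly_edge] is constant. *)
  have u1 : cos th * (P (r.+1 + p)).[x] = (P r.+1).[x].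
    have [C' [_ _ _ [A [B [D' [AD det e1' e2']]]]]] := amplitude_factor p_gt0 jac r.
    have Cx : C'.[x] = 0.
      have := congr1 (horner^~ x) e1'; rewrite -/(P _) hornerD !hornerM -/(P r) v0 -/(P (r + p)) v10 mulr0 addr0.
      by move=> /esym/eqP; rewrite mulf_eq0 (negbTE u0) orbF => /eqP.
    have det' : A.[x] * D'.[x] = 1.
      by have := congr1 (horner^~ x) det; rewrite hornerD hornerN !hornerM Cx mulr0 subr0 hornerC.
    have AD' : A.[x] + D'.[x] = 2 * cos th by rewrite -hornerD AD.
    have Ac : A.[x] = cos th.
      have : (A.[x] - cos th) ^+ 2 = 0.
        rewrite (_ : _ ^+ 2 = A.[x] * (A.[x] - 2 * cos th) + cos th ^+ 2); last by ring.
        by rewrite -AD' tau2 (_ : _ - _ = - D'.[x]); [rewrite mulrN det' addNr|ring].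
      by move=> /eqP; rewrite sqrf_eq0 subr_eq0 => /eqP.
    have -> : (P (r.+1 + p)).[x] = A.[x] * (P r.+1).[x].
      by rewrite {1}/P e2' hornerD !hornerM -/(P r) v0 mulr0 addr0.
    by rewrite Ac mulrA -expr2 tau2 mul1r.
  have um' : cos th ^+ m * um = (P r.+1).[x].
    have := opoly_edge p_gt0 jac r.+1 m tau2 Dx; rewrite -/P u1 subrr mulr0 addr0.
    by rewrite addSn.
  have sgc : Num.sg (cos th) = cos th.
    have : (cos th - 1) * (cos th + 1) = 0 by rewrite -(subrr (cos th ^+ 2)) [X in _ = _ - X]tau2; ring.
    move=> /eqP; rewrite mulf_eq0 subr_eq0 addr_eq0 => /orP[/eqP ->|/eqP ->].
      by rewrite sgr1.
    by rewrite sgrN sgr1.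
  have um0 : um != 0 by apply: contraNneq u0 => h; rewrite -um' h mulr0.
  rewrite C0 -um' sgrM sgrX sgc mulrCA -expr2 sqr_sg um0 mulr1 //.
Qed.

End BandPhase.

(** * Spacing of consecutive zeros in angle and in k *)

Section Spacing.
Variables (R : realType) (p : nat) (a b alpha beta : nat -> R).
Hypothesis p_gt0 : (1 <= p)%N.
Hypothesis jac : periodic_jacobi p a b.
Hypothesis bands : are_bands p a b alpha beta.
Let D := discriminant p a b.
Let P n := opoly a b n.

Let a_gt0 n : (1 <= n)%N -> 0 < a n.
Proof. by case: jac => h _ _ _; apply: h. Qed.

(** At a zero of p_n the Wronskian is - p_(n+1) p_n', so p_(n+1) has the sign opposite to that of
    p_n', which alternates between consecutive simple zeros. *)
Lemma next_zero_sign n x y : x < y -> (P n).[x] = 0 -> (P n).[y] = 0 ->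
  (forall z, x < z < y -> (P n).[z] != 0) ->
  Num.sg (P n.+1).[y] = - Num.sg (P n.+1).[x].
Proof.
move=> xy Px Py noz.
have [q1 q1E] := factor_theorem _ _ (introT rootP Px).
have yx : y - x != 0 by rewrite subr_eq0 gt_eqF.
have : root q1 y.
  have := Py; rewrite q1E hornerM hornerXsubC => /eqP.
  by rewrite mulf_eq0 (negbTE yx) orbF rootE.
move=> /factor_theorem[c cE]; rewrite {q1}cE in q1E.
have dx : (P n)^`().[x] = - (y - x) * c.[x].
  rewrite q1E !derivM !derivXsubC !hornerE; ring.
have dy : (P n)^`().[y] = (y - x) * c.[y].
  rewrite q1E !derivM !derivXsubC !hornerE; ring.
have Wx := wronskian_gt0 b a_gt0 n x; have Wy := wronskian_gt0 b a_gt0 n y.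
rewrite wronskianE -/(P _) -/(P _) Px mulr0 sub0r dx mulNr mulrN opprK in Wx.
rewrite wronskianE -/(P _) -/(P _) Py mulr0 sub0r dy in Wy.
have yx0 : 0 < y - x by rewrite subr_gt0.
have {}Wx : 0 < (P n.+1).[x] * c.[x] by rewrite mulrCA pmulr_rgt0 // in Wx.
have {}Wy : (P n.+1).[y] * c.[y] < 0 by rewrite mulrCA oppr_gt0 pmulr_rlt0 // in Wy.
have cc : 0 < c.[x] * c.[y].
  rewrite lt_neqAle leNgt eq_sym; apply/andP; split.
    apply/eqP => /eqP; rewrite mulf_eq0 => /orP[/eqP h|/eqP h].
      by move: Wx; rewrite h mulr0 ltxx.
    by move: Wy; rewrite h mulr0 ltxx.
  apply/negP => /(poly_ivtoo (ltW xy))[z]; rewrite in_itv /= => zI cz.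
  by have := noz z zI; rewrite q1E !hornerM (rootP cz) !mul0r eqxx.
have := gtr0_sg Wx; have := ltr0_sg Wy; have := gtr0_sg cc; rewrite !sgrM.
set sx := Num.sg c.[x]; set sy := Num.sg c.[y] => E1 E2 E3.
have sx2 : sx ^+ 2 = 1.
  by rewrite sqr_sg (_ : c.[x] != 0) //; apply: contraTneq cc => ->; rewrite mul0r ltxx.
have sy2 : sy ^+ 2 = 1.
  by rewrite sqr_sg (_ : c.[y] != 0) //; apply: contraTneq cc => ->; rewrite mulr0 ltxx.
have sxy : sx = sy by rewrite -[LHS]mulr1 -sy2 expr2 mulrA E1 mul1r.
have -> : Num.sg (P n.+1).[x] = sx by rewrite -[LHS]mulr1 -sx2 expr2 mulrA E3 mul1r.
by rewrite sxy -[LHS]mulr1 -sy2 expr2 mulrA E2 mulN1r.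
Qed.

Variables (j r : nat) (X : R -> R).
Hypothesis jp : (1 <= j <= p)%N.
Hypothesis cX : continuous X.
Hypothesis X_band : forall th, alpha j <= X th <= beta j.
Hypothesis X_cos : forall th, D.[X th] = 2 * cos th.
Hypothesis X_surj : forall x, alpha j <= x <= beta j ->
  exists2 th, 0 <= th <= pi & X th = x.

Lemma X_between s th t : 0 <= s -> s < th -> th < t -> t <= pi ->
  X s < X th < X t \/ X t < X th < X s.
Proof.
move=> s0 sth tht tpi.
have inj : {in `[0%R, pi] &, injective X}.
  move=> u v uI vI E; apply: cos_inj => //.
  by have := X_cos u; rewrite E X_cos => /(mulfI _); rewrite pnatr_eq0 => /(_ isT).
have sI : s \in `[0%R, pi] by rewrite in_itv /= s0; lra.
have tI : t \in `[0%R, pi] by rewrite in_itv /= tpi andbT; lra.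
have thI : th \in `[0%R, pi] by rewrite in_itv /=; apply/andP; split; lra.
have [mono|mono] := itv_continuous_inj_mono (continuous_subspaceT cX) inj.
  by left; rewrite !mono.
by right; rewrite !mono.
Qed.

Lemma X_preimage_between s t z : 0 <= s -> s < t -> t <= pi ->
  X s < z < X t \/ X t < z < X s -> exists th, [/\ s < th, th < t & X th = z].
Proof.
move=> s0 st tpi zI.
have zb : alpha j <= z <= beta j.
  have /andP[s1 s2] := X_band s; have /andP[t1 t2] := X_band t.
  case: zI => /andP[/ltW h1 /ltW h2].
    by rewrite (le_trans s1) // (le_trans h2).
  by rewrite (le_trans t1) // (le_trans h2).
have [th /andP[th0 thpi] E] := X_surj zb; exists th; rewrite -{z zb}E in zI *.
split=> //; rewrite ltNge le_eqVlt; apply/negP => /orP[/eqP h|h].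
- by move: zI; rewrite h ltxx ?andbF; case=> // /andP[]; rewrite ltxx.
- case: (X_between th0 h st tpi) zI => /andP[h1 h2] [] /andP[h3 h4].
  + by have := lt_trans h1 h3; rewrite ltxx.
  + by have := lt_trans h1 (lt_trans h2 h3); rewrite ltxx.
  + by have := lt_trans h1 (lt_trans h2 h4); rewrite ltxx.
  + by have := lt_trans h4 h2; rewrite ltxx.
- by move: zI; rewrite h ltxx ?andbF; case=> // /andP[]; rewrite ltxx.
- case: (X_between s0 st h thpi) zI => /andP[h1 h2] [] /andP[h3 h4].
  + by have := lt_trans h2 h4; rewrite ltxx.
  + by have := lt_trans h1 (lt_trans h2 h4); rewrite ltxx.
  + by have := lt_trans h1 (lt_trans h2 h3); rewrite ltxx.
  + by have := lt_trans h1 h3; rewrite ltxx.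
Qed.

Lemma phase_zero_spacing eta : 0 < eta -> exists M : nat, forall m s t, (M <= m)%N ->
  0 <= s -> s < t -> t <= pi ->
  (P (r + m * p)).[X s] = 0 -> (P (r + m * p)).[X t] = 0 ->
  (forall th, s < th -> th < t -> (P (r + m * p)).[X th] != 0) ->
  `|m%:R * (t - s) - pi| <= eta.
Proof.
move=> eta0.
have [e1 [e2 [ce1 ce2 e12 einner eedge]]] := phase_functions p_gt0 jac bands r jp.
have [M0 M0P] := edge_zero_eventually p_gt0 jac bands r jp.
pose E1 th := e1 (X th); pose E2 th := e2 (X th).
have cE1 : continuous E1 by apply: continuous_comp_within ce1 cX _ => th; rewrite /= in_itv /= X_band.
have cE2 : continuous E2 by apply: continuous_comp_within ce2 cX _ => th; rewrite /= in_itv /= X_band.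
have unif e : 0 < e -> exists2 d, 0 < d & forall s t,
    0 <= s <= pi -> 0 <= t <= pi -> `|s - t| < d ->
    `|E1 s - E1 t| < e /\ `|E2 s - E2 t| < e.
  move=> e0; have [d1 d10 h1] := continuous_unif 0 pi cE1 e0.
  have [d2 d20 h2] := continuous_unif 0 pi cE2 e0.
  exists (Num.min d1 d2); first by rewrite lt_min d10.
  by move=> s t sI _; rewrite lt_min => /andP[/(h1 _ _ sI) ? /(h2 _ _ sI) ?].
have [M MP] := phase_spacing (fun th _ => e12 _ (X_band th)) unif eta0.
exists (maxn M M0) => m s t; rewrite geq_max => /andP[Mm M0m] s0 st tpi Ps Pt noz.
have sI : 0 <= s <= pi by rewrite s0; lra.
have tI : 0 <= t <= pi by rewrite tpi andbT; lra.
have zero th : 0 <= th <= pi -> (P (r + m * p)).[X th] = 0 ->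
    sin (m%:R * th) = - Num.sg (P (r + m * p).+1).[X th] * E2 th /\
    cos (m%:R * th) = Num.sg (P (r + m * p).+1).[X th] * E1 th.
  move=> thI; apply: (phase_at_zero p_gt0 jac bands jp einner eedge) => //.
  by move=> x xe; exact: M0P.
have [ss cs] := zero s sI Ps; have [si ct] := zero t tI Pt.
have alt : Num.sg (P (r + m * p).+1).[X t] = - Num.sg (P (r + m * p).+1).[X s].
  have btw z : X s < z < X t \/ X t < z < X s -> (P (r + m * p)).[z] != 0.
    move=> zI.
    by have [th [h1 h2 <-]] := X_preimage_between s0 st tpi zI; apply: noz.
  have [lt|gt|E] := ltgtP (X s) (X t).
  - by apply: next_zero_sign => // z zI; apply: btw; left.
  - by rewrite (next_zero_sign gt Pt Ps (fun z zI => btw z (or_intror zI))) opprK.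
  - have [h1 h2] := midf_lt st.
    by have := X_between s0 h1 h2 tpi; rewrite E => -[] /andP[h3 /(lt_trans h3)]; rewrite ltxx.
rewrite alt in si ct.
apply: (MP m (Num.sg (P (r + m * p).+1).[X s]) s t) => //.
  by rewrite si opprK.
move=> u w su uw wt.
(* Up to the fixed sign c, the phase expression is a positive multiple of p_(r + m p), so having no
   zero between s and t means having constant sign there. *)
have [c c2 cP] : exists2 c : R, c ^+ 2 = 1 & forall th, s < th -> th < t -> exists2 k, 0 < k &
    E1 th * sin (m%:R * th) + E2 th * cos (m%:R * th) = c * k * (P (r + m * p)).[X th].
  have [c c2 cP] := period_wronskian_sg p_gt0 jac bands r jp.
  exists c => // th sth tht.
  have thI : 0 < th < pi by rewrite (le_lt_trans s0 sth) (lt_le_trans tht).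
  have xI : alpha j < X th < beta j.
    have /andP[xs1 xs2] := X_band s; have /andP[xt1 xt2] := X_band t.
    case: (X_between s0 sth tht tpi) => /andP[h1 h2].
      by rewrite (le_lt_trans xs1 h1) (lt_le_trans h2).
    by rewrite (le_lt_trans xt1 h1) (lt_le_trans h2).
  have s1 : 0 < sin th by exact: sin_gt0_pi.
  have [e1E e2E] := einner _ xI.
  have A0 : 0 < (amplitude p a b r).[X th].
    apply: amplitude_gt0 => //; rewrite X_cos exprMn.
    by have := cos2Dsin2 th; have := exprn_gt0 2 s1; lra.
  exists (sin th / Num.sqrt (amplitude p a b r).[X th]).
    by rewrite divr_gt0 // sqrtr_gt0.
  have := opoly_sin p_gt0 jac r m (X_cos th); rewrite -/P => oE.
  rewrite (_ : c * _ * _ = c / Num.sqrt (amplitude p a b r).[X th] * (sin th * (P (r + m * p)).[X th])); last by ring.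
  have Ks : Num.sqrt (1 - ((2^-1)%:P * discriminant p a b) ^+ 2).[X th] = sin th.
    rewrite (_ : _.[X th] = sin th ^+ 2); first by rewrite sqrtr_sqr gtr0_norm.
    rewrite hornerD hornerN horner_exp hornerM !hornerC -/D X_cos exprMn exprMn.
    by have := cos2Dsin2 th; lra.
  rewrite oE /E1 /E2 e1E e2E (cP _ xI) Ks hornerD hornerN !hornerM hornerC -/D X_cos -/P; field.
  by rewrite gt_eqF // sqrtr_gt0.
have [k1 k10 ->] := cP u su ltac:(lra); have [k2 k20 ->] := cP w ltac:(lra) wt.
rewrite (_ : _ * _ = c ^+ 2 * (k1 * k2) * ((P (r + m * p)).[X u] * (P (r + m * p)).[X w])); last by ring.
rewrite c2 mul1r (pmulr_rgt0 _ (mulr_gt0 k10 k20)).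
have Pu : (P (r + m * p)).[X u] != 0 by apply: noz => //; lra.
have Pw : (P (r + m * p)).[X w] != 0 by apply: noz => //; lra.
rewrite lt_def mulf_neq0 //= leNgt; apply/negP => neg.
have u0 : 0 <= u by lra.
have wpi : w <= pi by rewrite (le_trans (ltW wt)).
have inI z : X u < z < X w \/ X w < z < X u -> exists2 th, s < th < t & X th = z.
  move=> /(X_preimage_between u0 uw wpi)[th [h1 h2 <-]]; exists th => //.
  by rewrite (lt_trans su h1) (lt_trans h2).
have [lt|gt] := leP (X u) (X w).
  have [z] := poly_ivtoo lt neg; rewrite in_itv /= => zI /rootP Pz.
  have [th /andP[h1 h2] E] := inI z (or_introl zI).
  by have := noz th h1 h2; rewrite E Pz eqxx.
rewrite mulrC in neg.
have [z] := poly_ivtoo (ltW gt) neg; rewrite in_itv /= => zI /rootP Pz.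
have [th /andP[h1 h2] E] := inI z (or_intror zI).
by have := noz th h1 h2; rewrite E Pz eqxx.
Qed.

End Spacing.

(** For n = r + m p, c = pi, rho = r / p and w = m |s - t|, the number n times the increment of k,
    minus 1, is ((w - pi) m + rho w) / (pi m). The condition 2 < m e absorbs rho w. *)
Lemma spacing_arith (R : realFieldType) (c m e rho w : R) : 2 <= c -> 1 <= m -> 2 < m * e ->
  0 <= rho -> rho <= 1 -> 0 <= w -> `|w - c| <= e ->
  `|(w - c) * m + rho * w| <= 2 * e * (c * m).
Proof.
move=> c2 m1 me r0 r1 w0 wc; have m0 : 0 <= m by lra.
have e0 : 0 < e by rewrite -(@pmulr_rgt0 _ m); lra.
apply: le_trans (ler_normD _ _) _; rewrite !normrM (ger0_norm m0) (ger0_norm r0) (ger0_norm w0).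
have h1 : `|w - c| * m <= e * m by rewrite ler_wpM2r.
have h2 : rho * w <= c + e.
  have := ler_norm (w - c); have : rho * w <= w by rewrite ler_piMl.
  lra.
have h3 : e <= e * m by rewrite ler_peMr // ltW.
have h4 : 2 * (2 * (e * m) - 1) <= c * (2 * (e * m) - 1) by rewrite ler_wpM2r //; lra.
have -> : 2 * e * (c * m) = c * (2 * (e * m) - 1) + c by ring.
lra.
Qed.

Section ZeroSpacing.
Variables (R : realType) (n : nat) (a b alpha beta : nat -> R).
Let p := n.+1.
Hypothesis jac : periodic_jacobi p a b.
Hypothesis bands : are_bands p a b alpha beta.
Let D := discriminant p a b.
Variable X : nat -> R -> R.
Hypothesis cX : forall j, continuous (X j).
Hypothesis X_band : forall j th, (1 <= j <= p)%N -> alpha j <= X j th <= beta j.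
Hypothesis X_cos : forall j th, (1 <= j <= p)%N -> D.[X j th] = 2 * cos th.
Hypothesis X_surj : forall j x, (1 <= j <= p)%N -> alpha j <= x <= beta j ->
  exists2 th, 0 <= th <= pi & X j th = x.
Variable dk : probability (measurableTypeR R) R.
Hypothesis dk_eq : equilibrium_measure (band_union p alpha beta) dk.

Let a_gt0 k : (1 <= k)%N -> 0 < a k.
Proof. by case: jac => h _ _ _; apply: h. Qed.

Lemma band_zeros_consecutive k j l : (1 <= l < num_zeros a b alpha beta k j)%N ->
  let z := band_zeros a b alpha beta k j in
  [/\ alpha j <= z`_l.-1, z`_l.-1 < z`_l, z`_l <= beta j,
      (opoly a b k).[z`_l.-1] = 0 /\ (opoly a b k).[z`_l] = 0 &
      forall x, z`_l.-1 < x < z`_l -> (opoly a b k).[x] != 0].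
Proof.
move=> /andP[l0 lz]; move=> z; have P0 : opoly a b k != 0 by exact: opoly_neq0.
have zs : sorted <%R z.
  by apply: sorted_filter; [exact: lt_trans|exact: sorted_roots].
have memz x : (x \in z) = (alpha j <= x <= beta j) && root (opoly a b k) x.
  by rewrite mem_filter in_itv /= mem_rootsR.
have lz' : (l.-1 < size z)%N by apply: leq_ltn_trans lz; exact: leq_pred.
have := mem_nth 0 lz; rewrite -/z memz => /andP[/andP[ly yb] /rootP Py].
have := mem_nth 0 lz'; rewrite memz => /andP[/andP[ax xb] /rootP Px].
have ltE := lt_sorted_ltn_nth 0 zs.
have xy : z`_l.-1 < z`_l by rewrite ltE ?inE //; lia.
split=> // x /andP[h1 h2]; apply/negP => /eqP Pxx.
have xz : x \in z.
  by rewrite memz rootE Pxx eqxx andbT (le_trans ax (ltW h1)) (le_trans (ltW h2)).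
have iz : (index x z < size z)%N by rewrite index_mem.
move: h1 h2; rewrite -(nth_index 0 xz) !ltE ?inE //; lia.
Qed.

Lemma spacing_error_small r j e : (r < p)%N -> (1 <= j <= p)%N -> 0 < e ->
  exists M, forall m l, (M <= m)%N ->
    (1 <= l < num_zeros a b alpha beta (r + m * p) j)%N ->
    spacing_error a b alpha beta dk (r + m * p) j l <= 2 * e.
Proof.
move=> rp jp e0.
have [M MP] := phase_zero_spacing (isT : (1 <= p)%N) jac bands r jp (@cX j)
  (fun th => X_band th jp) (fun th => X_cos th jp) (fun x => @X_surj j x jp) e0.
have pi0 : (0 : R) < pi by exact: pi_gt0.
exists (maxn M (Num.truncn (2 / e)).+1) => m l; rewrite geq_max => /andP[Mm em] lP.
have m0 : (0 : R) < m%:R by rewrite ltr0n; lia.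
have me : 2 < m%:R * e.
  rewrite -ltr_pdivrMr //; apply: lt_le_trans (truncnS_gt _) _.
  by rewrite ler_nat.
have [] := band_zeros_consecutive lP; rewrite /spacing_error /=.
set z := band_zeros _ _ _ _ _ _; set k := (r + m * p)%N.
set x := z`_l.-1; set y := z`_l => ax xy yb [Px Py] noz.
have [s /andP[s0 spi] Es] : exists2 th, 0 <= th <= pi & X j th = x.
  by apply: X_surj => //; rewrite ax (le_trans (ltW xy)).
have [t /andP[t0 tpi] Et] : exists2 th, 0 <= th <= pi & X j th = y.
  by apply: X_surj => //; rewrite yb andbT (le_trans ax (ltW xy)).
have sp : `|m%:R * `|s - t| - pi| <= e.
  have btw u w th : 0 <= u -> u < th -> th < w -> w <= pi ->
      (X j u = x /\ X j w = y) \/ (X j u = y /\ X j w = x) -> (opoly a b k).[X j th] != 0.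
    move=> u0 uth thw wpi E; apply: noz.
    have := X_between (@cX j) (fun th => X_cos th jp) u0 uth thw wpi.
    case: E => [[-> ->]|[-> ->]] [] // /andP[h1 h2].
      by have := lt_trans h1 (lt_trans h2 xy); rewrite ltxx.
    by have := lt_trans h1 (lt_trans h2 xy); rewrite ltxx.
  have [st|ts|E] := ltgtP s t.
  - rewrite [`|s - t|]ltr0_norm ?subr_lt0 // opprB; apply: MP => //; rewrite ?Es ?Et //.
    by move=> th h1 h2; apply: (btw s t) => //; left.
  - rewrite [`|s - t|]gtr0_norm ?subr_gt0 //; apply: MP => //; rewrite ?Es ?Et //.
    by move=> th h1 h2; apply: (btw t s) => //; right.
  - by move: xy; rewrite -Es -Et E ltxx.
have -> : eq_cdf alpha dk y - eq_cdf alpha dk x = `|s - t| / (pi * p%:R).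
  rewrite -Es -Et; apply: (eq_cdf_band jac bands cX X_band X_cos X_surj dk_eq jp); rewrite ?s0 ?t0 //.
  by rewrite Es Et ltW.
have k0 : (0 : R) < k%:R by move: m0; rewrite !ltr0n addn_gt0 muln_gt0 => ->; rewrite orbT.
have p0 : (0 : R) < p%:R by rewrite ltr0n.
rewrite -[X in X * _](gtr0_norm k0) -normrM mulrBr divff ?gt_eqF //.
have rho : exists2 rho : R, 0 <= rho <= 1 & r%:R = rho * p%:R.
  exists (r%:R / p%:R); last by rewrite divfK // gt_eqF.
  by rewrite divr_ge0 ?ler0n // ler_pdivrMr // mul1r ler_nat ltnW.
have [rh /andP[rh0 rh1] rhE] := rho.
move: sp; set w := m%:R * `|s - t| => sp.
have -> : k%:R * (`|s - t| / (pi * p%:R)) - 1 = ((w - pi) * m%:R + rh * w) / (pi * m%:R).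
  have cE (c P S q : R) : c != 0 -> P != 0 -> S != 0 ->
      (rh * P + S * P) * (q / (c * P)) - 1 = ((S * q - c) * S + rh * (S * q)) / (c * S).
    by move=> c0 P0 S0; field; rewrite c0 P0 S0.
  rewrite /k natrD natrM rhE (cE _ _ _ _ (lt0r_neq0 pi0) (lt0r_neq0 p0) (lt0r_neq0 m0)) -/w.
  by [].
have w0 : 0 <= w by rewrite mulr_ge0 // ltW.
rewrite normrM normfV (gtr0_norm (mulr_gt0 pi0 m0)) ler_pdivrMr ?mulr_gt0 //.
have m1 : (1 : R) <= m%:R by move: m0; rewrite ltr0n ler1n.
exact: (spacing_arith (pi_ge2 R) m1 me rh0 rh1 w0 sp).
Qed.

End ZeroSpacing.

(** * The three assertions *)

Lemma num_zeros_shift (R : realType) (p : nat) (a b alpha beta : nat -> R) :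
  (1 <= p)%N -> periodic_jacobi p a b -> are_bands p a b alpha beta ->
  forall c j : nat, (1 <= j <= p)%N ->
  exists D : int, \forall m \near \oo,
    (num_zeros a b alpha beta (m * p + c).-1 j)%:Z = m%:Z - D.
Proof.
move=> p0 jac bands c j jp; have [N NP] := num_zeros_affine p0 jac bands.
(* N + 1 periods ensure N <= n0 even when c = 0; from there on each period adds one zero. *)
pose n0 := (N.+1 * p + c).-1.
exists (N.+1%:Z - (num_zeros a b alpha beta n0 j)%:Z); exists N.+1 => // m /= Nm.
have Nn0 : (N <= n0)%N by rewrite /n0 mulSn; nia.
have -> : (m * p + c).-1 = (n0 + (m - N.+1) * p)%N.
  have : (0 < N.+1 * p)%N by rewrite muln_gt0.
  rewrite /n0 -[in LHS](subnK Nm) mulnDl; move: (N.+1 * p)%N ((m - N.+1) * p)%N => A B; lia.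
rewrite NP // PoszD -subzn //; lia.
Qed.

Lemma num_zeros_bounded (R : realType) (p : nat) (a b alpha beta : nat -> R) :
  (1 <= p)%N -> periodic_jacobi p a b -> are_bands p a b alpha beta ->
  has_ubound [set r : R | exists n j : nat, (1 <= j <= p)%N /\
    r = `|n%:R / p%:R - (num_zeros a b alpha beta n j)%:R|].
Proof.
move=> p0 jac bands; have [N NP] := num_zeros_affine p0 jac bands.
have pR : (1 : R) <= p%:R by rewrite ler1n.
have small n j : `|n%:R / p%:R - (num_zeros a b alpha beta n j)%:R : R| <= n%:R + n%:R.
  apply: le_trans (ler_normB _ _) _; rewrite !ger0_norm ?divr_ge0 ?ler0n //.
  apply: lerD; last by rewrite ler_nat (num_zeros_le alpha beta jac).
  by rewrite ler_pdivrMr ?(lt_le_trans ltr01) // ler_peMr.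
exists ((N + p)%:R + (N + p)%:R) => x [n [j [jp ->]]].
have mon k : (k <= N + p)%N -> (k%:R + k%:R : R) <= (N + p)%:R + (N + p)%:R.
  by move=> kN; rewrite lerD ?ler_nat.
have [nN|Nn] := ltnP n N.
  by apply: le_trans (small n j) (mon _ _); apply: ltnW (ltn_addr _ _).
(* Removing whole periods lowers n / p and the count by the same integer, and leaves an index below
   N + p. *)
have nE : n = (N + (n - N) %% p + (n - N) %/ p * p)%N.
  by have := divn_eq (n - N) p; lia.
have lN : (N <= N + (n - N) %% p)%N by exact: leq_addr.
rewrite nE NP //; set n0 := (N + _)%N; set m := (_ %/ _)%N.
have -> : (n0 + m * p)%:R / p%:R - (num_zeros a b alpha beta n0 j + m)%:R =
    n0%:R / p%:R - (num_zeros a b alpha beta n0 j)%:R :> R.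
  by rewrite !natrD natrM; field; rewrite gt_eqF // (lt_le_trans ltr01).
apply: le_trans (small n0 j) (mon _ _).
by rewrite /n0 leq_add2l ltnW // ltn_mod.
Qed.

Lemma spacing_cvg (R : realType) (p : nat) (a b alpha beta : nat -> R)
    (dk : probability (measurableTypeR R) R) :
  (1 <= p)%N -> periodic_jacobi p a b -> are_bands p a b alpha beta ->
  equilibrium_measure (band_union p alpha beta) dk ->
  (fun n : nat =>
     \big[Num.max/0]_(1 <= j < p.+1)
       \big[Num.max/0]_(1 <= l < num_zeros a b alpha beta n j)
         spacing_error a b alpha beta dk n j l) @ \oo --> (0 : R).
Proof.
case: p => // n _ jac bands dk_eq; set p := n.+1.
have /choice[X XP] : forall j, exists X : R -> R, continuous X /\ ((1 <= j <= p)%N ->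
    [/\ forall th, alpha j <= X th <= beta j,
      forall th, (discriminant p a b).[X th] = 2 * cos th &
      forall x, alpha j <= x <= beta j -> exists2 th, 0 <= th <= pi & X th = x]).
  move=> j; have [jp|nj] := boolP (1 <= j <= p)%N.
    by have [X [cX h1 h2 h3]] := band_param_ex (isT : (1 <= p)%N) jac bands jp; exists X.
  by exists (cst 0); split=> // x; exact: cvg_cst.
have cX j : continuous (X j) by case: (XP j).
have Xb j th : (1 <= j <= p)%N -> alpha j <= X j th <= beta j by case: (XP j) => _ h /h[].
have Xc j th : (1 <= j <= p)%N -> (discriminant p a b).[X j th] = 2 * cos th.
  by case: (XP j) => _ h /h[].
have Xs j x : (1 <= j <= p)%N -> alpha j <= x <= beta j ->
    exists2 th, 0 <= th <= pi & X j th = x by case: (XP j) => _ h /h[_ _]; apply.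
apply/cvgrPdist_le => e e0.
have e2 : 0 < e / 2 by rewrite divr_gt0.
(* The thresholds of [spacing_error_small] depend on the residue r and on the band j, of which there
   are finitely many. *)
have [M MP] : exists M, forall r m, (r < p)%N -> (M <= m)%N ->
    forall j l, (1 <= j <= p)%N -> (1 <= l < num_zeros a b alpha beta (r + m * p) j)%N ->
      spacing_error a b alpha beta dk (r + m * p) j l <= e.
  apply: eventually_below => r rp.
  have [M MP] : exists M, forall j m, (j < p.+1)%N -> (M <= m)%N -> (1 <= j)%N ->
      forall l, (1 <= l < num_zeros a b alpha beta (r + m * p) j)%N ->
      spacing_error a b alpha beta dk (r + m * p) j l <= e.
    apply: eventually_below => j; rewrite ltnS => jp.
    case: (posnP j) => [->|j0]; first by exists 0%N.
    have jI : (1 <= j <= p)%N by rewrite j0.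
    have [M MP] := spacing_error_small jac bands cX Xb Xc Xs dk_eq rp jI e2.
    by exists M => m Mm _ l /(MP m l Mm); rewrite mulrC divfK ?pnatr_eq0.
  by exists M => m Mm j l /andP[j1 jp] lI; apply: MP.
exists (M * p)%N => // k /= Mk; rewrite sub0r normrN ger0_norm ?bigmax_ge_id //.
rewrite big_nat; apply: bigmax_le => [|j]; first exact: ltW.
rewrite ltnS => jI; rewrite big_nat; apply: bigmax_le => [|l lI]; first exact: ltW.
have kE : k = (k %% p + k %/ p * p)%N by rewrite addnC -divn_eq.
rewrite kE in lI *; apply: MP => //; first by rewrite ltn_mod.
by rewrite leq_divRL.
Qed.

Theorem theorem2p6 (R : realType) (p : nat) (a b alpha beta : nat -> R)
    (dk : probability (measurableTypeR R) R) (p_ge1 : (1 <= p)%N)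
    (jac_ab : periodic_jacobi p a b)
    (bands : are_bands p a b alpha beta)
    (dk_eq : equilibrium_measure (band_union p alpha beta) dk) :
  [/\ forall c j : nat, (1 <= j <= p)%N ->
        exists D : int, \forall m \near \oo,
          (num_zeros a b alpha beta (m * p + c).-1 j)%:Z = m%:Z - D \/
          (num_zeros a b alpha beta (m * p + c).-1 j)%:Z = m%:Z - D + 1,
      has_ubound
        [set r : R | exists n j : nat, (1 <= j <= p)%N /\
           r = `|n%:R / p%:R - (num_zeros a b alpha beta n j)%:R|] &
      (fun n : nat =>
         \big[Num.max/0]_(1 <= j < p.+1)
           \big[Num.max/0]_(1 <= l < num_zeros a b alpha beta n j)
             spacing_error a b alpha beta dk n j l) @ \oo --> (0 : R)].
Proof.
split; [|exact: num_zeros_bounded|exact: spacing_cvg].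
move=> c j jp; have [D DP] := num_zeros_shift p_ge1 jac_ab bands c jp.
by exists D; apply: filterS DP => m ->; left.
Qed.
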